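(* Let $U_r\in\mathbb{R}^{d\times r}$ have orthonormal columns, let $m\ge1$ be an integer, and let $p(\cdot|\cdot)$ be a proposal density on $\mathbb{R}^r$. The expected acceptance probabilities $\mathbb{E}[\alpha_1]$ of the pseudo-marginal algorithm and $\mathbb{E}[\alpha_\ast]$ of the idealized marginal algorithm, both at stationarity, satisfy $$0\le\mathbb{E}[\alpha_\ast]-\mathbb{E}[\alpha_1]\le 2\sqrt{\mathcal{R}(U_r,H)} .$$ In addition, if for some constant $C$ the conditional likelihood is bounded as $\frac{g(z;y)}{\bar g(z_r;y)}\le C$ for all $z\in\mathbb{R}^d$ (with $z_r=U_r^Tz$), then $$0\le\mathbb{E}[\alpha_\ast]-\mathbb{E}[\alpha_1]\le\frac{\sqrt C}{\sqrt m}\sqrt{\mathcal{R}(U_r,H)} .$$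
   Context: Setting: $\phi^0$ denotes a standard Gaussian density (on $\mathbb{R}^d$, $\mathbb{R}^r$ or $\mathbb{R}^{d-r}$ according to its argument). The function $z\mapsto g(z;y)>0$ is a continuously differentiable likelihood on $\mathbb{R}^d$ for fixed data $y$ (in the paper $g(z;y)=f(T(z);y)$, where $f$ is the original likelihood and $T$ is a bijection pushing $\phi^0$ forward to the prior), with $\mathcal Z=\int g(z;y)\phi^0(z)\,dz\in(0,\infty)$, and $\phi^y(z)=\frac1{\mathcal Z}g(z;y)\phi^0(z)$. Let $H=\int_{\mathbb{R}^d}\nabla_z\log g(z;y)\nabla_z\log g(z;y)^T\phi^y(z)\,dz$, assumed well defined (finite trace), and $\mathcal{R}(U_r,H)=\operatorname{trace}(H)-\operatorname{trace}(U_r^THU_r)$. Let $U_\bot\in\mathbb{R}^{d\times(d-r)}$ have orthonormal columns with $U_r^TU_\bot=0$; write $z=U_rz_r+U_\bot z_\bot$ with $z_r=U_r^Tz$, $z_\bot=U_\bot^Tz$, and $g(z_r,z_\bot;y)=g(U_rz_r+U_\bot z_\bot;y)$. The marginal likelihood is $\bar g(z_r;y)=\int_{\mathbb{R}^{d-r}}g(z_r,z_\bot;y)\phi^0(z_\bot)\,dz_\bot$, and the marginal posterior is $\phi^y(z_r)=\frac1{\mathcal Z}\bar g(z_r;y)\phi^0(z_r)$. Write $a\wedge b=\min\{a,b\}$. Idealized marginal algorithm: a Metropolis–Hastings chain on $\mathbb{R}^r$ targeting $\phi^y(z_r)$ with proposal $z_r'\sim p(\cdot|z_r)$ and acceptance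 probability $$\alpha_\ast(z_r,z_r')=1\wedge\frac{\bar g(z_r';y)\phi^0(z_r')p(z_r|z_r')}{\bar g(z_r;y)\phi^0(z_r)p(z_r'|z_r)} .$$ $\mathbb{E}[\alpha_\ast]$ is its expectation under $z_r\sim\phi^y(z_r)$, $z_r'\sim p(\cdot|z_r)$. Pseudo-marginal algorithm: a Metropolis–Hastings chain on the extended state $(z_r,\{z_\bot^i\}_{i=1}^m)$ targeting the density $$\phi^{y,m}(z_r,\{z_\bot^i\}_{i=1}^m)=\frac1{\mathcal Z}\phi^0(z_r)\Big(\prod_{i=1}^m\phi^0(z_\bot^i)\Big)\Big(\frac1m\sum_{i=1}^mg(z_r,z_\bot^i;y)\Big),$$ with proposal $z_r'\sim p(\cdot|z_r)$ and, independently, $z_\bot'^1,\dots,z_\bot'^m$ i.i.d. from $\phi^0$ on $\mathbb{R}^{d-r}$, and acceptance probability $$\alpha_1=1\wedge\frac{\phi^0(z_r')\sum_{i=1}^mg(z_r',z_\bot'^i;y)}{\phi^0(z_r)\sum_{i=1}^mg(z_r,z_\bot^i;y)}\,\frac{p(z_r|z_r')}{p(z_r'|z_r)} .$$ $\mathbb{E}[\alpha_1]$ is its expectation when $(z_r,\{z_\bot^i\})\sim\phi^{y,m}$ and the proposal is drawn as described. *)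

(* Defs.v *)
From HB Require Import structures.
From mathcomp Require Import all_boot all_order all_algebra.
From mathcomp Require Import all_classical all_reals all_analysis.

Set Implicit Arguments.
Unset Strict Implicit.
Unset Printing Implicit Defensive.

Import Order.TTheory GRing.Theory Num.Theory.
Import numFieldNormedType.Exports.

Local Open Scope classical_set_scope.
Local Open Scope ring_scope.

(* Matrices carry the sigma-algebra generated by the entries; on 'cV[R]_n this
   is the Borel sigma-algebra of R^n. *)

Definition measure_matrix_display : measure_display -> measure_display.
Proof. exact. Qed.

Section measurable_matrix.
Context {d} {T : measurableType d} (m n : nat).

Definition matrix_measurable : set (set 'M[T]_(m, n)) :=
  <<s \bigcup_(ij in [set: 'I_m * 'I_n])
        preimage_set_system setT (fun M : 'M[T]_(m, n) => M ij.1 ij.2)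
          measurable >>.

HB.instance Definition _ := @isMeasurable.Build (measure_matrix_display d)
  'M[T]_(m, n) matrix_measurable
  (@sigma_algebra0 _ _ _) (@sigma_algebraC _ _) (@sigma_algebra_bigcup _ _ _).

Lemma measurable_fun_matrixP d' (S : measurableType d') (f : S -> 'M[T]_(m, n)) :
  (forall i j, measurable_fun setT (fun s => f s i j)) ->
  measurable_fun setT f.
Proof.
move=> mf _ Y mY; rewrite setTI.
have : [set A | measurable (f @^-1` A)] Y; last by [].
move: Y mY; apply: smallest_sub.
  split => /=.
  - by rewrite preimage_set0.
  - by move=> A mA; rewrite setTD preimage_setC; exact: measurableC.
  - by move=> F mF; rewrite preimage_bigcup; exact: bigcupT_measurable.
move=> _ [[i j] _ [B mB <-]] /=; rewrite setTI.
by have := mf i j measurableT B mB; rewrite setTI.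
Qed.

Lemma measurable_matrix_entry i j :
  measurable_fun setT (fun M : 'M[T]_(m, n) => M i j).
Proof.
move=> _ B mB; apply: sub_sigma_algebra; exists (i, j) => //.
by exists B.
Qed.

End measurable_matrix.

(* Image of a sigma-finite measure by a measurable map with a measurable left
   inverse. *)
Section measure_image.
Context d1 d2 (T1 : measurableType d1) (T2 : measurableType d2) (R : realType).
Variables (phi : T1 -> T2) (psi : T2 -> T1).
Hypotheses (mphi : measurable_fun setT phi) (mpsi : measurable_fun setT psi).
Hypothesis phiK : cancel phi psi.
Variable mu : {sigma_finite_measure set T1 -> \bar R}.

Let mphi_mixin := isMeasurableFun.Build _ _ _ _ _ mphi.
Let phi_mfun : {mfun T1 >-> T2} := HB.pack phi mphi_mixin.
Let nu := pushforward mu phi_mfun.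

Let nu0 : nu set0 = 0%E. Proof. exact: measure0. Qed.

Let nu_ge0 A : (0 <= nu A)%E. Proof. exact: measure_ge0. Qed.

Let nu_sigma_additive : semi_sigma_additive nu.
Proof. exact: measure_semi_sigma_additive. Qed.

HB.instance Definition _ := isMeasure.Build _ _ _ nu
  nu0 nu_ge0 nu_sigma_additive.

Let nu_sigma_finite : sigma_finite setT nu.
Proof.
have [F FT Foo] := sigma_finiteT mu.
exists (fun k => psi @^-1` F k); first by rewrite -preimage_bigcup -FT.
move=> k; have [mFk Fkoo] := Foo k; split.
  by rewrite -[X in measurable X]setTI; exact: mpsi.
rewrite /nu /pushforward -comp_preimage (_ : _ \o _ = id) ?preimage_id//.
by apply/funext => x /=; rewrite phiK.
Qed.

HB.instance Definition _ := Measure_isSigmaFinite.Build _ _ _ nu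
  nu_sigma_finite.

Definition measure_image : {sigma_finite_measure set T2 -> \bar R} := nu.

Lemma measure_imageE A : measure_image A = mu (phi @^-1` A).
Proof. by []. Qed.

End measure_image.

(* m1 \x m2, bundled with its sigma-finiteness: the canonical instance of the
   library is available for subprobabilities only *)
Section product_sigma_finite.
Context d1 d2 (T1 : measurableType d1) (T2 : measurableType d2) (R : realType).
Variables (m1 : {sigma_finite_measure set T1 -> \bar R})
  (m2 : {sigma_finite_measure set T2 -> \bar R}).

Let prod := (m1 \x m2)%E.

HB.instance Definition _ := Measure.on prod.

Let prod_sigma_finite : sigma_finite setT prod.
Proof.
have /sigma_finiteP[F [TF ndF Foo]] := sigma_finiteT m1.
have /sigma_finiteP[G [TG ndG Goo]] := sigma_finiteT m2.
exists (fun n => F n `*` G n).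
  rewrite -setXTT TF TG predeqE => -[x y]; split.
    move=> [/= [n _ Fnx] [k _ Gky]]; exists (maxn n k) => //; split.
    - by move: x Fnx; exact/subsetPset/ndF/leq_maxl.
    - by move: y Gky; exact/subsetPset/ndG/leq_maxr.
  by move=> [n _ []/= ? ?]; split; exists n.
move=> k; have [? ?] := Foo k; have [? ?] := Goo k.
split; first exact: measurableX.
by rewrite /prod product_measure1E// lte_mul_pinfty// ge0_fin_numE.
Qed.

HB.instance Definition _ := Measure_isSigmaFinite.Build _ _ _ prod
  prod_sigma_finite.

Definition product_sigma_finite :
  {sigma_finite_measure set (T1 * T2)%type -> \bar R} := prod.

End product_sigma_finite.

Definition dirac_sigma_finite d (T : measurableType d) (R : realType) (a : T) :
  {sigma_finite_measure set T -> \bar R} := \d_a.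

Section power_measure.
Context d (T : measurableType d) (R : realType).

Definition tuple_cons n (x : T * n.-tuple T) : n.+1.-tuple T :=
  [tuple of x.1 :: x.2].

Definition tuple_uncons n (t : n.+1.-tuple T) : T * n.-tuple T :=
  (thead t, [tuple of behead t]).

Lemma tuple_consK n : cancel (@tuple_cons n) (@tuple_uncons n).
Proof.
case=> x t; rewrite /tuple_uncons /tuple_cons theadE; congr pair; exact/val_inj.
Qed.

Lemma measurable_tuple_cons n : measurable_fun setT (@tuple_cons n).
Proof. exact: (@measurable_cons _ _ (T * n.-tuple T)%type T fst n snd). Qed.

Lemma measurable_tuple_uncons n : measurable_fun setT (@tuple_uncons n).
Proof.
apply: measurable_fun_pair; first exact: measurable_tnth.
exact: measurable_behead.
Qed.

Fixpoint power_measure (mu : {sigma_finite_measure set T -> \bar R}) (n : nat) :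
    {sigma_finite_measure set (n.-tuple T) -> \bar R} :=
  if n is n'.+1 then
    measure_image (@measurable_tuple_cons n') (@measurable_tuple_uncons n')
      (@tuple_consK n')
      (product_sigma_finite mu (power_measure mu n'))
  else dirac_sigma_finite R [tuple].

Local Open Scope ereal_scope.

Lemma power_measure_box (mu : {sigma_finite_measure set T -> \bar R}) n
    (A : 'I_n -> set T) : (forall i, measurable (A i)) ->
  power_measure mu n [set t | forall i, A i (tnth t i)] =
  \prod_(i < n) mu (A i).
Proof.
elim: n A => [A _|n IH A mA].
  rewrite big_ord0 /= diracE mem_set//; by case.
pose B := [set t : n.-tuple T | forall i, A (lift ord0 i) (tnth t i)].
have mB : measurable B.
  rewrite (_ : B = \bigcap_(i in [set: 'I_n])
      (@tnth n T ^~ i @^-1` A (lift ord0 i))); last first.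
    by apply/seteqP; split => t /= h i; [move=> _|]; exact: h.
  apply: fin_bigcap_measurable => // i _.
  by rewrite -[X in measurable X]setTI; exact: measurable_tnth.
rewrite big_ord_recl -IH// -product_measure1E//.
transitivity ((mu \x power_measure mu n)
    (@tuple_cons n @^-1` [set t | forall i, A i (tnth t i)])); first by [].
congr (_ _); apply/seteqP; split => -[x t] /=.
- move=> h; split; first by have := h ord0; rewrite /tuple_cons tnth0.
  by move=> i; have := h (lift ord0 i); rewrite /tuple_cons tnthS.
- move=> [h0 h] i; have [j ->|->] := unliftP ord0 i.
    by rewrite /tuple_cons tnthS; exact: h.
  by rewrite /tuple_cons tnth0.
Qed.

End power_measure.

Section lebesgue_cV.
Context (R : realType) (n : nat).
(* R with the display lebesgue_measure is stated on *)
Local Notation mR := (measurableTypeR R).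

Definition cV_of_tuple (t : n.-tuple mR) : 'cV[R]_n := \col_i tnth t i.

Definition tuple_of_cV (z : 'cV[R]_n) : n.-tuple mR := [tuple z i 0 | i < n].

Lemma cV_of_tupleK : cancel cV_of_tuple tuple_of_cV.
Proof.
by move=> t; apply/eq_from_tnth => i; rewrite tnth_mktuple mxE.
Qed.

Lemma measurable_cV_of_tuple : measurable_fun setT cV_of_tuple.
Proof.
apply: measurable_fun_matrixP => i j.
rewrite (_ : (fun _ => _) = (@tnth n mR)^~ i); last first.
  by apply/funext => t; rewrite mxE.
exact: measurable_tnth.
Qed.

Lemma measurable_tuple_of_cV : measurable_fun setT tuple_of_cV.
Proof.
apply/measurable_fun_tnthP => i.
rewrite (_ : _ \o _ = fun z : 'cV[R]_n => z i 0); last first.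
  by apply/funext => z /=; rewrite tnth_mktuple.
exact: (@measurable_matrix_entry _ R n 1 i 0).
Qed.

Definition lebesgue_cV : {sigma_finite_measure set 'cV[R]_n -> \bar R} :=
  measure_image measurable_cV_of_tuple measurable_tuple_of_cV cV_of_tupleK
    (power_measure (@lebesgue_measure R) n).

Lemma lebesgue_cV_box (A : 'I_n -> set mR) : (forall i, measurable (A i)) ->
  lebesgue_cV [set z | forall i, A i (z i 0)] =
  (\prod_(i < n) lebesgue_measure (A i))%E.
Proof.
move=> mA; rewrite -power_measure_box//.
transitivity (power_measure (@lebesgue_measure R) n
    (cV_of_tuple @^-1` [set z | forall i, A i (z i 0)])); first by [].
by congr (_ _); apply/seteqP; split => t /= h i; have := h i; rewrite mxE.
Qed.

End lebesgue_cV.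
Arguments lebesgue_cV : clear implicits.

Section gradient.
Context (R : realType) (d : nat).

Definition gradient (f : 'cV[R]_d -> R) (z : 'cV[R]_d) : 'cV[R]_d :=
  \col_i 'D_(delta_mx i 0) f z.

Definition continuously_differentiable (f : 'cV[R]_d -> R) : Prop :=
  (forall z, differentiable f z) /\ continuous (gradient f).

End gradient.

Definition gauss_pdf (R : realType) (n : nat) (z : 'cV[R]_n) : R :=
  \prod_(i < n) normal_pdf 0 1 (z i 0).

Section posterior.
Context (R : realType) (d : nat).
Variable g : 'cV[R]_d -> R.

Definition evidence : \bar R :=
  (\int[lebesgue_cV R d]_z (g z * gauss_pdf z)%:E)%E.

Definition posterior_pdf (z : 'cV[R]_d) : R :=
  g z * gauss_pdf z / fine evidence.

Definition score_outer (z : 'cV[R]_d) : 'M[R]_d :=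
  gradient (fun w => ln (g w)) z *m (gradient (fun w => ln (g w)) z)^T.

Definition Hmx_integrand (i j : 'I_d) (z : 'cV[R]_d) : R :=
  score_outer z i j * posterior_pdf z.

Definition Hmx_well_defined : Prop :=
  forall i j, (lebesgue_cV R d).-integrable setT (EFin \o Hmx_integrand i j).

Definition Hmx : 'M[R]_d :=
  \matrix_(i, j) \int[lebesgue_cV R d]_z Hmx_integrand i j z.

End posterior.

Definition trace_residual (R : realType) (d r : nat) (U : 'M[R]_(d, r))
    (H : 'M[R]_d) : R :=
  \tr H - \tr (U^T *m H *m U).

(* A conditional density q(y | x) is written q y x. *)
Definition proposal_density (R : realType) (r : nat)
    (p : 'cV[R]_r -> 'cV[R]_r -> R) : Prop :=
  [/\ measurable_fun setT (fun x : 'cV[R]_r * 'cV[R]_r => p x.1 x.2),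
      forall z' z, 0 <= p z' z &
      forall z, (\int[lebesgue_cV R r]_z' (p z' z)%:E = 1)%E].

(* E[alpha(x, y)] for x ~ pi and y ~ q(. | x), densities taken w.r.t. mu *)
Definition expected_acceptance d (X : measurableType d) (R : realType)
    (mu : {measure set X -> \bar R}) (pi : X -> R) (q : X -> X -> R)
    (alpha : X -> X -> R) : \bar R :=
  (\int[mu]_x \int[mu]_y (alpha x y * q y x * pi x)%:E)%E.

Section algorithms.
Context (R : realType) (d r : nat).
Variables (g : 'cV[R]_d -> R) (Ur : 'M[R]_(d, r)) (Up : 'M[R]_(d, d - r)).
Variable p : 'cV[R]_r -> 'cV[R]_r -> R.

Definition split_likelihood (zr : 'cV[R]_r) (zp : 'cV[R]_(d - r)) : R :=
  g (Ur *m zr + Up *m zp).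

(* Rintegral makes this 0 where the integral diverges; when the evidence is
   finite, this only concerns a null set of zr *)
Definition marginal_likelihood (zr : 'cV[R]_r) : R :=
  \int[lebesgue_cV R (d - r)]_zp (split_likelihood zr zp * gauss_pdf zp).

Definition marginal_posterior_pdf (zr : 'cV[R]_r) : R :=
  marginal_likelihood zr * gauss_pdf zr / fine (evidence g).

Definition alpha_star (zr zr' : 'cV[R]_r) : R :=
  Num.min 1
    ((marginal_likelihood zr' * gauss_pdf zr' * p zr zr') /
     (marginal_likelihood zr * gauss_pdf zr * p zr' zr)).

Definition E_alpha_star : \bar R :=
  expected_acceptance (lebesgue_cV R r) marginal_posterior_pdf p alpha_star.

Variable m : nat.

Implicit Types x y : 'cV[R]_r * m.-tuple 'cV[R]_(d - r).

Definition lebesgue_ext :=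
  product_sigma_finite (lebesgue_cV R r)
    (power_measure (lebesgue_cV R (d - r)) m).

Definition likelihood_sum x : R :=
  \sum_(i < m) split_likelihood x.1 (tnth x.2 i).

Definition gauss_pdf_tuple (zs : m.-tuple 'cV[R]_(d - r)) : R :=
  \prod_(i < m) gauss_pdf (tnth zs i).

Definition ext_posterior_pdf x : R :=
  (fine (evidence g))^-1 * gauss_pdf x.1 * gauss_pdf_tuple x.2 *
  (m%:R^-1 * likelihood_sum x).

Definition ext_proposal y x : R := p y.1 x.1 * gauss_pdf_tuple y.2.

Definition alpha_1 x y : R :=
  Num.min 1
    ((gauss_pdf y.1 * likelihood_sum y) / (gauss_pdf x.1 * likelihood_sum x) *
     (p x.1 y.1 / p y.1 x.1)).

Definition E_alpha_1 : \bar R :=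
  expected_acceptance lebesgue_ext ext_posterior_pdf ext_proposal alpha_1.

End algorithms.

(* Main.v *)
Require Import Defs.
From HB Require Import structures.
From mathcomp Require Import all_boot all_order all_algebra.
From mathcomp Require Import all_classical all_reals all_analysis.
From mathcomp Require Import measurable_realfun.
From mathcomp Require Import ring lra.
Import Order.TTheory GRing.Theory Num.Theory.
Import numFieldNormedType.Exports.
Local Open Scope classical_set_scope.
Local Open Scope ring_scope.

(* Write c(z, z') = phi(z) p(z' | z) / Z, let gb be the marginal likelihood and
   let L(z) be the average of g(z, .) over m draws from phi, so that E L(z) =
   gb(z).  At stationarity
     E[alpha_star] = int int min(c(z, z') gb(z), c(z', z) gb(z')) dz dz',
     E[alpha_1] = int int E min(c(z, z') L(z), c(z', z) L'(z')) dz dz'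
   with L and L' independent, and Jensen's inequality gives
   E[alpha_1] <= E[alpha_star].  Conversely the first minimum M exceeds the mean
   of the second one by at most half of c(z, z') E|L - gb|(z) +
   c(z', z) E|L' - gb|(z'), and also by at most M/2 times the mean of |w - w'|,
   where w = L(z) / gb(z) and w' = L'(z') / gb(z'); by AM-GM the latter is
   controlled by the variances of w and w', which are of order 1/m.

   On a fiber, f = g(z, .) satisfies
     f(X) - f(Y) = int_0^(pi/2) d/dt f(X sin t + Y cos t) dt,
   and rotating the pair of independent Gaussian vectors X, Y gives
     E|f(X) - f(Y)|^q <= (pi/2)^q E|<grad f(X), Y>|^q for q = 1, 2
   (Maurey and Pisier).  The loss with respect to the sharp Poincare constant is
   harmless: pi <= 4 suffices for both bounds.  Since Up Up^T = 1 - Ur Ur^T, the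
   fiberwise quantities E[f |grad ln f|^2] integrate to Z R(Ur, H). *)

Set Implicit Arguments.
Unset Strict Implicit.
Unset Printing Implicit Defensive.

(** * Densities and powers of measures *)

(** Square roots are kept out of the integrals. For a free parameter [t > 0], every fiberwise error
    is bounded by an expression linear in the marginal [gb z] and in the fiberwise Fisher
    information [N z]. Linear terms integrate exactly over pairs, since [c z z' * gb z] has total
    mass 1 and [c z z' * N z] has total mass [Res]. One choice of [t] at the very end brings the
    square root back; the optimal ones would give [pi / 2 * sqrt Res] and
    [pi / 4 * sqrt (C * Res / m)]. Two estimates are needed because a fiber may have infinite
    variance when the likelihood ratio is unbounded. Only first moments are used then, and that
    estimate does not improve with [m]. Both [gb z] and [N z] are finite parts of integrals that may
    diverge on a null set of [z]; if the marginal diverges, [gb z] is 0 and Jensen's inequality may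
    fail. Pointwise estimates are therefore claimed for good [z] only and integrated almost
    everywhere. They are stated additively, and extended reals are subtracted only once both terms
    are known to be finite. *)

Section density_measure.
Context d (T : measurableType d) (R : realType).
Variables (mu : {measure set T -> \bar R}) (psi : T -> R).
Hypotheses (mpsi : measurable_fun setT psi) (psi0 : forall x, 0 <= psi x).
Hypothesis psi1 : (\int[mu]_x (psi x)%:E = 1)%E.

Let mEpsi : measurable_fun setT (EFin \o psi).
Proof. exact/measurable_EFinP. Qed.

Let nu (A : set T) : \bar R := (\int[mu]_(x in A) (psi x)%:E)%E.

Let nu0 : nu set0 = 0%E. Proof. exact: integral_set0. Qed.

Let nu_ge0 A : (0 <= nu A)%E.
Proof. by apply: integral_ge0 => x _; rewrite lee_fin. Qed.

Let nu_sigma_additive : semi_sigma_additive nu.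
Proof.
move=> A mA tA mUA; rewrite /nu ge0_integral_bigcup//.
- by apply: is_cvg_ereal_nneg_natsum_cond => n _ _; exact: nu_ge0.
- exact: measurable_funTS.
- by move=> x _; rewrite lee_fin.
Qed.

HB.instance Definition _ := isMeasure.Build _ _ _ nu
  nu0 nu_ge0 nu_sigma_additive.

Let nuT : nu setT = 1%E. Proof. exact: psi1. Qed.

HB.instance Definition _ := Measure_isProbability.Build _ _ _ nu nuT.

Definition density_prob : probability T R := nu.

Import HBNNSimple.

(** Monotone convergence is applied to both sides along one sequence of simple functions; on a level
    set the identity is the definition of [nu]. *)
Lemma integral_density_prob (h : T -> \bar R) : measurable_fun setT h ->
  (forall x, 0 <= h x)%E ->
  (\int[density_prob]_x h x = \int[mu]_x (h x * (psi x)%:E))%E.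
Proof.
move=> mh h0; pose f := nnsfun_approx measurableT mh.
have fh x : h x = limn (fun n => (f n x)%:E).
  by apply/esym/cvg_lim => //; exact: cvg_nnsfun_approx.
transitivity (limn (fun n => \int[density_prob]_x (f n x)%:E))%E.
  under eq_integral do rewrite fh.
  apply: monotone_convergence => //.
  - by move=> n; exact/measurable_EFinP/measurable_funP.
  - by move=> n x _; rewrite lee_fin.
  - by move=> x _ a b ab; rewrite lee_fin; exact/lefP/nd_nnsfun_approx.
transitivity (limn (fun n => \int[mu]_x ((f n x)%:E * (psi x)%:E)))%E; last first.
  have fhp x : (h x * (psi x)%:E = limn (fun n => (f n x)%:E * (psi x)%:E))%E.
    apply/esym/cvg_lim => //; apply: cvgeZr => //.
    exact: cvg_nnsfun_approx.
  under [RHS]eq_integral do rewrite fhp.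
  apply/esym; apply: monotone_convergence => //.
  - move=> n; apply/emeasurable_funM => //.
    exact/measurable_EFinP/measurable_funP.
  - by move=> n x _; rewrite mule_ge0// lee_fin.
  - move=> x _ a b ab; rewrite lee_wpmul2r ?lee_fin//.
    exact/lefP/nd_nnsfun_approx.
congr (limn _); apply/funext => n.
under [LHS]eq_integral do rewrite fimfunE -fsumEFin//.
rewrite ge0_integral_fsum//; last 2 first.
- by move=> y; exact/measurable_EFinP/measurable_funM.
- by move=> y x _; exact: nnfun_muleindic_ge0.
under [RHS]eq_integral => x _.
  rewrite [X in X%:E]fimfunE -fsumEFin// ge0_mule_fsuml; last first.
    by move=> y; exact: nnfun_muleindic_ge0.
  over.
rewrite ge0_integral_fsum//; last 2 first.
- move=> y; apply: emeasurable_funM => //.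
  exact/measurable_EFinP/measurable_funM.
- move=> y x _; rewrite mule_ge0 ?lee_fin//; exact: nnfun_muleindic_ge0.
apply: eq_fsbigr => r /set_mem [y _ fyr].
have r0 : 0 <= r by rewrite -fyr.
under eq_integral do rewrite EFinM.
rewrite integralZl_indic_nnsfun//.
under [RHS]eq_integral do rewrite EFinM -muleA.
rewrite [in RHS]ge0_integralZl//; last 2 first.
- by apply: emeasurable_funM => //; exact/measurable_EFinP.
- by move=> x _; rewrite mule_ge0 ?lee_fin.
congr (_ * _)%E; rewrite integral_indic// setIT.
rewrite /density_prob /nu /= [LHS]integral_mkcond; apply: eq_integral => x _.
rewrite patchE; case: ifPn => [|] xr.
  by rewrite indicE xr mul1e.
by rewrite indicE (negbTE xr) mul0e.
Qed.

End density_measure.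

(** * Integration against powers of a measure *)

Section integral_power_measure.
Local Open Scope ereal_scope.

Lemma integral_measure_image d1 d2 (T1 : measurableType d1)
    (T2 : measurableType d2) (R : realType) (phi : T1 -> T2) (psi : T2 -> T1)
    (mphi : measurable_fun setT phi) (mpsi : measurable_fun setT psi)
    (phiK : cancel phi psi) (mu : {sigma_finite_measure set T1 -> \bar R})
    (f : T2 -> \bar R) : measurable_fun setT f -> (forall x, 0 <= f x) ->
  \int[measure_image mphi mpsi phiK mu]_y f y = \int[mu]_x f (phi x).
Proof. by move=> mf f0; exact: (@ge0_integral_pushforward _ _ _ _ _ phi). Qed.

Lemma integral_product_sigma_finite d1 d2 (T1 : measurableType d1)
    (T2 : measurableType d2) (R : realType)
    (m1 : {sigma_finite_measure set T1 -> \bar R})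
    (m2 : {sigma_finite_measure set T2 -> \bar R}) (f : T1 * T2 -> \bar R) :
  measurable_fun setT f -> (forall x, 0 <= f x) ->
  \int[product_sigma_finite m1 m2]_z f z = \int[m1]_x \int[m2]_y f (x, y).
Proof. by move=> mf f0; exact: (fubini_tonelli1 f). Qed.

Context d (T : measurableType d) (R : realType).
Implicit Type mu : {sigma_finite_measure set T -> \bar R}.

Lemma integral_power_measure0 mu (f : 0.-tuple T -> \bar R) :
  measurable_fun setT f -> (forall x, 0 <= f x) ->
  \int[power_measure mu 0]_t f t = f [tuple].
Proof. by move=> mf f0; rewrite /= integral_dirac// diracT mul1e. Qed.

Lemma integral_power_measureS mu n (f : n.+1.-tuple T -> \bar R) :
  measurable_fun setT f -> (forall x, 0 <= f x) ->
  \int[power_measure mu n.+1]_t f t =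
  \int[mu]_x \int[power_measure mu n]_t f (tuple_cons (x, t)).
Proof.
move=> mf f0.
rewrite [LHS](integral_measure_image (@measurable_tuple_cons _ T n)
  (@measurable_tuple_uncons _ T n) (@tuple_consK _ T n))//.
rewrite (integral_product_sigma_finite mu (power_measure mu n))//.
exact: (measurableT_comp mf (@measurable_tuple_cons _ _ _)).
Qed.

Lemma measurable_tuple_consr n (x : T) :
  measurable_fun setT (fun t : n.-tuple T => tuple_cons (x, t)).
Proof.
apply: measurableT_comp; first exact: measurable_tuple_cons.
exact: measurable_pair1.
Qed.

Lemma measurable_mktuple d' (S : measurableType d') n (f : 'I_n -> S -> T) :
  (forall i, measurable_fun setT (f i)) ->
  measurable_fun setT (fun s => [tuple f i s | i < n]).
Proof.
move=> mf; apply/measurable_fun_tnthP => i.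
rewrite (_ : _ \o _ = f i)//.
by apply/funext => s /=; rewrite tnth_mktuple.
Qed.

(** Tonelli and induction: the invariance hypothesis acts on the head coordinate, the induction
    hypothesis on the tail. The maps depend on the coordinate, as they do for the translation by a
    vector. *)
Lemma integral_power_measure_map mu n (tau : 'I_n -> T -> T)
    (f : n.-tuple T -> \bar R) :
  (forall i, measurable_fun setT (tau i)) ->
  (forall i (h : T -> \bar R), measurable_fun setT h -> (forall x, 0 <= h x) ->
    \int[mu]_x h (tau i x) = \int[mu]_x h x) ->
  measurable_fun setT f -> (forall x, 0 <= f x) ->
  \int[power_measure mu n]_t f [tuple tau i (tnth t i) | i < n] =
  \int[power_measure mu n]_t f t.
Proof.
elim: n tau f => [|n IH] tau f mtau tauE mf f0.
  rewrite !integral_power_measure0//; first by congr f; apply: eq_from_tnth => -[].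
  apply: measurableT_comp => //; apply: measurable_mktuple => i.
  exact: (measurableT_comp (mtau i) (measurable_tnth i)).
have mg : measurable_fun setT
    (fun t : n.-tuple T => [tuple tau (lift ord0 i) (tnth t i) | i < n]).
  apply: measurable_mktuple => i.
  by apply: measurableT_comp; [exact: mtau|exact: measurable_tnth].
rewrite integral_power_measureS; last 2 first.
- apply: (measurableT_comp mf); apply: measurable_mktuple => i.
  exact: (measurableT_comp (mtau i) (measurable_tnth i)).
- by move=> t; exact: f0.
have -> := integral_power_measureS mu mf f0.
have := tauE ord0 (fun x => \int[power_measure mu n]_t f (tuple_cons (x, t))).
move=> <-; last 2 first.
- apply: (measurable_fun_fubini_tonelli_F (fun z => f (tuple_cons z))).
    exact: (measurableT_comp mf (@measurable_tuple_cons _ _ _)).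
  by move=> z; exact: f0.
- by move=> x; apply: integral_ge0.
apply: eq_integral => x _.
rewrite -[RHS](IH (fun i => tau (lift ord0 i))
  (fun t => f (tuple_cons (tau ord0 x, t))))//; last 2 first.
- by move=> i h; exact: tauE.
- exact: (measurableT_comp mf (measurable_tuple_consr _)).
apply: eq_integral => t _; congr f; apply: eq_from_tnth => i.
rewrite tnth_mktuple /tuple_cons; have [j ->|->] := unliftP ord0 i.
  by rewrite !tnthS tnth_mktuple.
by rewrite !tnth0.
Qed.

(** Serves at two levels: for the coordinates of one Gaussian vector, and for the [m] auxiliary
    vectors of the extended state. *)
Lemma integral_power_measure_density mu (psi : T -> R)
    (mpsi : measurable_fun setT psi) (psi0 : forall x, (0 <= psi x)%R)
    (psi1 : \int[mu]_x (psi x)%:E = 1) n (f : n.-tuple T -> \bar R) :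
  measurable_fun setT f -> (forall x, 0 <= f x) ->
  \int[power_measure (density_prob mpsi psi0 psi1) n]_t f t =
  \int[power_measure mu n]_t (f t * (\prod_(i < n) psi (tnth t i))%:E).
Proof.
have mprod k : measurable_fun setT
    (fun t : k.-tuple T => \prod_(i < k) psi (tnth t i))%R.
  apply: measurable_prod => i _.
  exact: (measurableT_comp _ (measurable_tnth i)).
have prod0 k (t : k.-tuple T) : (0 <= \prod_(i < k) psi (tnth t i))%R.
  by apply: prodr_ge0 => i _.
elim: n f => [|n IH] f mf f0.
  rewrite !integral_power_measure0//; first by rewrite big_ord0 mule1.
  - by apply: emeasurable_funM => //; apply/measurable_EFinP; exact: mprod.
  - by move=> t; rewrite mule_ge0 ?lee_fin.
have mf1 x : measurable_fun setT (fun t => f (tuple_cons (x, t))).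
  exact: (measurableT_comp mf (measurable_tuple_consr x)).
rewrite integral_power_measureS//.
rewrite [RHS]integral_power_measureS; last 2 first.
- by apply: emeasurable_funM => //; apply/measurable_EFinP; exact: mprod.
- by move=> t; rewrite mule_ge0 ?lee_fin.
rewrite integral_density_prob//; last 2 first.
- apply: (measurable_fun_fubini_tonelli_F (fun z => f (tuple_cons z))) => //.
  exact: (measurableT_comp mf (@measurable_tuple_cons _ _ _)).
- by move=> x; exact: integral_ge0.
apply: eq_integral => x _; rewrite IH// -ge0_integralZr//; last 3 first.
- by apply: emeasurable_funM => //; apply/measurable_EFinP; exact: mprod.
- by move=> t _; rewrite mule_ge0 ?lee_fin.
- by rewrite lee_fin.
apply: eq_integral => t _; rewrite -muleA; congr (_ * _); rewrite -EFinM.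
rewrite big_ord_recl /tuple_cons tnth0 mulrC; congr (_ * _)%:E.
by apply: eq_bigr => i _; rewrite tnthS.
Qed.

(** Mass 1 is a plain hypothesis here and below, because [power_measure] is bundled as a
    sigma-finite measure even when its base is a probability. *)
Lemma integral_cst_mass1 d' (S : measurableType d')
    (nu : {measure set S -> \bar R}) (c : \bar R) :
  nu setT = 1 -> \int[nu]_x c = c.
Proof. by move=> nu1; rewrite (integral_cst nu measurableT) nu1 mule1. Qed.

Lemma power_measure_setT mu n : mu setT = 1 -> power_measure mu n setT = 1.
Proof.
move=> mu1.
transitivity (power_measure mu n [set t | forall i, setT (tnth t i)]).
  by congr (_ _); apply/seteqP; split.
by rewrite (power_measure_box mu (fun=> @measurableT _ T)) big1.
Qed.

Lemma integral_power_measure_tnth mu n (i : 'I_n) (f : T -> \bar R) :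
  mu setT = 1 -> measurable_fun setT f -> (forall x, 0 <= f x) ->
  \int[power_measure mu n]_t f (tnth t i) = \int[mu]_x f x.
Proof.
move=> mu1; elim: n i => [[]//|n IH] i mf f0; rewrite integral_power_measureS//; last first.
  exact: (measurableT_comp _ (measurable_tnth i)).
have [j ->|->] := unliftP ord0 i.
  under eq_integral do under eq_integral do rewrite /tuple_cons tnthS.
  under eq_integral do rewrite IH//.
  exact: integral_cst_mass1.
under eq_integral do under eq_integral do rewrite /tuple_cons tnth0.
apply: eq_integral => x _.
by rewrite /=; apply: integral_cst_mass1; exact: power_measure_setT.
Qed.

End integral_power_measure.

(** * Second moments and sums of independent terms *)

Section variance.
Local Open Scope ereal_scope.
Context d (T : measurableType d) (R : realType).

Lemma integrable_of_sqr (nu : {measure set T -> \bar R}) (X : T -> R) :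
  nu setT = 1 -> measurable_fun setT X ->
  \int[nu]_x (X x ^+ 2)%:E < +oo -> nu.-integrable setT (EFin \o X).
Proof.
move=> nu1 mX X2; apply/integrableP; split; first exact/measurable_EFinP.
apply: (@le_lt_trans _ _ (\int[nu]_x (1 + (X x ^+ 2)%:E))).
  apply: ge0_le_integral => //.
  - by apply/measurable_EFinP; exact: measurableT_comp.
  - by apply: emeasurable_funD => //; apply/measurable_EFinP/measurable_funX.
  - move=> x _ /=; rewrite -EFinD lee_fin.
    have := sqr_ge0 (`|X x| - 1)%R; rewrite -(real_normK (num_real (X x))); nra.
rewrite ge0_integralD//.
- by rewrite integral_cst_mass1// lte_add_pinfty// ltry.
- by move=> x _; rewrite lee_fin sqr_ge0.
- by apply/measurable_EFinP/measurable_funX.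
Qed.

Lemma integral_sqr_shift (nu : {measure set T -> \bar R}) (X : T -> R) (c : R) :
  nu setT = 1 -> measurable_fun setT X ->
  \int[nu]_x (X x ^+ 2)%:E < +oo -> \int[nu]_x (X x)%:E = 0 ->
  \int[nu]_x ((X x + c) ^+ 2)%:E = \int[nu]_x (X x ^+ 2)%:E + (c ^+ 2)%:E.
Proof.
move=> nu1 mX X2 X0.
have iX := integrable_of_sqr nu1 mX X2.
have iX2 : nu.-integrable setT (fun x => (X x ^+ 2)%:E).
  apply/integrableP; split; first by apply/measurable_EFinP/measurable_funX.
  by under eq_integral do rewrite gee0_abs ?lee_fin ?sqr_ge0//.
have ic (k : R) : nu.-integrable setT (cst k%:E).
  apply/integrableP; split => //=.
  by rewrite integral_cst_mass1// ltry.
transitivity (\int[nu]_x (((X x ^+ 2)%:E + (2 * c)%:E * (X x)%:E) +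
    (c ^+ 2)%:E)).
  apply: eq_integral => x _; rewrite -EFinM -!EFinD; congr EFin; ring.
have icX : nu.-integrable setT (fun x => (2 * c)%:E * (X x)%:E).
  exact: integrableZl.
rewrite integralD//; last 2 first.
- exact: integrableD.
- exact: ic.
rewrite integral_cst_mass1// integralD//.
by rewrite integralZl// X0 mule0 adde0.
Qed.

(** Independent centered terms have no cross terms. The shift [c] carries the induction: the head
    coordinate is frozen and absorbed into the shift of the remaining sum. *)
Lemma integral_power_measure_sqr_sum (mu : {sigma_finite_measure set T -> \bar R})
    n (X : 'I_n -> T -> R) (c : R) :
  mu setT = 1 -> (forall i, measurable_fun setT (X i)) ->
  (forall i, \int[mu]_x (X i x ^+ 2)%:E < +oo) ->
  (forall i, \int[mu]_x (X i x)%:E = 0) ->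
  \int[power_measure mu n]_t (((\sum_(i < n) X i (tnth t i)) + c) ^+ 2)%:E =
  \sum_(i < n) \int[mu]_x (X i x ^+ 2)%:E + (c ^+ 2)%:E.
Proof.
move=> mu1; elim: n X c => [|n IH] X c mX X2 X0.
  under eq_integral do rewrite big_ord0 add0r.
  rewrite big_ord0 add0e; apply: integral_cst_mass1.
  exact: power_measure_setT.
rewrite integral_power_measureS; last 2 first.
- apply/measurable_EFinP/measurable_funX/measurable_funD => //.
  apply: measurable_sum => i.
  exact: (measurableT_comp (mX i) (measurable_tnth i)).
- by move=> t; rewrite lee_fin sqr_ge0.
transitivity (\int[mu]_x (\sum_(i < n) \int[mu]_x (X (lift ord0 i) x ^+ 2)%:E +
    ((X ord0 x + c) ^+ 2)%:E)).
  apply: eq_integral => x _; rewrite -IH//.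
  apply: eq_integral => t _; congr (_ ^+ 2)%:E.
  rewrite big_ord_recl /tuple_cons tnth0 -addrA [RHS]addrCA; congr (_ + _)%R.
  by congr (_ + _)%R; apply: eq_bigr => i _; rewrite tnthS.
rewrite ge0_integralD//; last 3 first.
- by move=> x _; apply: sume_ge0 => i _; apply: integral_ge0 => y _; rewrite lee_fin sqr_ge0.
- by move=> x _; rewrite lee_fin sqr_ge0.
- exact/measurable_EFinP/measurable_funX/measurable_funD.
rewrite integral_cst_mass1// integral_sqr_shift// big_ord_recl.
by rewrite addeA; congr (_ + _); rewrite addeC.
Qed.

End variance.

(** * Lebesgue and Gaussian measures on R^n *)

Section measurable_matrix_operations.
Context d (S : measurableType d) (R : realType) (m n : nat).
Implicit Types f g : S -> 'M[R]_(m, n).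

Lemma measurable_entry f i j : measurable_fun setT f ->
  measurable_fun setT (fun s => f s i j).
Proof. exact: (measurableT_comp (measurable_matrix_entry i j)). Qed.

Lemma measurable_addmx f g : measurable_fun setT f -> measurable_fun setT g ->
  measurable_fun setT (fun s => f s + g s).
Proof.
move=> mf mg; apply: measurable_fun_matrixP => i j.
under eq_fun do rewrite mxE.
by apply: measurable_funD; exact: measurable_entry.
Qed.

Lemma measurable_scalemx (k : S -> R) f :
  measurable_fun setT k -> measurable_fun setT f ->
  measurable_fun setT (fun s => k s *: f s).
Proof.
move=> mk mf; apply: measurable_fun_matrixP => i j.
under eq_fun do rewrite mxE.
by apply: measurable_funM => //; exact: measurable_entry.
Qed.

Lemma measurable_oppmx f : measurable_fun setT f ->
  measurable_fun setT (fun s => - f s).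
Proof.
move=> mf; under eq_fun do rewrite -scaleN1r.
exact: measurable_scalemx.
Qed.

Lemma measurable_mulmx p (A : 'M[R]_(p, m)) f : measurable_fun setT f ->
  measurable_fun setT (fun s => A *m f s).
Proof.
move=> mf; apply: measurable_fun_matrixP => i j.
under eq_fun do rewrite mxE.
apply: measurable_sum => k; apply: measurable_funM => //.
exact: measurable_entry.
Qed.

End measurable_matrix_operations.

Section lebesgue_invariance.
Local Open Scope ereal_scope.
Context (R : realType).
Local Notation mR := (measurableTypeR R).
Local Notation mu := (@lebesgue_measure R).

Lemma measurable_shiftR (c : R) :
  measurable_fun setT ((fun x => x + c)%R : mR -> mR).
Proof. exact: (@measurable_funD _ _ _ _ id (cst c)). Qed.

Lemma measurable_oppR : measurable_fun setT (-%R : mR -> mR).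
Proof. exact: (measurable_funN (@measurable_id _ mR setT)). Qed.

(** By uniqueness of the Lebesgue measure it suffices to compare half-open intervals. *)
Lemma lebesgue_measure_shift (c : R) (A : set mR) : measurable A ->
  pushforward mu ((fun x => x + c)%R : mR -> mR) A = mu A.
Proof.
move=> mA.
pose cm : {mfun mR >-> mR} := HB.pack ((fun x => x + c)%R : mR -> mR)
  (isMeasurableFun.Build _ _ _ _ _ (measurable_shiftR c)).
apply/esym.
apply: (@lebesgue_measure_unique _ (pushforward mu cm)) => //= _ [[a b]] _ <-.
rewrite /pushforward (_ : _ @^-1` _ = `](a - c)%R, (b - c)%R]%classic); last first.
  by apply/seteqP; split => x /=; rewrite !in_itv/= ltrBlDr lerBrDr.
rewrite !lebesgue_measure_itv/= !lte_fin ltrD2r.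
by case: ifPn => // _; rewrite -!EFinB; congr EFin; ring.
Qed.

Lemma integral_lebesgue_shift (c : R) (h : mR -> \bar R) :
  measurable_fun setT h -> (forall x, 0 <= h x) ->
  \int[mu]_x h (x + c)%R = \int[mu]_x h x.
Proof.
move=> mh h0.
rewrite -[LHS](ge0_integral_pushforward (measurable_shiftR c) mu measurableT mh)//.
by apply: eq_measure_integral => [|? A mA _];
  [exact: measurable_shiftR|exact: lebesgue_measure_shift].
Qed.

Lemma integral_lebesgue_opp (h : mR -> \bar R) :
  measurable_fun setT h -> (forall x, 0 <= h x) ->
  \int[mu]_x h (- x)%R = \int[mu]_x h x.
Proof.
move=> mh h0.
rewrite -[LHS](ge0_integral_pushforward measurable_oppR mu measurableT mh)//.
by apply: eq_measure_integral => A mA _; exact: lebesgue_measureN.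
Qed.

Context (n : nat).

Lemma integral_lebesgue_cV (f : 'cV[R]_n -> \bar R) :
  measurable_fun setT f -> (forall x, 0 <= f x) ->
  \int[lebesgue_cV R n]_z f z =
  \int[power_measure mu n]_t f (cV_of_tuple t).
Proof. by move=> mf f0; exact: integral_measure_image. Qed.

Lemma integral_lebesgue_cV_shift (c : 'cV[R]_n) (f : 'cV[R]_n -> \bar R) :
  measurable_fun setT f -> (forall x, 0 <= f x) ->
  \int[lebesgue_cV R n]_z f (z + c)%R = \int[lebesgue_cV R n]_z f z.
Proof.
move=> mf f0; rewrite !integral_lebesgue_cV//; last first.
  by apply: (measurableT_comp mf); apply: measurable_addmx.
rewrite -[RHS](integral_power_measure_map (tau := fun i => (fun x => x + c i 0)%R : mR -> mR))//.
- apply: eq_integral => t _; congr f; apply/colP => i.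
  by rewrite !mxE tnth_mktuple.
- by move=> i; exact: measurable_shiftR.
- by move=> i h mh h0; exact: integral_lebesgue_shift.
- exact: (measurableT_comp mf (@measurable_cV_of_tuple _ _)).
Qed.

Lemma integral_lebesgue_cV_opp (f : 'cV[R]_n -> \bar R) :
  measurable_fun setT f -> (forall x, 0 <= f x) ->
  \int[lebesgue_cV R n]_z f (- z)%R = \int[lebesgue_cV R n]_z f z.
Proof.
move=> mf f0; rewrite !integral_lebesgue_cV//; last first.
  by apply: (measurableT_comp mf); apply: measurable_oppmx.
rewrite -[RHS](integral_power_measure_map (tau := fun _ : 'I_n => (-%R : mR -> mR)))//.
- apply: eq_integral => t _; congr f; apply/colP => i.
  by rewrite !mxE tnth_mktuple.
- by move=> i h mh h0; exact: integral_lebesgue_opp.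
- exact: (measurableT_comp mf (@measurable_cV_of_tuple _ _)).
Qed.

End lebesgue_invariance.

Section gaussian.
Context (R : realType).
Local Notation mR := (measurableTypeR R).

Lemma measurable_gauss_pdf n : measurable_fun setT (@gauss_pdf R n).
Proof.
apply: measurable_prod => i _; apply: measurableT_comp.
  exact: measurable_normal_pdf.
exact: measurable_matrix_entry.
Qed.

Lemma gauss_pdf_gt0 n (z : 'cV[R]_n) : 0 < gauss_pdf z.
Proof.
apply: prodr_gt0 => i _; rewrite /normal_pdf oner_eq0 mulr_gt0 ?expR_gt0//.
by rewrite normal_peak_gt0// oner_eq0.
Qed.

Lemma gauss_pdf_ge0 n (z : 'cV[R]_n) : 0 <= gauss_pdf z.
Proof. exact/ltW/gauss_pdf_gt0. Qed.

(** This form shows rotation invariance: [z] enters only through its sum of squares. *)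
Lemma gauss_pdfE n (z : 'cV[R]_n) :
  gauss_pdf z = normal_peak 1 ^+ n * expR (- (\sum_i z i 0 ^+ 2) / 2).
Proof.
rewrite mulNr mulr_suml -sumrN expR_sum -[X in _ ^+ X]card_ord -prodr_const.
rewrite -big_split/=; apply: eq_bigr => i _.
by rewrite /normal_pdf oner_eq0/= /normal_fun subr0 expr1n mulNr.
Qed.

Lemma measurable_normal_pdf01 :
  measurable_fun setT (normal_pdf 0 1 : mR -> R).
Proof. exact: measurable_normal_pdf. Qed.

(** Built by [density_prob], so that [integral_power_measure_density] identifies its powers with the
    Gaussian density on columns. *)
Definition std_normal : probability mR R :=
  density_prob measurable_normal_pdf01 (@normal_pdf_ge0 R 0 1)
    (@integral_normal_pdf R 0 1).

Local Open Scope ereal_scope.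

Lemma integral_gauss n (f : 'cV[R]_n -> \bar R) :
  measurable_fun setT f -> (forall x, 0 <= f x) ->
  \int[lebesgue_cV R n]_z (f z * (gauss_pdf z)%:E) =
  \int[power_measure std_normal n]_t f (cV_of_tuple t).
Proof.
move=> mf f0; rewrite integral_lebesgue_cV; last 2 first.
- apply: emeasurable_funM => //.
  by apply/measurable_EFinP; exact: measurable_gauss_pdf.
- by move=> z; rewrite mule_ge0// lee_fin gauss_pdf_ge0.
have mfc : measurable_fun setT (f \o @cV_of_tuple R n).
  exact: (measurableT_comp mf (@measurable_cV_of_tuple _ _)).
have /= -> := integral_power_measure_density measurable_normal_pdf01
  (@normal_pdf_ge0 R 0 1) (@integral_normal_pdf R 0 1) mfc (fun=> f0 _).
apply: eq_integral => t _; congr (_ * _%:E).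
by apply: eq_bigr => i _; rewrite mxE.
Qed.

Lemma integral_gauss_pdf n : \int[lebesgue_cV R n]_z (gauss_pdf z)%:E = 1.
Proof.
under eq_integral do rewrite -[_%:E]mul1e.
rewrite (@integral_gauss _ (cst 1))// integral_cst_mass1//.
by apply: power_measure_setT; exact: probability_setT.
Qed.

(* locked: otherwise unification and simplification unfold the construction of
   the measure *)
Definition gauss_prob n : probability 'cV[R]_n R :=
  locked (density_prob (@measurable_gauss_pdf n) (@gauss_pdf_ge0 n)
    (integral_gauss_pdf n)).

Lemma integral_gauss_prob n (f : 'cV[R]_n -> \bar R) :
  measurable_fun setT f -> (forall x, 0 <= f x) ->
  \int[gauss_prob n]_z f z = \int[lebesgue_cV R n]_z (f z * (gauss_pdf z)%:E).
Proof. by rewrite /gauss_prob -lock; exact: integral_density_prob. Qed.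

Lemma integral_gauss_prob_tuple n (f : 'cV[R]_n -> \bar R) :
  measurable_fun setT f -> (forall x, 0 <= f x) ->
  \int[gauss_prob n]_z f z =
  \int[power_measure std_normal n]_t f (cV_of_tuple t).
Proof. by move=> mf f0; rewrite integral_gauss_prob// integral_gauss. Qed.

End gaussian.

(** * Moments of the standard normal distribution *)

Section normal_moments.
Context (R : realType).
Local Notation mR := (measurableTypeR R).
Local Notation mu := (@lebesgue_measure R).

Lemma FTC_is_derive (f F : R -> R) (a b : R) : a < b -> continuous f ->
  (forall x : R, is_derive x 1 F (f x)) ->
  (\int[mu]_(x in `[a, b]) (f x)%:E = (F b - F a)%:E)%E.
Proof.
move=> ab cf dF; have cF : continuous F.
  move=> x; apply: differentiable_continuous; apply/derivable1_diffP.
  exact: (@ex_derive _ _ _ _ _ _ _ (dF x)).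
rewrite EFinB; apply: continuous_FTC2 => //.
- exact: continuous_subspaceT.
- split; first by move=> x _; exact: (@ex_derive _ _ _ _ _ _ _ (dF x)).
  + exact/cvg_at_right_filter/cF.
  + exact/cvg_at_left_filter/cF.
- by move=> x _; rewrite derive1E; exact: derive_val.
Qed.

Lemma is_derive_normal_pdf (x : R) :
  is_derive x 1 (normal_pdf 0 1) (- x * normal_pdf 0 1 x).
Proof.
pose h : R -> R := (- 2^-1) \*: ((id : R -> R) ^+ 2).
have dh : is_derive x 1 h (- x).
  by apply: is_derive_eq; rewrite /= /GRing.scale/=; field.
have -> : normal_pdf 0 1 = normal_peak 1 \*: (expR \o h).
  rewrite normal_pdfE ?oner_eq0//; apply/funext => y.
  rewrite /normal_fun /h !fctE /= /GRing.scale/=; congr (_ * expR _).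
  by rewrite subr0 expr1n; field.
apply: is_derive_eq; rewrite /= /GRing.scale/=; ring.
Qed.

(** [- x * phi x] is an antiderivative of [x ^ 2 * phi x - phi x]. Its boundary terms on a symmetric
    interval are nonpositive, so the bound needs no limit at infinity. *)
Lemma integral_normal_sqr_itv (a : R) : 0 < a ->
  (\int[mu]_(x in `[(- a)%R, a]) (x ^+ 2 * normal_pdf 0 1 x)%:E <= 1)%E.
Proof.
move=> a0; set phi := normal_pdf (0 : R) 1.
have cphi : continuous phi by apply: continuous_normal_pdf; rewrite oner_eq0.
pose F (x : R) := - (x * phi x).
pose f (x : R) := x ^+ 2 * phi x - phi x.
have cf : continuous f.
  move=> x; apply: cvgB; last exact: cphi.
  by apply: cvgM; [exact: sqr_continuous|exact: cphi].
have dF (x : R) : is_derive x 1 F (f x).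
  have dphi := is_derive_normal_pdf x.
  apply: is_derive_eq; rewrite /= /GRing.scale/= /f -/phi; ring.
have aa : - a < a by lra.
have E := FTC_is_derive aa cf dF.
have ci (h : R -> R) : continuous h -> mu.-integrable `[(- a)%R, a] (EFin \o h).
  move=> ch; apply: continuous_compact_integrable; first exact: segment_compact.
  exact: continuous_subspaceT.
have -> : (\int[mu]_(x in `[(- a)%R, a]) (x ^+ 2 * phi x)%:E =
    \int[mu]_(x in `[(- a)%R, a]) (f x)%:E + \int[mu]_(x in `[(- a)%R, a]) (phi x)%:E)%E.
  rewrite -integralD//; last 2 first.
  - exact: ci.
  - exact: ci.
  by apply: eq_integral => x _; rewrite -EFinD subrK.
rewrite E -[leRHS]add0e; apply: leeD.
  rewrite lee_fin /F.
  have := normal_pdf_ge0 0 1 a; have := normal_pdf_ge0 0 1 (- a); rewrite -/phi; nra.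
rewrite -(integral_normal_pdf 0 1); apply: ge0_subset_integral => //.
- by apply/measurable_EFinP; exact: measurable_normal_pdf.
- by move=> x _; rewrite lee_fin normal_pdf_ge0.
Qed.

Local Open Scope ereal_scope.

Lemma integral_std_normal_sqr : \int[std_normal R]_x (x ^+ 2)%:E <= 1.
Proof.
rewrite integral_density_prob; last 2 first.
- by apply/measurable_EFinP; exact: (@measurable_funX _ mR).
- by move=> x; rewrite lee_fin sqr_ge0.
under eq_integral do rewrite -EFinM.
pose F (n : nat) : set mR := `[(- n.+1%:R)%R, n.+1%:R]%classic.
have UF : \bigcup_n F n = setT.
  apply/seteqP; split => // x _.
  have [n xn] : exists n : nat, (`|x| <= n.+1%:R)%R.
    exists (Num.trunc `|x|); exact/ltW/truncnS_gt.
  by exists n => //; rewrite /F/= in_itv/= -ler_norml.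
have mf : measurable_fun setT (fun x : mR => (x ^+ 2 * normal_pdf 0 1 x)%:E).
  apply/measurable_EFinP/measurable_funM; last exact: measurable_normal_pdf.
  exact: (@measurable_funX _ mR).
have f0 (x : mR) : 0 <= (x ^+ 2 * normal_pdf 0 1 x)%:E.
  by rewrite lee_fin mulr_ge0 ?sqr_ge0 ?normal_pdf_ge0.
have : \int[mu]_(x in F i) (x ^+ 2 * normal_pdf 0 1 x)%:E @[i --> \oo] -->
    \int[mu]_(x in \bigcup_i F i) (x ^+ 2 * normal_pdf 0 1 x)%:E.
  apply: ge0_nondecreasing_set_cvg_integral => //.
  - move=> i j ij; apply/subsetPset => x; rewrite /F/= !in_itv/= => /andP[ix xi].
    have : (i.+1%:R <= j.+1%:R :> R)%R by rewrite ler_nat.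
    by move=> ?; apply/andP; split; lra.
  - by move=> n; exact: measurable_itv.
  - by move=> n; exact: measurable_funTS.
rewrite UF => cvgF.
rewrite -(cvg_lim _ cvgF)//; apply: lime_le; first by apply/cvg_ex; eexists; exact: cvgF.
by apply: nearW => n; exact: integral_normal_sqr_itv.
Qed.

Lemma integral_std_normal_opp (h : mR -> \bar R) :
  measurable_fun setT h -> (forall x, 0 <= h x) ->
  \int[std_normal R]_x h (- x)%R = \int[std_normal R]_x h x.
Proof.
move=> mh h0; rewrite !integral_density_prob//; last first.
  by apply: (measurableT_comp mh); exact: measurable_oppR.
rewrite -[RHS]integral_lebesgue_opp; last 2 first.
- apply: emeasurable_funM => //; apply/measurable_EFinP.
  exact: measurable_normal_pdf.
- by move=> x; rewrite mule_ge0// lee_fin normal_pdf_ge0.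
apply: eq_integral => x _; congr (_ * _%:E).
by rewrite normal_pdfE ?oner_eq0// /normal_fun !subr0 sqrrN.
Qed.

(** By symmetry the positive and negative parts have the same integral. It is finite thanks to the
    second moment, so the difference is really 0. *)
Lemma integral_std_normal_id : \int[std_normal R]_x (x : R)%:E = 0.
Proof.
pose f (x : mR) : \bar R := (x : R)%:E.
have mf : measurable_fun setT f.
  by apply/measurable_EFinP; exact: (@measurable_id _ mR).
have intf : (std_normal R).-integrable setT f.
  apply: (@integrable_of_sqr _ mR R (std_normal R) id) => //.
  - exact: probability_setT.
  - by rewrite (le_lt_trans integral_std_normal_sqr)// ltry.
rewrite -/(\int[std_normal R]_x f x) integralE.
have -> : \int[std_normal R]_x f^\- x = \int[std_normal R]_x f^\+ x.
  rewrite -[RHS]integral_std_normal_opp; last 2 first.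
  - exact: measurable_funepos.
  - by move=> x; exact: funepos_ge0.
  by apply: eq_integral => x _; rewrite funeposE funenegE /f EFinN.
by apply: subee; exact: integrable_pos_fin_num.
Qed.

(** The dot product is a sum of independent centered terms [v i 0 * x]; an upper bound on the second
    moment of each coordinate is enough for the inequality. *)
Lemma integral_gauss_dot_sqr n (v : 'cV[R]_n) :
  \int[gauss_prob R n]_y ((v^T *m y) 0 0 ^+ 2)%R%:E <=
  (\sum_i v i 0%R ^+ 2)%R%:E.
Proof.
rewrite integral_gauss_prob_tuple; last 2 first.
- apply/measurable_EFinP/measurable_funX/measurable_entry.
  exact: measurable_mulmx.
- by move=> y; rewrite lee_fin sqr_ge0.
pose X (i : 'I_n) (x : mR) : R := (v i 0 * x)%R.
have mX i : measurable_fun setT (X i).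
  apply: measurable_funM => //; exact: (@measurable_id _ mR).
have X2E i : \int[std_normal R]_x (X i x ^+ 2)%:E =
    (v i 0 ^+ 2)%:E * \int[std_normal R]_x (x ^+ 2)%:E.
  rewrite -ge0_integralZl//.
  - by apply: eq_integral => x _; rewrite -EFinM exprMn.
  - by apply/measurable_EFinP; exact: (@measurable_funX _ mR).
  - by move=> x _; rewrite lee_fin sqr_ge0.
  - by rewrite lee_fin sqr_ge0.
have X2le i : \int[std_normal R]_x (X i x ^+ 2)%:E <= (v i 0 ^+ 2)%:E.
  rewrite X2E -[leRHS]mule1; apply: lee_wpmul2l; first by rewrite lee_fin sqr_ge0.
  exact: integral_std_normal_sqr.
under eq_integral do rewrite mxE -[X in (X ^+ 2)%:E]addr0.
under eq_integral => t _.
  under eq_bigr do rewrite !mxE -/(X _ _).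
  over.
rewrite (integral_power_measure_sqr_sum (X := X))//.
- by rewrite expr0n/= adde0 -sumEFin; exact: lee_sum.
- exact: probability_setT.
- by move=> i; rewrite (le_lt_trans (X2le i))// ltry.
- move=> i; under eq_integral do rewrite EFinM.
  rewrite integralZl//; first by rewrite integral_std_normal_id mule0.
  apply: (@integrable_of_sqr _ mR R (std_normal R) id) => //.
  + exact: probability_setT.
  + by rewrite (le_lt_trans integral_std_normal_sqr)// ltry.
Qed.

End normal_moments.

(** * Orthogonal invariance of the Lebesgue and Gaussian measures *)

Section orthogonal_change_of_variables.
Local Open Scope ereal_scope.
Context (R : realType) (d r n : nat).
Variables (U : 'M[R]_(d, r)) (V : 'M[R]_(d, n)).
Hypotheses (drn : (d = r + n)%N) (UU : U^T *m U = 1%:M) (VV : V^T *m V = 1%:M).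
Hypothesis UV : U^T *m V = 0%R.

(** The transpose of [row_mx U V] is its left inverse, hence also its right inverse; the dimension
    equation is what makes this matrix square. *)
Lemma orthogonal_completeness : (U *m U^T + V *m V^T = 1%:M)%R.
Proof.
move: U V UU VV UV; rewrite drn => A B AA BB AB.
have BA : B^T *m A = 0%R by rewrite -[LHS]trmxK trmx_mul trmxK AB trmx0.
rewrite -[LHS]mul_row_col; apply: mulmx1C.
by rewrite mul_col_row AA BB AB BA -scalar_mx_block.
Qed.

Lemma orthogonal_sqr_sum (z : 'cV[R]_r) (s : 'cV[R]_n) :
  (\sum_i (U *m z + V *m s)%R i 0%R ^+ 2 =
   \sum_i z i 0 ^+ 2 + \sum_i s i 0 ^+ 2)%R.
Proof.
have sqE k (w : 'cV[R]_k) : (\sum_i w i 0 ^+ 2 = (w^T *m w) 0 0)%R.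
  by rewrite mxE; apply: eq_bigr => i _; rewrite mxE.
have VU : V^T *m U = 0%R by rewrite -[LHS]trmxK trmx_mul trmxK UV trmx0.
rewrite !sqE [(_ + _)^T%R]linearD/= !trmx_mul mulmxDl !mulmxDr.
rewrite !mulmxA -!(mulmxA z^T) -!(mulmxA s^T) UU VV UV VU.
by rewrite !mul0mx !mulmx0 !mul1mx addr0 add0r mxE.
Qed.

Lemma gauss_pdf_orthogonal (z : 'cV[R]_r) (s : 'cV[R]_n) :
  gauss_pdf (U *m z + V *m s)%R = (gauss_pdf z * gauss_pdf s)%R.
Proof.
rewrite !gauss_pdfE orthogonal_sqr_sum drn exprD mulrACA -expRD.
by congr (_ * expR _)%R; ring.
Qed.

Let w (p : 'cV[R]_r * 'cV[R]_n) := (U *m p.1 + V *m p.2)%R.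

Let mw : measurable_fun setT w.
Proof. by apply: measurable_addmx; exact: measurable_mulmx. Qed.

Let nu := product_sigma_finite (lebesgue_cV R r) (lebesgue_cV R n).

Let nuE (h : 'cV[R]_d -> \bar R) : measurable_fun setT h ->
  (forall x, 0 <= h x) -> \int[nu]_p h (w p) =
  \int[lebesgue_cV R r]_z \int[lebesgue_cV R n]_s h (U *m z + V *m s)%R.
Proof.
move=> mh h0; have mhw : measurable_fun setT (h \o w).
  exact: (measurableT_comp mh mw).
exact: (integral_product_sigma_finite _ _ mhw (fun=> h0 _)).
Qed.

(** By completeness, a shift by [y] is a shift of the first component by [U^T *m y] and of the
    second by [V^T *m y]. *)
Let nu_shift (h : 'cV[R]_d -> \bar R) (y : 'cV[R]_d) : measurable_fun setT h ->
  (forall x, 0 <= h x) ->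
  \int[nu]_p h (w p + y)%R = \int[nu]_p h (w p).
Proof.
move=> mh h0.
have mhy : measurable_fun setT (fun x : 'cV[R]_d => h (x + y)%R).
  by apply: (measurableT_comp mh); exact: measurable_addmx.
rewrite (nuE mhy (fun=> h0 _)) (nuE mh h0).
pose H z := \int[lebesgue_cV R n]_s h (U *m z + V *m s)%R.
have mhw : measurable_fun setT (h \o w) by exact: (measurableT_comp mh mw).
rewrite -[RHS](integral_lebesgue_cV_shift (U^T *m y)%R (f := H)); last 2 first.
- exact: (measurable_fun_fubini_tonelli_F _ mhw (fun=> h0 _)).
- by move=> z; exact: integral_ge0.
apply: eq_integral => z _; rewrite /H.
rewrite -[RHS](integral_lebesgue_cV_shift (V^T *m y)%R); last 2 first.
- apply: (measurableT_comp mh); apply: measurable_addmx => //.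
  exact: measurable_mulmx.
- by [].
apply: eq_integral => s _; congr h.
rewrite !mulmxDr !mulmxA addrACA; congr (_ + _)%R.
by rewrite -mulmxDl orthogonal_completeness mul1mx.
Qed.

(* Two translation-invariant measures nu and la satisfy nu(f) la(k) =
   la(f) nu(k): apply Tonelli's theorem to f(x) k(y) after one translation for
   each measure.  Here k is the Gaussian density, of integral 1 for both. *)
Lemma integral_lebesgue_orthogonal (f : 'cV[R]_d -> \bar R) :
  measurable_fun setT f -> (forall x, 0 <= f x) ->
  \int[lebesgue_cV R r]_z \int[lebesgue_cV R n]_s f (U *m z + V *m s)%R =
  \int[lebesgue_cV R d]_x f x.
Proof.
move=> mf f0; rewrite -nuE//.
pose k (x : 'cV[R]_d) := (gauss_pdf x)%:E.
have mk : measurable_fun setT k by apply/measurable_EFinP; exact: measurable_gauss_pdf.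
have k0 x : 0 <= k x by rewrite lee_fin gauss_pdf_ge0.
(* The Gaussian density splits along the frame, so the normalization of [nu] is found without
   computing any determinant. *)
have nuk : \int[nu]_p k (w p) = 1.
  rewrite nuE//; under eq_integral.
    move=> z _; under eq_integral do rewrite /k gauss_pdf_orthogonal EFinM.
    rewrite ge0_integralZl//; last 3 first.
    - by apply/measurable_EFinP; exact: measurable_gauss_pdf.
    - by move=> s _; rewrite lee_fin gauss_pdf_ge0.
    - by rewrite lee_fin gauss_pdf_ge0.
    rewrite integral_gauss_pdf mule1; over.
  exact: integral_gauss_pdf.
have mfw : measurable_fun setT (f \o w) by exact: (measurableT_comp mf mw).
have mkw : measurable_fun setT (k \o w) by exact: (measurableT_comp mk mw).
transitivity (\int[nu]_p \int[lebesgue_cV R d]_y (f (w p) * k y)).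
  apply: eq_integral => p _; rewrite ge0_integralZl//.
  by rewrite integral_gauss_pdf mule1.
transitivity (\int[nu]_p \int[lebesgue_cV R d]_y (f (w p) * k (y + w p)%R)).
  apply: eq_integral => p _.
  rewrite (integral_lebesgue_cV_shift (w p) (f := fun y => f (w p) * k y))//.
    by apply: emeasurable_funM.
  by move=> y; rewrite mule_ge0.
transitivity (\int[lebesgue_cV R d]_y \int[nu]_p (f (w p) * k (y + w p)%R)).
  pose Q (q : ('cV[R]_r * 'cV[R]_n) * 'cV[R]_d) :=
    f (w q.1) * k (q.2 + w q.1)%R.
  have mQ : measurable_fun setT Q.
    apply: emeasurable_funM.
      exact: (measurableT_comp mfw measurable_fst).
    apply: (measurableT_comp mk); apply: measurable_addmx => //.
    exact: (measurableT_comp mw measurable_fst).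
  by apply: (fubini_tonelli Q mQ) => q; rewrite mule_ge0.
transitivity (\int[lebesgue_cV R d]_y \int[nu]_p (f (w p - y)%R * k (w p))).
  apply: eq_integral => y _.
  rewrite -[RHS](nu_shift (h := fun x => f (x - y)%R * k x) y).
  - by apply: eq_integral => p _; rewrite addrK addrC.
  - apply: emeasurable_funM => //.
    by apply: (measurableT_comp mf); exact: measurable_addmx.
  - by move=> x; rewrite mule_ge0.
transitivity (\int[nu]_p \int[lebesgue_cV R d]_y (f (w p - y)%R * k (w p))).
  apply/esym.
  pose Q (q : ('cV[R]_r * 'cV[R]_n) * 'cV[R]_d) :=
    f (w q.1 - q.2)%R * k (w q.1).
  have mQ : measurable_fun setT Q.
    apply: emeasurable_funM.
      apply: (measurableT_comp mf); apply: measurable_addmx.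
        exact: (measurableT_comp mw measurable_fst).
      exact: measurable_oppmx.
    exact: (measurableT_comp mkw measurable_fst).
  by apply: (fubini_tonelli Q mQ) => q; rewrite mule_ge0.
transitivity (\int[nu]_p (k (w p) * \int[lebesgue_cV R d]_y f y)).
  apply: eq_integral => p _.
  rewrite -ge0_integralZl//.
  (* The variable [y] enters [f] with a minus sign, hence a reflection in addition to the
     translation by [w p]. *)
  rewrite -[RHS](integral_lebesgue_cV_shift (w p)); last 2 first.
  - by apply: emeasurable_funM.
  - by move=> y; rewrite mule_ge0.
  rewrite -[RHS](integral_lebesgue_cV_opp); last 2 first.
  - apply: emeasurable_funM => //.
    by apply: (measurableT_comp mf); exact: measurable_addmx.
  - by move=> y; rewrite mule_ge0.
  by apply: eq_integral => y _; rewrite muleC [(- y + _)%R]addrC.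
rewrite ge0_integralZr//; last by apply: integral_ge0.
by rewrite nuk mul1e.
Qed.

Lemma integral_gauss_orthogonal (f : 'cV[R]_d -> \bar R) :
  measurable_fun setT f -> (forall x, 0 <= f x) ->
  \int[gauss_prob R r]_z \int[gauss_prob R n]_s f (U *m z + V *m s)%R =
  \int[gauss_prob R d]_x f x.
Proof.
move=> mf f0; rewrite [RHS]integral_gauss_prob//.
have mk : measurable_fun setT (fun x : 'cV[R]_d => f x * (gauss_pdf x)%:E).
  apply: emeasurable_funM => //; apply/measurable_EFinP.
  exact: measurable_gauss_pdf.
rewrite -integral_lebesgue_orthogonal//; last first.
  by move=> x; rewrite mule_ge0// lee_fin gauss_pdf_ge0.
have mfw : measurable_fun setT (f \o w) by exact: (measurableT_comp mf mw).
rewrite integral_gauss_prob; last 2 first.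
- exact: (measurable_fun_fubini_tonelli_F _ mfw (fun=> f0 _)).
- by move=> z; exact: integral_ge0.
apply: eq_integral => z _.
have mfz : measurable_fun setT (fun s : 'cV[R]_n => f (U *m z + V *m s)%R).
  apply: (measurableT_comp mf); apply: measurable_addmx => //.
  exact: measurable_mulmx.
rewrite integral_gauss_prob// -ge0_integralZr//; last 3 first.
- apply: emeasurable_funM => //; apply/measurable_EFinP.
  exact: measurable_gauss_pdf.
- by move=> s _; rewrite mule_ge0// lee_fin gauss_pdf_ge0.
- by rewrite lee_fin gauss_pdf_ge0.
apply: eq_integral => s _.
by rewrite gauss_pdf_orthogonal -muleA -EFinM [(gauss_pdf s * _)%R]mulrC.
Qed.

End orthogonal_change_of_variables.

(** * Gradients and Gaussian concentration *)

Section continuous_measurable.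
Context (R : realType) (n : nat).

Let grid_index (k : nat) (z : 'cV[R]_n) : 'cV[int]_n :=
  \col_i Num.floor (z i 0 * k.+1%:R).

Let grid_point (k : nat) (v : 'cV[int]_n) : 'cV[R]_n :=
  \col_i ((v i 0)%:~R / k.+1%:R).

Let measurable_cell k v : measurable (grid_index k @^-1` [set v]).
Proof.
rewrite (_ : _ @^-1` _ = \bigcap_(i in [set: 'I_n]) ((fun z : 'cV[R]_n => z i 0) @^-1`
    [set x | (v i 0)%:~R <= x * k.+1%:R < (v i 0 + 1)%:~R])); last first.
  apply/seteqP; split => z /=.
    by move=> <- i _ /=; rewrite mxE floor_itv.
  by move=> h; apply/colP => i; rewrite mxE; apply/eqP; rewrite floor_eq; exact: h.
apply: fin_bigcap_measurable => // i _; rewrite -[X in measurable X]setTI.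
apply: measurable_matrix_entry => //.
rewrite (_ : mkset _ = `[(v i 0)%:~R / k.+1%:R, (v i 0 + 1)%:~R / k.+1%:R[%classic).
  exact: measurable_itv.
apply/seteqP; split => x /=; rewrite in_itv/=.
  by rewrite ler_pdivrMr// ltr_pdivlMr.
by rewrite ler_pdivrMr// ltr_pdivlMr.
Qed.

(* The Borel sigma-algebra of the topology and the one generated by the entries
   agree: a continuous function is the limit of its discretizations on the
   grids of mesh 1/(k+1), which take countably many values. *)
Lemma continuous_measurable_cV (f : 'cV[R]_n -> R) : continuous f ->
  measurable_fun setT f.
Proof.
move=> cf; apply: (@measurable_fun_cvg _ _ _ _
    (fun k z => f (grid_point k (grid_index k z)))).
- move=> k _ B mB; rewrite setTI.
  (* Integer vectors form a countable type; decoding [m] lists the cells as a sequence, so the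
     preimage is a countable union of whole cells. *)
  pose cell m : set 'cV[R]_n := if unpickle m is Some v then
    [set z | grid_index k z = v /\ B (f (grid_point k v))] else set0.
  rewrite (_ : _ @^-1` _ = \bigcup_m cell m); last first.
    apply/seteqP; split => z /=.
      by move=> Bz; exists (pickle (grid_index k z)) => //; rewrite /cell pickleK.
    by move=> [m _]; rewrite /cell; case: unpickle => // v [/= -> ].
  apply: bigcup_measurable => m _; rewrite /cell.
  case: unpickle => // v; have [Bv|Bv] := pselect (B (f (grid_point k v))).
    rewrite (_ : mkset _ = grid_index k @^-1` [set v]); first exact: measurable_cell.
    by apply/seteqP; split => z /=; [case|split].
  rewrite (_ : mkset _ = set0)//.
  by apply/seteqP; split => z //= [].
- move=> z _; apply: (@cvg_comp _ _ _ _ f _ (nbhs z)); last exact: cf.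
  apply/cvg_ballP => e e0; near=> k; split => // i j.
  rewrite (ord1 j) /ball/= !mxE.
  have k0 : (0 : R) < k.+1%:R by rewrite ltr0n.
  have /andP[h1 h2] := floor_itv (z i 0 * k.+1%:R).
  have -> : z i 0 - (Num.floor (z i 0 * k.+1%:R))%:~R / k.+1%:R =
      (z i 0 * k.+1%:R - (Num.floor (z i 0 * k.+1%:R))%:~R) / k.+1%:R.
    by rewrite mulrBl mulfK// gt_eqF.
  rewrite ger0_norm; last by rewrite divr_ge0 ?subr_ge0// ltW.
  apply: (@lt_trans _ _ (k.+1%:R^-1)).
    by rewrite -[ltRHS]mul1r ltr_pM2r ?invr_gt0// ltrBlDl -intrD1.
  by near: k; exact: near_infty_natSinv_lt (PosNum e0).
Unshelve. all: by end_near. Qed.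

Lemma continuous_measurable_cV_mx m (v : 'cV[R]_n -> 'cV[R]_m) : continuous v ->
  measurable_fun setT v.
Proof.
move=> cv; apply: measurable_fun_matrixP => i j.
apply: continuous_measurable_cV => z.
exact: (continuous_comp (cv z) (@coord_continuous R m 1 i j _)).
Qed.

End continuous_measurable.

(** * Gradients and chain rules *)

Section gradient_theory.
Context (R : realType) (n : nat).

Lemma diff_gradient k (f : 'cV[R]_k -> R) (z v : 'cV[R]_k) : differentiable f z ->
  'd f z v = ((gradient f z)^T *m v) 0 0.
Proof.
move=> df; have {1}-> : v = \sum_i v i 0 *: delta_mx i 0.
  apply/colP => i; rewrite summxE (bigD1 i)//= !mxE !eqxx mulr1 big1 ?addr0//.
  by move=> j ji; rewrite !mxE eq_sym (negbTE ji) mulr0.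
rewrite linear_sum mxE; apply: eq_bigr => i _.
by rewrite linearZ/= !mxE deriveE// mulrC.
Qed.

Lemma continuous_mx (T : topologicalType) (p q : nat) (F : T -> 'M[R]_(p, q)) :
  (forall i j, continuous (fun t => F t i j)) -> continuous F.
Proof.
move=> cF t; apply/cvg_ballP => e e0.
have H : \forall t' \near t, forall ij : 'I_p * 'I_q,
    ball (F t ij.1 ij.2) e (F t' ij.1 ij.2).
  apply: filter_forall => ij.
  by have /cvg_ballP := cF ij.1 ij.2 t; apply.
by near=> t'; split => // i j; exact: (near H t' _ (i, j)).
Unshelve. all: by end_near. Qed.

Lemma continuous_mulmx (T : topologicalType) (k p q : nat) (A : 'M[R]_(k, p))
    (F : T -> 'M[R]_(p, q)) :
  continuous F -> continuous (fun t => A *m F t).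
Proof.
move=> cF; apply: continuous_mx => i j t.
rewrite /continuous_at mxE; under eq_fun do rewrite mxE.
apply: cvg_big => [|l _]; first exact: add_continuous.
apply: cvgM; first exact: cvg_cst.
exact: (continuous_comp (cF t) (@coord_continuous R _ _ l j _)).
Qed.

Section affine.
Context (d : nat) (f : 'cV[R]_d -> R) (a : 'cV[R]_d) (A : 'M[R]_(d, n)).
Hypothesis df : continuously_differentiable f.

Let h (s : 'cV[R]_n) := a + A *m s.

Let is_diff_h s : is_diff s h (mulmx A).
Proof.
have cA : continuous (mulmx A : 'cV[R]_n -> 'cV[R]_d).
  by apply: continuous_mulmx => x; exact: cvg_id.
have dA : is_diff s (mulmx A : 'cV[R]_n -> 'cV[R]_d) (mulmx A).
  by apply: DiffDef; [exact: linear_differentiable|exact: diff_lin].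
have -> : h = cst a + mulmx A by [].
by apply: is_diff_eq (is_diffD (is_diff_cst a s) dA) _; rewrite add0r.
Qed.

Let differentiable_h s : differentiable h s.
Proof. exact: (@ex_diff _ _ _ _ _ _ _ (is_diff_h s)). Qed.

Let differentiable_fh s : differentiable (f \o h) s.
Proof. by apply: differentiable_comp => //; exact: (proj1 df). Qed.

(** With [A = Up] this makes the gradient along a fiber the projection [Up^T *m gradient g], from
    which the trace residual arises. *)
Lemma gradient_affine s :
  gradient (fun s => f (a + A *m s)) s = A^T *m gradient f (a + A *m s).
Proof.
rewrite -/(f \o h); apply/colP => i; rewrite mxE deriveE//.
rewrite diff_comp//; last exact: (proj1 df).
rewrite /= (@diff_val _ _ _ _ _ _ _ (is_diff_h s)) diff_gradient; last exact: (proj1 df).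
rewrite mulmxA mxE [RHS]mxE (bigD1 i)//= big1 ?addr0.
  by rewrite !mxE !eqxx mulr1; apply: eq_bigr => j _; rewrite !mxE mulrC.
by move=> j ji; rewrite !mxE (negbTE ji) mulr0.
Qed.

Lemma continuously_differentiable_affine :
  continuously_differentiable (fun s => f (a + A *m s)).
Proof.
split; first exact: differentiable_fh.
rewrite (_ : gradient _ = fun s => A^T *m gradient f (h s)); last first.
  by apply/funext => s; exact: gradient_affine.
apply: continuous_mulmx => s; apply: (@continuous_comp _ _ _ h (gradient f)).
  exact: differentiable_continuous.
exact: (proj2 df).
Qed.

End affine.

(* rotate' is the derivative of rotate with respect to t *)
Definition rotate (t : R) (x y : 'cV[R]_n) : 'cV[R]_n := sin t *: x + cos t *: y.

Definition rotate' (t : R) (x y : 'cV[R]_n) : 'cV[R]_n := cos t *: x - sin t *: y.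

Lemma is_derive_rotate (f : 'cV[R]_n -> R) (x y : 'cV[R]_n) (t : R) :
  continuously_differentiable f ->
  is_derive t 1 (fun t => f (rotate t x y))
    (((gradient f (rotate t x y))^T *m rotate' t x y) 0 0).
Proof.
move=> df; pose c t := rotate t x y.
have dsin : differentiable (sin : R -> R) t by apply/derivable1_diffP.
have dcos : differentiable (cos : R -> R) t by apply/derivable1_diffP.
have dsx : is_diff t (fun t => sin t *: x) (fun h => 'd sin t h *: x).
  by apply: DiffDef; [exact: differentiableZl|exact: diffZl].
have dcy : is_diff t (fun t => cos t *: y) (fun h => 'd cos t h *: y).
  by apply: DiffDef; [exact: differentiableZl|exact: diffZl].
have dc := is_diffD dsx dcy.
have dct : differentiable c t by exact: (@ex_diff _ _ _ _ _ _ _ dc).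
have dfc : differentiable (f \o c) t.
  by apply: differentiable_comp => //; exact: (proj1 df).
apply: DeriveDef; first exact/derivable1_diffP.
rewrite -/(f \o c) deriveE// diff_comp//; last exact: (proj1 df).
rewrite /= diff_gradient; last exact: (proj1 df).
rewrite [in LHS](@diff_val _ _ _ _ _ _ _ dc)/= !fctE -!deriveE//.
by rewrite !derive_val /rotate' scaleNr.
Qed.

End gradient_theory.

Section tonelli3.
Local Open Scope ereal_scope.
Context d1 d2 d3 (T1 : measurableType d1) (T2 : measurableType d2)
  (T3 : measurableType d3) (R : realType).
Variables (m1 : {sigma_finite_measure set T1 -> \bar R})
  (m2 : {sigma_finite_measure set T2 -> \bar R})
  (m3 : {sigma_finite_measure set T3 -> \bar R}).

(** Brings the angle to the outside, where the two Gaussian integrals can be treated for each fixed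
    angle. *)
Lemma fubini_tonelli_rot (F : T1 * T2 * T3 -> \bar R) :
  measurable_fun setT F -> (forall x, 0 <= F x) ->
  \int[m1]_x \int[m2]_y \int[m3]_t F (x, y, t) =
  \int[m3]_t \int[m1]_x \int[m2]_y F (x, y, t).
Proof.
move=> mF F0; pose m12 := product_sigma_finite m1 m2.
transitivity (\int[m12]_p \int[m3]_t F (p, t)).
  rewrite (integral_product_sigma_finite m1 m2)//.
    exact: (measurable_fun_fubini_tonelli_F F mF F0).
  by move=> p; exact: integral_ge0.
have -> := fubini_tonelli (m1 := m12) (m2 := m3) F mF F0.
apply: eq_integral => t _.
rewrite (integral_product_sigma_finite m1 m2 (f := fun p => F (p, t)))//.
exact: (measurableT_comp mF (measurable_pair2 t)).
Qed.

End tonelli3.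

(** * Rotated Gaussian pairs and increments of functions *)

Section gaussian_rotation.
Local Open Scope ereal_scope.
Context (R : realType) (n : nat).
Local Notation G := (gauss_prob R n).

(** Both sides are the integral of one function against the Gaussian measure in dimension [n + n],
    decomposed along two orthonormal frames: [(U1, V1)] is the coordinate frame and [(U2, V2)] the
    rotated one. *)
Lemma integral_gauss_rotate (F : 'cV[R]_n * 'cV[R]_n -> \bar R) (t : R) :
  measurable_fun setT F -> (forall x, 0 <= F x) ->
  \int[G]_x \int[G]_y F (rotate t x y, rotate' t x y) =
  \int[G]_x \int[G]_y F (x, y).
Proof.
move=> mF F0.
pose f (w : 'cV[R]_(n + n)) := F (usubmx w, dsubmx w).
have mf : measurable_fun setT f.
  apply: (measurableT_comp mF); apply: measurable_fun_pair;
    apply: measurable_fun_matrixP => i j; under eq_fun do rewrite mxE;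
    exact: measurable_matrix_entry.
have f0 x : 0 <= f x by exact: F0.
pose U1 : 'M[R]_(n + n, n) := col_mx 1%:M 0.
pose V1 : 'M[R]_(n + n, n) := col_mx 0 1%:M.
pose U2 : 'M[R]_(n + n, n) := col_mx (sin t)%:M (cos t)%:M.
pose V2 : 'M[R]_(n + n, n) := col_mx (cos t)%:M (- sin t)%:M.
have trE (A B C D : 'M[R]_n) :
    ((col_mx A B)^T *m col_mx C D = A^T *m C + B^T *m D)%R.
  by rewrite tr_col_mx mul_row_col.
have cs := cos2Dsin2 t.
transitivity (\int[G]_x \int[G]_y f (U2 *m x + V2 *m y)%R).
  apply: eq_integral => x _; apply: eq_integral => y _; congr F.
  rewrite !mul_col_mx add_col_mx col_mxKu col_mxKd !mul_scalar_mx.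
  by rewrite scaleNr.
transitivity (\int[G]_x \int[G]_y f (U1 *m x + V1 *m y)%R); last first.
  apply: eq_integral => x _; apply: eq_integral => y _; congr F.
  by rewrite !mul_col_mx add_col_mx col_mxKu col_mxKd !mul1mx !mul0mx addr0 add0r.
have orth U V UU VV UV :=
  @integral_gauss_orthogonal R (n + n) n n U V erefl UU VV UV f mf f0.
transitivity (\int[gauss_prob R (n + n)]_x f x); last first.
  apply/esym/orth; rewrite trE trmx1 trmx0.
  - by rewrite mulmx1 mul0mx addr0.
  - by rewrite mulmx1 mul0mx add0r.
  - by rewrite mulmx0 mul0mx addr0.
apply: orth.
- rewrite trE !tr_scalar_mx -!scalar_mxM -raddfD/=; congr (_ %:M).
  by rewrite -cs; ring.
- rewrite trE !tr_scalar_mx -!scalar_mxM -raddfD/=; congr (_ %:M).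
  by rewrite -cs; ring.
- rewrite trE !tr_scalar_mx -!scalar_mxM -raddfD/= (_ : _ + _ = 0)%R ?raddf0//.
  by ring.
Qed.

Variable f : 'cV[R]_n -> R.
Hypothesis df : continuously_differentiable f.

Local Notation mR := (measurableTypeR R).
Local Notation mu := (@lebesgue_measure R).
Local Notation A := (`[0%R, (pi / 2)%R]%classic : set mR).

Let dot (v w : 'cV[R]_n) : R := ((v^T *m w) 0 0)%R.

Let u (p : 'cV[R]_n * 'cV[R]_n) (t : R) : R :=
  dot (gradient f (rotate t p.1 p.2)) (rotate' t p.1 p.2).

Let continuous_dot (T : topologicalType) (v w : T -> 'cV[R]_n) :
  continuous v -> continuous w -> continuous (fun t => dot (v t) (w t)).
Proof.
move=> cv cw.
have -> : (fun t => dot (v t) (w t)) =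
    (fun t => \sum_i v t i 0%R * w t i 0%R)%R.
  apply/funext => t; rewrite /dot mxE; apply: eq_bigr => i _.
  by rewrite mxE.
move=> t; apply: cvg_big => [|i _]; first exact: add_continuous.
apply: cvgM.
  exact: (continuous_comp (cv t) (@coord_continuous R n 1 i 0%R _)).
exact: (continuous_comp (cw t) (@coord_continuous R n 1 i 0%R _)).
Qed.

Let continuous_scalecst (k : R -> R) (x : 'cV[R]_n) :
  continuous k -> continuous (fun t => k t *: x)%R.
Proof.
move=> ck; apply: continuous_mx => i j.
have -> : (fun t => (k t *: x)%R i j) = (fun t => k t * x i j)%R.
  by apply/funext => t; rewrite mxE.
by move=> t; apply: cvgM; [exact: ck|exact: cvg_cst].
Qed.

Let continuous_u p : continuous (u p).
Proof.
have csx (x : 'cV[R]_n) : continuous (fun t => sin t *: x)%R.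
  exact: (continuous_scalecst (@continuous_sin R)).
have ccx (x : 'cV[R]_n) : continuous (fun t => cos t *: x)%R.
  exact: (continuous_scalecst (@continuous_cos R)).
apply: continuous_dot => t.
  apply: (@continuous_comp _ _ _ (fun t => rotate t p.1 p.2)).
    by apply: cvgD; [exact: csx|exact: ccx].
  exact: (proj2 df).
by apply: cvgB; [exact: ccx|exact: csx].
Qed.

Let pihalf_gt0 : (0 < pi / 2 :> R)%R. Proof. by rewrite divr_gt0// pi_gt0. Qed.

Let integral_u p : \int[mu]_(t in A) (u p t)%:E = (f p.1 - f p.2)%:E.
Proof.
rewrite (FTC_is_derive pihalf_gt0 (@continuous_u p)
  (fun t => is_derive_rotate p.1 p.2 t df)).
rewrite /rotate sin_pihalf cos_pihalf sin0 cos0 !scale1r !scale0r.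
by rewrite addr0 add0r.
Qed.

Let integrable_u (h : R -> R) : continuous h -> mu.-integrable A (EFin \o h).
Proof.
move=> ch; apply: continuous_compact_integrable; first exact: segment_compact.
exact: continuous_subspaceT.
Qed.

Let measurable_dotP d (S : measurableType d) (v w : S -> 'cV[R]_n) :
  measurable_fun setT v -> measurable_fun setT w ->
  measurable_fun setT (fun s => dot (v s) (w s)).
Proof.
move=> mv mw; rewrite /dot; under eq_fun do rewrite mxE.
apply: measurable_sum => i; apply: measurable_funM; last exact: measurable_entry.
by under eq_fun do rewrite mxE; exact: measurable_entry.
Qed.

Let mgrad : measurable_fun setT (gradient f).
Proof. exact: continuous_measurable_cV_mx (proj2 df). Qed.

Let measurable_u :
  measurable_fun setT (fun q : ('cV[R]_n * 'cV[R]_n) * mR => u q.1 q.2).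
Proof.
have msin : measurable_fun setT (sin : mR -> R).
  exact: (continuous_measurable_fun (@continuous_sin R)).
have mcos : measurable_fun setT (cos : mR -> R).
  exact: (continuous_measurable_fun (@continuous_cos R)).
have mp1 : measurable_fun setT
    (fun q : ('cV[R]_n * 'cV[R]_n) * mR => q.1.1).
  exact: (measurableT_comp measurable_fst measurable_fst).
have mp2 : measurable_fun setT
    (fun q : ('cV[R]_n * 'cV[R]_n) * mR => q.1.2).
  exact: (measurableT_comp measurable_snd measurable_fst).
have msq : measurable_fun setT
    (fun q : ('cV[R]_n * 'cV[R]_n) * mR => sin q.2).
  exact: (measurableT_comp msin measurable_snd).
have mcq : measurable_fun setT
    (fun q : ('cV[R]_n * 'cV[R]_n) * mR => cos q.2).
  exact: (measurableT_comp mcos measurable_snd).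
apply: measurable_dotP.
  apply: (measurableT_comp mgrad).
  by apply: measurable_addmx; exact: measurable_scalemx.
apply: measurable_addmx; first exact: measurable_scalemx.
by apply: measurable_oppmx; exact: measurable_scalemx.
Qed.

Let lebesgue_measure_pihalf : mu A = (pi / 2)%:E.
Proof. by rewrite lebesgue_measure_itv/= lte_fin pihalf_gt0 oppr0 adde0. Qed.

(** Common to both exponents. The last hypothesis is Jensen's inequality along the rotation path,
    with [K = 1] for the absolute value and [K = pi / 2] for the square; the other factor [pi / 2]
    is the length of the range of angles. *)
Lemma integral_gauss_increment_le (Phi : R -> R) (K : R) :
  measurable_fun setT Phi -> (forall x, 0 <= Phi x)%R -> (0 <= K)%R ->
  (forall p, (Phi (f p.1 - f p.2))%:E <=
    K%:E * \int[mu]_(t in A) (Phi (u p t))%:E) ->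
  \int[G]_x \int[G]_y (Phi (f x - f y))%:E <=
  (K * (pi / 2))%:E *
    \int[G]_x \int[G]_y (Phi (((gradient f x)^T *m y) 0 0)%R)%:E.
Proof.
move=> mPhi Phi0 K0 hPhi.
pose I := \int[G]_x \int[G]_y (Phi (((gradient f x)^T *m y) 0 0)%R)%:E.
have mF : measurable_fun setT
    (fun p : 'cV[R]_n * 'cV[R]_n => (Phi (dot (gradient f p.1) p.2))%:E).
  apply/measurable_EFinP; apply: (measurableT_comp mPhi).
  by apply: measurable_dotP => //; exact: (measurableT_comp mgrad).
have F0 (p : 'cV[R]_n * 'cV[R]_n) :
    0 <= (Phi (dot (gradient f p.1) p.2))%:E by rewrite lee_fin.
have mA : measurable A by exact: measurable_itv.
pose Q (q : ('cV[R]_n * 'cV[R]_n) * mR) : \bar R :=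
  (Phi (u q.1 q.2))%:E * (\1_A q.2)%:E.
have mPu : measurable_fun setT
    (fun q : ('cV[R]_n * 'cV[R]_n) * mR => (Phi (u q.1 q.2))%:E).
  by apply/measurable_EFinP; exact: (measurableT_comp mPhi measurable_u).
have mQ : measurable_fun setT Q.
  apply: emeasurable_funM => //; apply/measurable_EFinP.
  apply: (measurableT_comp _ measurable_snd).
  exact: measurable_indic.
have Q0 q : 0 <= Q q by rewrite mule_ge0// lee_fin.
have QA p : \int[mu]_(t in A) (Phi (u p t))%:E = \int[mu]_t Q (p, t).
  rewrite integral_mkcond; apply: eq_integral => t _.
  by rewrite epatch_indic.
have mQF : measurable_fun setT (fun p => \int[mu]_t Q (p, t)).
  exact: (measurable_fun_fubini_tonelli_F Q mQ Q0).
have QF0 p : 0 <= \int[mu]_t Q (p, t) by exact: integral_ge0.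
have mff : measurable_fun setT f.
  apply: continuous_measurable_cV => x.
  exact: (differentiable_continuous (proj1 df x)).
have mL : measurable_fun setT
    (fun p : 'cV[R]_n * 'cV[R]_n => (Phi (f p.1 - f p.2))%:E).
  apply/measurable_EFinP; apply: (measurableT_comp mPhi).
  by apply: measurable_funB; exact: (measurableT_comp mff).
have L0 (p : 'cV[R]_n * 'cV[R]_n) : 0 <= (Phi (f p.1 - f p.2))%:E.
  by rewrite lee_fin.
have mKQ : measurable_fun setT (fun p => K%:E * \int[mu]_t Q (p, t)).
  exact: emeasurable_funM.
apply: (@le_trans _ _
    (\int[G]_x \int[G]_y (K%:E * \int[mu]_t Q ((x, y), t)))).
  apply: ge0_le_integral => //.
  - by move=> x _; apply: integral_ge0 => y _; rewrite lee_fin.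
  - exact: (measurable_fun_fubini_tonelli_F _ mL L0).
  - apply: (measurable_fun_fubini_tonelli_F _ mKQ) => p.
    by rewrite mule_ge0.
  - move=> x _; apply: ge0_le_integral => //.
    + by move=> y _; rewrite lee_fin.
    + exact: (measurableT_comp mL (measurable_pair1 x)).
    + exact: (measurableT_comp mKQ (measurable_pair1 x)).
    + by move=> y _; rewrite -QA; exact: hPhi.
have -> : \int[G]_x \int[G]_y (K%:E * \int[mu]_t Q (x, y, t)) =
    K%:E * \int[G]_x \int[G]_y \int[mu]_t Q (x, y, t).
  rewrite -ge0_integralZl//.
  - apply: eq_integral => x _; rewrite ge0_integralZl//.
    exact: (measurableT_comp mQF (measurable_pair1 x)).
  - exact: (measurable_fun_fubini_tonelli_F _ mQF QF0).
  - by move=> x _; exact: integral_ge0.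
(* For a fixed angle, the rotated pair has the law of the original one, so the inner double integral
   is [I] whatever [t] is. *)
rewrite (fubini_tonelli_rot G G mu mQ Q0).
have -> : \int[mu]_t \int[G]_x \int[G]_y Q (x, y, t) =
    \int[mu]_t (I * (\1_A t)%:E).
  apply: eq_integral => t _; rewrite -[I](integral_gauss_rotate t mF F0).
  have mPut : measurable_fun setT (fun p => (Phi (u p t))%:E).
    exact: (measurableT_comp mPu (measurable_pair2 t)).
  have Put0 p : 0 <= (Phi (u p t))%:E by rewrite lee_fin.
  rewrite -ge0_integralZr//.
  - apply: eq_integral => x _; rewrite -ge0_integralZr//.
    exact: (measurableT_comp mPut (measurable_pair1 x)).
  - exact: (measurable_fun_fubini_tonelli_F _ mPut Put0).
  - by move=> x _; exact: integral_ge0.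
rewrite ge0_integralZl//; last 2 first.
- by apply/measurable_EFinP; exact: measurable_indic.
- by apply: integral_ge0 => x _; apply: integral_ge0 => y _; rewrite lee_fin.
have -> : \int[mu]_t (\1_A t)%:E = (pi / 2)%:E.
  by rewrite integral_indic// setIT; exact: lebesgue_measure_pihalf.
by rewrite -/I EFinM (muleC I) muleA.
Qed.

Lemma integral_gauss_increment_norm_le :
  \int[G]_x \int[G]_y (`|f x - f y|%R)%:E <=
  (pi / 2)%:E * \int[G]_x \int[G]_y (`|((gradient f x)^T *m y) 0 0|%R)%:E.
Proof.
have := @integral_gauss_increment_le Num.norm 1.
rewrite mul1r; apply => // p.
rewrite mul1e (_ : _%:E = `|(f p.1 - f p.2)%:E|)// -integral_u.
apply: le_abse_integral => //.
by apply: measurable_int; exact: (integrable_u (@continuous_u p)).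
Qed.

Lemma integral_gauss_increment_sqr_le :
  \int[G]_x \int[G]_y ((f x - f y) ^+ 2)%:E <=
  ((pi / 2) ^+ 2)%:E * \int[G]_x \int[G]_y ((((gradient f x)^T *m y) 0 0) ^+ 2)%R%:E.
Proof.
rewrite expr2; apply: (@integral_gauss_increment_le (fun x => x ^+ 2)%R (pi / 2)).
- exact: measurable_funX.
- by move=> x; exact: sqr_ge0.
- exact: ltW.
move=> p; set a := (f p.1 - f p.2)%R; set L := (pi / 2)%R.
have L0 : (0 < L)%R by exact: pihalf_gt0.
have iu := integrable_u (@continuous_u p).
have iu2 : mu.-integrable A (EFin \o (fun t => u p t ^+ 2)%R).
  apply: integrable_u => t.
  exact: (continuous_comp (@continuous_u p t) (@sqr_continuous R _)).
have ic (c : R) : mu.-integrable A (EFin \o cst c).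
  by apply: integrable_u => t; exact: cvg_cst.
(* The Cauchy-Schwarz inequality in the form of a nonnegative square: [a / L] is the mean of [u p]
   over the interval, and the integral of [(u p t - a / L) ^ 2] is nonnegative. *)
have H : \int[mu]_(t in A) ((2 * (a / L))%:E * (u p t)%:E) <=
    \int[mu]_(t in A) ((u p t ^+ 2)%:E + ((a / L) ^+ 2)%:E).
  apply: le_integral => //; first exact: integrableZl.
    by apply: (integrableD _ iu2 (ic _)); exact: measurable_itv.
  move=> t _; rewrite lee_fin; have := sqr_ge0 (u p t - a / L); nra.
have mA : measurable A by exact: measurable_itv.
rewrite integralZl// integral_u integralD// ?[X in _ + X](integral_cst mu mA) in H;
  last exact: ic.
rewrite [X in _ + _ * X]lebesgue_measure_pihalf in H.
rewrite -/a -/L -!EFinM in H.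
rewrite -lee_pdivrMl// -EFinM.
have -> : (L^-1 * a ^+ 2 = 2 * (a / L) * a - (a / L) ^+ 2 * L)%R.
  by field; rewrite gt_eqF.
by rewrite EFinB leeBlDr.
Qed.

End gaussian_rotation.

(** * Comparison of the acceptance probabilities *)

(** Here [x] and [y] stand for estimators divided by their means, so the left side averages to [M].
    The proof writes [Num.min x y] as the half-sum minus [|x - y| / 2] and bounds the latter by
    AM-GM. The difference is displayed as [x - 1 - (y - 1)] to show centered variables. *)
Lemma scaled_min_le (R : realFieldType) (A B M x y t : R) :
  0 < t -> 0 <= M -> M <= A -> M <= B -> 0 <= x -> 0 <= y ->
  M / 2 * x + M / 2 * y <=
  Num.min (A * x) (B * y) + M * t / 4 + M / (4 * t) * (x - 1 - (y - 1)) ^+ 2.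
Proof.
move=> t0 M0 MA MB x0 y0.
have h (z : R) : `|z| / 2 <= t / 4 + z ^+ 2 / (4 * t).
  rewrite -subr_ge0 (_ : _ - _ = (`|z| - t) ^+ 2 / (4 * t)).
    by rewrite divr_ge0 ?sqr_ge0// mulr_ge0// ltW.
  by rewrite -(real_normK (num_real z)); field; rewrite gt_eqF.
have hM := ler_wpM2l M0 (h (x - y)).
have Ax : M * x <= A * x by rewrite ler_wpM2r.
have By : M * y <= B * y by rewrite ler_wpM2r.
have Mmin : M * Num.min x y <= Num.min (A * x) (B * y).
  rewrite le_min; apply/andP; split.
    by apply: le_trans Ax; rewrite ler_wpM2l// ge_min lexx.
  by apply: le_trans By; rewrite ler_wpM2l// ge_min lexx orbT.
rewrite (_ : x - 1 - (y - 1) = x - y); last by ring.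
rewrite (_ : M / (4 * t) * (x - y) ^+ 2 = M * ((x - y) ^+ 2 / (4 * t))); last by ring.
have minE : Num.min x y = (x + y - `|x - y|) / 2.
  by case: (leP x y) => ?; case: (ger0P (x - y)) => ?; lra.
by rewrite minE in Mmin; lra.
Qed.

(** * Minimum of the means against mean of the minimum *)

Section pseudo_marginal_coupling.
Local Open Scope ereal_scope.
Context d (T : measurableType d) (R : realType).
Variable Q : {sigma_finite_measure set T -> \bar R}.
Hypothesis Q1 : Q setT = 1.

Let integral2_cstr (u : T -> R) :
  \int[Q]_s \int[Q]_s' (u s)%:E = \int[Q]_s (u s)%:E.
Proof. by apply: eq_integral => s _; exact: integral_cst_mass1. Qed.

Let integral2_cstl (v : T -> R) :
  \int[Q]_s \int[Q]_s' (v s')%:E = \int[Q]_s (v s)%:E.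
Proof. exact: integral_cst_mass1. Qed.

Let integral2_sum (F : T * T -> R) (u v : T -> R) :
  measurable_fun setT F -> measurable_fun setT u -> measurable_fun setT v ->
  (forall x, 0 <= F x)%R -> (forall s, 0 <= u s)%R -> (forall s, 0 <= v s)%R ->
  \int[Q]_s \int[Q]_s' (F (s, s') + u s + v s')%:E =
  \int[Q]_s \int[Q]_s' (F (s, s'))%:E + \int[Q]_s (u s)%:E + \int[Q]_s (v s)%:E.
Proof.
move=> mF mu mv F0 u0 v0.
have mEF : measurable_fun setT (EFin \o F) by exact/measurable_EFinP.
have mEu : measurable_fun setT (EFin \o u) by exact/measurable_EFinP.
have mEv : measurable_fun setT (EFin \o v) by exact/measurable_EFinP.
have mIF : measurable_fun setT (fun s => \int[Q]_s' (F (s, s'))%:E).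
  by apply: (measurable_fun_fubini_tonelli_F _ mEF) => x; rewrite lee_fin.
have IF0 s : 0 <= \int[Q]_s' (F (s, s'))%:E.
  by apply: integral_ge0 => s' _; rewrite lee_fin.
have Iv0 : 0 <= \int[Q]_s (v s)%:E by apply: integral_ge0 => s _; rewrite lee_fin.
transitivity (\int[Q]_s ((\int[Q]_s' (F (s, s'))%:E + (u s)%:E) +
    \int[Q]_s' (v s')%:E)).
  apply: eq_integral => s _.
  have mFs : measurable_fun setT (fun s' => (F (s, s'))%:E).
    exact: (measurableT_comp mEF (measurable_pair1 s)).
  under eq_integral do rewrite !EFinD.
  rewrite ge0_integralD//; last 3 first.
  - by move=> s' _; rewrite -EFinD lee_fin addr_ge0.
  - by apply: emeasurable_funD.
  - by move=> s' _; rewrite lee_fin.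
  congr (_ + _); rewrite ge0_integralD//; last 2 first.
  - by move=> s' _; rewrite lee_fin.
  - by move=> s' _; rewrite lee_fin.
  by rewrite integral_cst_mass1.
rewrite ge0_integralD//; last 2 first.
- by move=> s _; rewrite adde_ge0// lee_fin.
- exact: emeasurable_funD.
rewrite integral_cst_mass1// ge0_integralD//.
by move=> s _; rewrite lee_fin.
Qed.

Variables (L L' : T -> R) (a b c c' : R).
Hypotheses (mL : measurable_fun setT L) (mL' : measurable_fun setT L').
Hypotheses (L0 : forall s, (0 <= L s)%R) (L'0 : forall s, (0 <= L' s)%R).
Hypotheses (La : \int[Q]_s (L s)%:E = a%:E) (L'b : \int[Q]_s (L' s)%:E = b%:E).
Hypotheses (c0 : (0 <= c)%R) (c'0 : (0 <= c')%R).

Let a0 : (0 <= a)%R.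
Proof. by rewrite -lee_fin -La; apply: integral_ge0 => s _; rewrite lee_fin. Qed.

Let b0 : (0 <= b)%R.
Proof. by rewrite -lee_fin -L'b; apply: integral_ge0 => s _; rewrite lee_fin. Qed.

Let F (x : T * T) : R := (Num.min (c * L x.1) (c' * L' x.2))%R.

Let mF : measurable_fun setT F.
Proof.
apply: measurable_minr; apply: measurable_funM => //.
  exact: (measurableT_comp mL measurable_fst).
exact: (measurableT_comp mL' measurable_snd).
Qed.

Let F0 x : (0 <= F x)%R.
Proof. by rewrite le_min !mulr_ge0. Qed.

Let mZ (k : R) (h : T -> R) : measurable_fun setT h ->
  measurable_fun setT (fun s => k * h s)%R.
Proof. by move=> mh; exact: measurable_funM. Qed.

Let integralZ (k : R) (h : T -> R) : (0 <= k)%R -> measurable_fun setT h ->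
  (forall s, 0 <= h s)%R ->
  \int[Q]_s (k * h s)%:E = k%:E * \int[Q]_s (h s)%:E.
Proof.
move=> k0 mh h0; under eq_integral do rewrite EFinM.
by rewrite ge0_integralZl//; [exact/measurable_EFinP|move=> s _; rewrite lee_fin].
Qed.

Let le_integral2 (f1 f2 : T * T -> R) : measurable_fun setT f1 ->
  measurable_fun setT f2 -> (forall x, 0 <= f1 x <= f2 x)%R ->
  \int[Q]_s \int[Q]_s' (f1 (s, s'))%:E <= \int[Q]_s \int[Q]_s' (f2 (s, s'))%:E.
Proof.
move=> m1 m2 f12.
have f10 x : (0 <= f1 x)%R by case/andP: (f12 x).
have f20 x : (0 <= f2 x)%R by case/andP: (f12 x); exact: le_trans.
have mE1 : measurable_fun setT (EFin \o f1) by exact/measurable_EFinP.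
have mE2 : measurable_fun setT (EFin \o f2) by exact/measurable_EFinP.
apply: ge0_le_integral => //.
- by move=> s _; apply: integral_ge0 => s' _; rewrite lee_fin.
- by apply: (measurable_fun_fubini_tonelli_F _ mE1) => x; rewrite lee_fin.
- by apply: (measurable_fun_fubini_tonelli_F _ mE2) => x; rewrite lee_fin.
move=> s _; apply: ge0_le_integral => //.
- by move=> s' _; rewrite lee_fin.
- exact: (measurableT_comp mE1 (measurable_pair1 s)).
- exact: (measurableT_comp mE2 (measurable_pair1 s)).
- by move=> s' _; rewrite lee_fin; case/andP: (f12 (s, s')).
Qed.

(* Jensen's inequality for the concave function min *)
Lemma integral_min_le :
  \int[Q]_s \int[Q]_s' (Num.min (c * L s) (c' * L' s'))%:E <=
  (Num.min (c * a) (c' * b))%:E.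
Proof.
rewrite EFin_min le_min; apply/andP; split.
- rewrite EFinM -La -integralZ// -integral2_cstr.
  apply: (@le_integral2 F (fun x => c * L x.1)%R) => //.
    by apply: measurable_funM => //; exact: (measurableT_comp mL measurable_fst).
  by move=> x; rewrite F0/= ge_min lexx.
- rewrite EFinM -L'b -integralZ// -integral2_cstl.
  apply: (@le_integral2 F (fun x => c' * L' x.2)%R) => //.
    by apply: measurable_funM => //; exact: (measurableT_comp mL' measurable_snd).
  by move=> x; rewrite F0/= ge_min lexx orbT.
Qed.

Let integral2_addr (k : R) : (0 <= k)%R ->
  \int[Q]_s \int[Q]_s' (F (s, s') + k)%:E =
  \int[Q]_s \int[Q]_s' (F (s, s'))%:E + k%:E.
Proof.
move=> k0; have mcst (e : R) : measurable_fun setT (cst e : T -> R) by [].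
have := integral2_sum mF (mcst k) (mcst 0%R) F0 (fun=> k0) (fun=> lexx _).
have ck (e : R) : \int[Q]_s (cst e s)%:E = e%:E by apply: (integral_cst_mass1 e%:E).
rewrite !ck adde0 => <-.
by apply: eq_integral => s _; apply: eq_integral => s' _; rewrite addr0.
Qed.

Let mnorm (h : T -> R) (e : R) : measurable_fun setT h ->
  measurable_fun setT (fun s => `|h s - e|%R).
Proof. by move=> mh; apply: measurableT_comp => //; exact: measurable_funB. Qed.

Let integral2D (f1 f2 : T * T -> R) :
  measurable_fun setT f1 -> measurable_fun setT f2 ->
  (forall x, 0 <= f1 x)%R -> (forall x, 0 <= f2 x)%R ->
  \int[Q]_s \int[Q]_s' (f1 (s, s') + f2 (s, s'))%:E =
  \int[Q]_s \int[Q]_s' (f1 (s, s'))%:E + \int[Q]_s \int[Q]_s' (f2 (s, s'))%:E.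
Proof.
move=> m1 m2 f10 f20.
have mE1 : measurable_fun setT (EFin \o f1) by exact/measurable_EFinP.
have mE2 : measurable_fun setT (EFin \o f2) by exact/measurable_EFinP.
rewrite -ge0_integralD//.
- apply: eq_integral => s _; under eq_integral do rewrite EFinD.
  rewrite ge0_integralD//.
  + by move=> s' _; rewrite lee_fin.
  + exact: (measurableT_comp mE1 (measurable_pair1 s)).
  + by move=> s' _; rewrite lee_fin.
  + exact: (measurableT_comp mE2 (measurable_pair1 s)).
- by move=> s _; apply: integral_ge0 => s' _; rewrite lee_fin.
- by apply: (measurable_fun_fubini_tonelli_F _ mE1) => x; rewrite lee_fin.
- by move=> s _; apply: integral_ge0 => s' _; rewrite lee_fin.
- by apply: (measurable_fun_fubini_tonelli_F _ mE2) => x; rewrite lee_fin.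
Qed.

Let integral2Z (k : R) (f1 : T * T -> R) : (0 <= k)%R ->
  measurable_fun setT f1 -> (forall x, 0 <= f1 x)%R ->
  \int[Q]_s \int[Q]_s' (k * f1 (s, s'))%:E =
  k%:E * \int[Q]_s \int[Q]_s' (f1 (s, s'))%:E.
Proof.
move=> k0 m1 f10.
have mE1 : measurable_fun setT (EFin \o f1) by exact/measurable_EFinP.
rewrite -ge0_integralZl//.
- apply: eq_integral => s _; apply: integralZ => //.
  exact: (measurableT_comp m1 (measurable_pair1 s)).
- by apply: (measurable_fun_fubini_tonelli_F _ mE1) => x; rewrite lee_fin.
- by move=> s _; apply: integral_ge0 => s' _; rewrite lee_fin.
Qed.

Let integral2_mean (m x y : R) : (0 <= m)%R -> (0 <= x)%R -> (0 <= y)%R ->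
  \int[Q]_s \int[Q]_s' (m + x * L s + y * L' s')%:E = (m + x * a + y * b)%:E.
Proof.
move=> m0 x0 y0.
have mm : measurable_fun setT (cst m : T * T -> R) by [].
have := integral2_sum mm (mZ x mL) (mZ y mL') (fun=> m0)
  (fun s => mulr_ge0 x0 (L0 s)) (fun s => mulr_ge0 y0 (L'0 s)).
have -> : \int[Q]_s \int[Q]_s' (cst m (s, s'))%:E = m%:E.
  rewrite -[RHS](integral_cst_mass1 m%:E Q1); apply: eq_integral => s _;
  exact: (integral_cst_mass1 m%:E).
by rewrite !integralZ// La L'b -!EFinM -!EFinD => <-.
Qed.

Let addeC4 (x y z v : \bar R) : x + y + z + v = x + (z + v) + y.
Proof. by rewrite -!addeA; congr (_ + _); rewrite addeC -addeA. Qed.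

(** A minimum is the half-sum minus half the absolute difference. The half-sums have equal means and
    cancel; this saves a factor 2 over a termwise Lipschitz bound for the minimum. *)
Lemma min_le_integral_min_norm :
  (Num.min (c * a) (c' * b))%:E <=
  \int[Q]_s \int[Q]_s' (Num.min (c * L s) (c' * L' s'))%:E +
  ((c / 2)%:E * \int[Q]_s (`|L s - a|%R)%:E +
   (c' / 2)%:E * \int[Q]_s (`|L' s - b|%R)%:E).
Proof.
(* The common mean of the half-sums is added to both sides, so that only nonnegative functions are
   integrated. *)
pose k := (c / 2 * a + c' / 2 * b)%R.
have c20 : (0 <= c / 2)%R by rewrite divr_ge0.
have c'20 : (0 <= c' / 2)%R by rewrite divr_ge0.
have k0 : (0 <= k)%R by rewrite addr_ge0// mulr_ge0.
have m0 : (0 <= Num.min (c * a) (c' * b))%R by rewrite le_min !mulr_ge0.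
rewrite -(@leeD2rE _ k%:E)// -EFinD /k addrA -(integral2_mean m0 c20 c'20).
rewrite -/k.
apply: (@le_trans _ _ (\int[Q]_s \int[Q]_s' (F (s, s') + k +
    c / 2 * `|L s - a| + c' / 2 * `|L' s' - b|)%R%:E)); last first.
  rewrite (@integral2_sum (fun x => F x + k)%R (fun s => c / 2 * `|L s - a|)%R
    (fun s => c' / 2 * `|L' s - b|)%R).
  - rewrite integral2_addr// !integralZ//; [|exact: mnorm|exact: mnorm].
    by rewrite addeC4 lexx.
  - exact: measurable_funD.
  - by apply: mZ; exact: mnorm.
  - by apply: mZ; exact: mnorm.
  - by move=> x; rewrite addr_ge0.
  - by move=> s; rewrite mulr_ge0.
  - by move=> s; rewrite mulr_ge0.
apply: (@le_integral2 (fun x => Num.min (c * a) (c' * b) + c / 2 * L x.1 +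
  c' / 2 * L' x.2)%R (fun x => F x + k + c / 2 * `|L x.1 - a| +
     c' / 2 * `|L' x.2 - b|)%R).
- apply: measurable_funD; first apply: measurable_funD => //.
    by apply: measurable_funM => //; exact: (measurableT_comp mL measurable_fst).
  by apply: measurable_funM => //; exact: (measurableT_comp mL' measurable_snd).
- apply: measurable_funD; first apply: measurable_funD.
  + exact: measurable_funD.
  + apply: measurable_funM => //.
    exact: (measurableT_comp (mnorm _ mL) measurable_fst).
  + apply: measurable_funM => //.
    exact: (measurableT_comp (mnorm _ mL') measurable_snd).
- move=> [s s']; rewrite /F /k/=; apply/andP; split.
    by rewrite !addr_ge0// mulr_ge0.
  have cE (z e : R) : (0 <= z)%R -> (z / 2 * `|e| = `|z * e| / 2)%R.
    by move=> z0; rewrite normrM (ger0_norm z0) mulrAC.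
  rewrite !cE// !mulrBr !(mulrAC _ (2^-1)%R).
  have key (A B x y : R) : (Num.min A B + x / 2 + y / 2 <=
      Num.min x y + (A / 2 + B / 2) + `|x - A| / 2 + `|y - B| / 2)%R.
    by case: (leP A B) => ?; case: (leP x y) => ?;
      case: (ger0P (x - A)) => ?; case: (ger0P (y - B)) => ?; lra.
  exact: key.
Qed.

(** The variance bounds carry the mean as a factor so that the normalized estimators have variances
    at most [nu / a] and [nu' / b]. Multiplied by the minimum, the denominators disappear and the
    error stays linear. *)
Lemma min_le_integral_min_sqr (t nu nu' : R) : (0 < t)%R ->
  (0 < a)%R -> (0 < b)%R ->
  \int[Q]_s ((L s - a) ^+ 2)%:E <= (a * nu)%:E ->
  \int[Q]_s ((L' s - b) ^+ 2)%:E <= (b * nu')%:E ->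
  (Num.min (c * a) (c' * b))%:E <=
  \int[Q]_s \int[Q]_s' (Num.min (c * L s) (c' * L' s'))%:E +
  (t / 8 * (c * a + c' * b) + (4 * t)^-1 * (c * nu + c' * nu'))%:E.
Proof.
move=> t0 a_gt0 b_gt0 Vnu Vnu'.
pose M := (Num.min (c * a) (c' * b))%R.
have M0 : (0 <= M)%R by rewrite le_min !mulr_ge0.
pose w s := (L s / a)%R; pose w' s := (L' s / b)%R.
pose X s := (w s - 1)%R; pose X' s := (w' s - 1)%R.
have mX : measurable_fun setT X.
  by apply: measurable_funB => //; exact: measurable_funM.
have mX' : measurable_fun setT X'.
  by apply: measurable_funB => //; exact: measurable_funM.
have mean (h : T -> R) (e : R) : measurable_fun setT h -> (0 < e)%R ->
    (forall s, 0 <= h s)%R -> \int[Q]_s (h s)%:E = e%:E ->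
    \int[Q]_s (h s / e - 1)%:E = 0.
  move=> mh e0 h0 he.
  have ih : Q.-integrable setT (EFin \o (fun s => e^-1 * h s)%R).
    apply/integrableP; split; first by apply/measurable_EFinP; exact: mZ.
    under eq_integral => s _.
      rewrite /= ger0_norm; last by rewrite mulr_ge0// invr_ge0 ltW.
      over.
    by rewrite integralZ// ?invr_ge0 ?ltW// he -EFinM ltry.
  have i1 : Q.-integrable setT (EFin \o cst 1%R).
    apply/integrableP; split; first by apply/measurable_EFinP.
    under eq_integral do rewrite /= normr1.
    by rewrite (integral_cst_mass1 _ Q1) ltry.
  under eq_integral do rewrite mulrC EFinB.
  rewrite integralB// (integral_cst_mass1 _ Q1).
  rewrite integralZ// ?invr_ge0 ?ltW// he -EFinM mulVf ?gt_eqF//.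
  by rewrite -EFinB subrr.
have varX (h : T -> R) (e n : R) : measurable_fun setT h -> (0 < e)%R ->
    \int[Q]_s ((h s - e) ^+ 2)%:E <= (e * n)%:E ->
    \int[Q]_s ((h s / e - 1) ^+ 2)%:E <= (n / e)%:E.
  move=> mh e0 hn.
  have -> : \int[Q]_s ((h s / e - 1) ^+ 2)%:E =
      (e ^- 2)%:E * \int[Q]_s ((h s - e) ^+ 2)%:E.
    rewrite -integralZ.
    - apply: eq_integral => s _; congr EFin; field; rewrite gt_eqF//.
    - by rewrite invr_ge0 sqr_ge0.
    - by apply: measurable_funX; exact: measurable_funB.
    - by move=> s; exact: sqr_ge0.
  rewrite (_ : (n / e)%:E = (e ^- 2)%:E * (e * n)%:E); last first.
    by rewrite -EFinM; congr EFin; field; rewrite gt_eqF.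
  by apply: lee_wpmul2l => //; rewrite lee_fin invr_ge0 sqr_ge0.
have VX := varX _ _ _ mL a_gt0 Vnu; have VX' := varX _ _ _ mL' b_gt0 Vnu'.
have X2 : \int[Q]_s (X s ^+ 2)%:E < +oo by rewrite (le_lt_trans VX)// ltry.
have X'2 : \int[Q]_s (X' s ^+ 2)%:E < +oo by rewrite (le_lt_trans VX')// ltry.
have EX := mean _ _ mL a_gt0 L0 La; have EX' := mean _ _ mL' b_gt0 L'0 L'b.
have V0 (Y : T -> R) : 0 <= \int[Q]_s (Y s ^+ 2)%:E.
  by apply: integral_ge0 => s _; rewrite lee_fin sqr_ge0.
pose D (x : T * T) := ((X x.1 - X' x.2) ^+ 2)%R.
have mD : measurable_fun setT D.
  apply: measurable_funX; apply: measurable_funB.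
    exact: (measurableT_comp mX measurable_fst).
  exact: (measurableT_comp mX' measurable_snd).
have D0 x : (0 <= D x)%R by exact: sqr_ge0.
(* Variances of independent centered variables add: for fixed [s], the inner integral is a second
   moment shifted by [- X s]. *)
have intD : \int[Q]_s \int[Q]_s' (D (s, s'))%:E <= (nu / a + nu' / b)%:E.
  rewrite EFinD; apply: le_trans (leeD VX VX').
  have -> : \int[Q]_s \int[Q]_s' (D (s, s'))%:E =
      \int[Q]_s ((X s ^+ 2)%:E + \int[Q]_s' (X' s' ^+ 2)%:E).
    apply: eq_integral => s _.
    rewrite addeC -sqrrN -(integral_sqr_shift (- X s)%R Q1 mX' X'2 EX').
    by apply: eq_integral => s' _; congr EFin; rewrite /D/=; ring.
  rewrite ge0_integralD//; last 2 first.
  - by move=> s _; rewrite lee_fin sqr_ge0.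
  - by apply/measurable_EFinP; exact: measurable_funX.
  by rewrite (integral_cst_mass1 _ Q1).
pose K1 := (M * t / 4)%R; pose K2 := (M / (4 * t))%R.
have K10 : (0 <= K1)%R by rewrite divr_ge0// mulr_ge0// ltW.
have K20 : (0 <= K2)%R by rewrite divr_ge0// mulr_ge0// ltW.
have Ma : (0 <= M / 2 / a)%R by rewrite !divr_ge0// ltW.
have Mb : (0 <= M / 2 / b)%R by rewrite !divr_ge0// ltW.
(* Both normalized estimators have mean 1, so [M] is the mean of [M / 2 * (w + w')], which can be
   compared pointwise. The summand 0 is there to match [integral2_mean]. *)
have ME : M%:E = \int[Q]_s \int[Q]_s' (0 + M / 2 / a * L s + M / 2 / b * L' s')%R%:E.
  rewrite integral2_mean//; congr EFin; field.
  by rewrite !gt_eqF.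
have step : M%:E <= \int[Q]_s \int[Q]_s' (F (s, s') + K1 + K2 * D (s, s'))%R%:E.
  rewrite ME.
  apply: (@le_integral2 (fun x => 0 + M / 2 / a * L x.1 + M / 2 / b * L' x.2)%R
    (fun x => F x + K1 + K2 * D x)%R).
  - apply: measurable_funD; first apply: measurable_funD => //.
      by apply: measurable_funM => //; exact: (measurableT_comp mL measurable_fst).
    by apply: measurable_funM => //; exact: (measurableT_comp mL' measurable_snd).
  - apply: measurable_funD; first exact: measurable_funD.
    exact: measurable_funM.
  - move=> [s s']; apply/andP; split; first by rewrite !addr_ge0// mulr_ge0.
    rewrite /F /K1 /K2 /D /X /X' /w /w'/= add0r.
    set x := (L s / a)%R; set y := (L' s' / b)%R.
    have x0 : (0 <= x)%R by rewrite divr_ge0// ltW.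
    have y0 : (0 <= y)%R by rewrite divr_ge0// ltW.
    have -> : (M / 2 / a * L s = M / 2 * x)%R by rewrite /x; field; rewrite gt_eqF.
    have -> : (M / 2 / b * L' s' = M / 2 * y)%R by rewrite /y; field; rewrite gt_eqF.
    have -> : (c * L s = (c * a) * x)%R by rewrite /x; field; rewrite gt_eqF.
    have -> : (c' * L' s' = (c' * b) * y)%R by rewrite /y; field; rewrite gt_eqF.
    have MA : (M <= c * a)%R by rewrite ge_min lexx.
    have MB : (M <= c' * b)%R by rewrite ge_min lexx orbT.
    exact: scaled_min_le.
have intE : \int[Q]_s \int[Q]_s' (F (s, s') + K1 + K2 * D (s, s'))%R%:E =
    \int[Q]_s \int[Q]_s' (F (s, s'))%:E + K1%:E +
    K2%:E * \int[Q]_s \int[Q]_s' (D (s, s'))%:E.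
  rewrite -(integral2_addr K10).
  rewrite (@integral2D (fun x => F x + K1)%R (fun x => K2 * D x)%R)//.
  - by congr (_ + _); exact: integral2Z.
  - exact: measurable_funD.
  - exact: measurable_funM.
  - by move=> x; rewrite addr_ge0.
  - by move=> x; rewrite mulr_ge0.
apply: (le_trans step); rewrite intE -addeA; apply: leeD; first exact: lexx.
apply: (@le_trans _ _ (K1 + K2 * (nu / a + nu' / b))%R%:E).
  rewrite EFinD [X in _ <= _ + X]EFinM; apply: leeD; first exact: lexx.
  by apply: lee_wpmul2l => //; rewrite lee_fin.
have nu0 : (0 <= nu)%R.
  by rewrite -(pmulr_rge0 _ a_gt0) -lee_fin; exact: le_trans (V0 _) Vnu.
have nu'0 : (0 <= nu')%R.
  by rewrite -(pmulr_rge0 _ b_gt0) -lee_fin; exact: le_trans (V0 _) Vnu'.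
(* The minimum is at most the half-sum in the first term; in the second, [M / a <= c] and
   [M / b <= c'] remove the means. *)
rewrite lee_fin; apply: lerD.
  have MA : (M <= c * a)%R by rewrite ge_min lexx.
  have MB : (M <= c' * b)%R by rewrite ge_min lexx orbT.
  by rewrite /K1; nra.
rewrite /K2 mulrAC mulrC ler_pM2l; last by rewrite invr_gt0 mulr_gt0.
rewrite mulrDr; apply: lerD.
  rewrite mulrCA mulrC ler_wpM2r// ler_pdivrMr//; by rewrite ge_min lexx.
rewrite mulrCA mulrC ler_wpM2r// ler_pdivrMr//; by rewrite ge_min lexx orbT.
Qed.

End pseudo_marginal_coupling.

(** * Sample means and independent copies *)

Section sample_mean.
Local Open Scope ereal_scope.
Context d (T : measurableType d) (R : realType).
Variable P : {sigma_finite_measure set T -> \bar R}.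
Hypothesis P1 : P setT = 1.
Variables (h : T -> R) (a : R) (m : nat).
Hypotheses (mh : measurable_fun setT h) (h0 : forall s, (0 <= h s)%R).
Hypotheses (ha : \int[P]_s (h s)%:E = a%:E) (m_gt0 : (0 < m)%N).

Let mean (s : m.-tuple T) : R := (m%:R^-1 * \sum_(i < m) h (tnth s i))%R.

Let mneq0 : m%:R != 0%R :> R. Proof. by rewrite pnatr_eq0 -lt0n. Qed.

Let sum_cst (x : \bar R) : \sum_(i < m) x = m%:R%:E * x.
Proof. by rewrite mule_natl big_const_ord -Monoid.iteropE. Qed.

Let mhi (f : T -> R) (i : 'I_m) : measurable_fun setT f ->
  measurable_fun setT (fun s : m.-tuple T => f (tnth s i)).
Proof. by move=> mf; exact: (measurableT_comp mf (measurable_tnth i)). Qed.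

Lemma measurable_sample_mean : measurable_fun setT mean.
Proof.
by apply: measurable_funM => //; apply: measurable_sum => i; exact: mhi.
Qed.

Let integral_sum_tnth (f : T -> R) : measurable_fun setT f ->
  (forall s, 0 <= f s)%R ->
  \int[power_measure P m]_s (m%:R^-1 * \sum_(i < m) f (tnth s i))%R%:E =
  \int[P]_s (f s)%:E.
Proof.
move=> mf f0.
under eq_integral do rewrite EFinM -sumEFin.
rewrite ge0_integralZl//; last 2 first.
- by apply: emeasurable_sum => i; apply/measurable_EFinP; exact: mhi.
- by move=> s _; apply: sume_ge0 => i _; rewrite lee_fin.
rewrite ge0_integral_sum//; last 2 first.
- by move=> i; apply/measurable_EFinP; exact: mhi.
- by move=> i s _; rewrite lee_fin.
under eq_bigr => i _.
  rewrite (@integral_power_measure_tnth _ _ _ P m i (fun s => (f s)%:E) P1)//.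
    over.
  exact/measurable_EFinP.
by rewrite sum_cst muleA -EFinM mulVf// mul1e.
Qed.

Lemma integral_sample_mean : \int[power_measure P m]_s (mean s)%:E = a%:E.
Proof. by rewrite /mean integral_sum_tnth. Qed.

(** Only the triangle inequality is used, term by term; no second moment is assumed, and no factor
    decreasing in [m] is gained. *)
Lemma integral_sample_mean_norm_le :
  \int[power_measure P m]_s (`|mean s - a|%R)%:E <=
  \int[P]_s (`|h s - a|%R)%:E.
Proof.
have mn : measurable_fun setT (fun s => `|h s - a|%R).
  by apply: measurableT_comp => //; exact: measurable_funB.
rewrite -integral_sum_tnth//; apply: ge0_le_integral => //.
- apply/measurable_EFinP; apply: measurableT_comp => //.
  by apply: measurable_funB => //; exact: measurable_sample_mean.
- apply/measurable_EFinP; apply: measurable_funM => //.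
  by apply: measurable_sum => i; exact: (mhi i mn).
move=> s _; rewrite lee_fin.
have -> : (mean s - a = m%:R^-1 * \sum_(i < m) (h (tnth s i) - a))%R.
  by rewrite sumrB mulrBr sumr_const card_ord -[(a *+ m)%R]mulr_natl mulKf.
rewrite normrM ger0_norm ?invr_ge0// ler_wpM2l ?invr_ge0//.
exact: ler_norm_sum.
Qed.

Let ih : P.-integrable setT (EFin \o h).
Proof.
apply/integrableP; split; first exact/measurable_EFinP.
by under eq_integral do rewrite /= ger0_norm//; rewrite ha ltry.
Qed.

Let ic (c : R) : P.-integrable setT (fun=> c%:E).
Proof.
apply/integrableP; split => //.
by rewrite (integral_cst_mass1 _ P1) ltry.
Qed.

Let centered : \int[P]_s (h s - a)%:E = 0.
Proof.
under eq_integral do rewrite EFinB.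
by rewrite integralB// (integral_cst_mass1 _ P1) ha -EFinB subrr.
Qed.

Let mc : measurable_fun setT (fun s => h s - a)%R.
Proof. exact: measurable_funB. Qed.

(** The mean is replaced by an independent copy of [h]: [h s - a] is the integral of [h s - h s']
    over [s'], and the absolute value moves inside. *)
Lemma integral_norm_sub_mean_le :
  \int[P]_s (`|h s - a|%R)%:E <= \int[P]_s \int[P]_s' (`|h s - h s'|%R)%:E.
Proof.
have mp : measurable_fun setT (fun x : T * T => (`|h x.1 - h x.2|%R)%:E).
  apply/measurable_EFinP; apply: measurableT_comp => //.
  by apply: measurable_funB; exact: (measurableT_comp mh).
apply: ge0_le_integral => //.
- by apply/measurable_EFinP; apply: measurableT_comp.
- by apply: (measurable_fun_fubini_tonelli_F _ mp) => x; rewrite lee_fin.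
move=> s _.
have -> : (`|h s - a|%R)%:E = `| \int[P]_s' (h s - h s')%:E |.
  under eq_integral do rewrite EFinB.
  by rewrite integralB// (integral_cst_mass1 _ P1) ha.
apply: le_abse_integral => //.
by apply/measurable_EFinP; apply: measurable_funB.
Qed.

Hypothesis var_h : \int[P]_s ((h s - a) ^+ 2)%:E < +oo.

Lemma integral_sample_mean_sqr :
  \int[power_measure P m]_s ((mean s - a) ^+ 2)%:E =
  (m%:R^-1)%:E * \int[P]_s ((h s - a) ^+ 2)%:E.
Proof.
pose X (i : 'I_m) s := (m%:R^-1 * (h s - a))%R.
have X2 i : \int[P]_s (X i s ^+ 2)%:E =
    (m%:R ^- 2)%:E * \int[P]_s ((h s - a) ^+ 2)%:E.
  rewrite -ge0_integralZl//.
  - by apply: eq_integral => s _; rewrite -EFinM /X exprMn exprVn.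
  - by apply/measurable_EFinP; exact: measurable_funX.
  - by move=> s _; rewrite lee_fin sqr_ge0.
have := @integral_power_measure_sqr_sum _ _ _ P m X 0 P1.
rewrite expr0n/= adde0 => H.
transitivity (\int[power_measure P m]_t ((\sum_(i < m) X i (tnth t i) + 0) ^+ 2)%R%:E).
  apply: eq_integral => s _; congr (_ ^+ 2)%R%:E.
  rewrite addr0 -mulr_sumr sumrB mulrBr sumr_const card_ord.
  by rewrite -[(a *+ m)%R]mulr_natl mulKf.
rewrite H.
- under eq_bigr do rewrite X2.
  rewrite sum_cst muleA -EFinM.
  by congr (_%:E * _); field.
- by move=> i; exact: measurable_funM.
- by move=> i; rewrite X2 lte_mul_pinfty// ?lee_fin ?invr_ge0 ?sqr_ge0.
- move=> i; under eq_integral do rewrite EFinM.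
  rewrite integralZl// ?centered ?mule0//.
  under eq_fun do rewrite EFinB.
  exact: integrableB.
Qed.

(** The exact factor 2 is kept: it turns [(pi / 2) ^ 2] into [pi ^ 2 / 8] in the variance bound on a
    fiber. *)
Lemma integral_sqr_sub_pair :
  \int[P]_s \int[P]_s' ((h s - h s') ^+ 2)%:E =
  2%:E * \int[P]_s ((h s - a) ^+ 2)%:E.
Proof.
have -> : \int[P]_s \int[P]_s' ((h s - h s') ^+ 2)%:E =
    \int[P]_s (((h s - a) ^+ 2)%:E + \int[P]_s' ((h s' - a) ^+ 2)%:E).
  apply: eq_integral => s _; rewrite addeC -sqrrN.
  rewrite -(integral_sqr_shift (- (h s - a))%R P1 mc var_h centered).
  by apply: eq_integral => s' _; congr EFin; ring.
rewrite ge0_integralD//; last 3 first.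
- by move=> s _; rewrite lee_fin sqr_ge0.
- by apply/measurable_EFinP; exact: measurable_funX.
- by move=> _ _; apply: integral_ge0 => s _; rewrite lee_fin sqr_ge0.
rewrite (integral_cst_mass1 _ P1) (_ : 2%:E = 1 + 1)//.
by rewrite ge0_muleDl// !mul1e.
Qed.

End sample_mean.

(** * Deviation of a positive function from its Gaussian mean *)

Section gaussian_fiber.
Local Open Scope ereal_scope.
Context (R : realType) (n : nat).
Local Notation G := (gauss_prob R n).
Variables (f : 'cV[R]_n -> R) (a N : R).
Hypotheses (f_gt0 : forall x, (0 < f x)%R) (df : continuously_differentiable f).
Hypothesis fa : \int[G]_x (f x)%:E = a%:E.

(** This is [f] times the squared norm of the gradient of [ln f], with the logarithm eliminated. *)
Definition fisher_integrand (x : 'cV[R]_n) : R :=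
  ((\sum_i gradient f x i 0 ^+ 2) / f x)%R.

Hypothesis fN : \int[G]_x (fisher_integrand x)%:E = N%:E.

Let mf : measurable_fun setT f.
Proof.
apply: continuous_measurable_cV => x.
exact: (differentiable_continuous (proj1 df x)).
Qed.

Let mgrad : measurable_fun setT (gradient f).
Proof. exact: continuous_measurable_cV_mx (proj2 df). Qed.

Let mV : measurable_fun setT (fun x => (f x)^-1)%R.
Proof.
apply: continuous_measurable_cV => x; have cf := differentiable_continuous (proj1 df x).
exact: (cvgV (lt0r_neq0 (f_gt0 x)) cf).
Qed.

Let mfisher : measurable_fun setT fisher_integrand.
Proof.
apply: measurable_funM => //; apply: measurable_sum => i.
by apply: measurable_funX; exact: measurable_entry.
Qed.

Let fisher_ge0 x : (0 <= fisher_integrand x)%R.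
Proof.
by apply: divr_ge0; [apply: sumr_ge0 => i _; exact: sqr_ge0|exact: ltW].
Qed.

Let dot (x y : 'cV[R]_n) : R := (((gradient f x)^T *m y) 0 0)%R.

Let mdot : measurable_fun setT (fun p : 'cV[R]_n * 'cV[R]_n => dot p.1 p.2).
Proof.
rewrite /dot; under eq_fun do rewrite mxE.
apply: measurable_sum => i; apply: measurable_funM.
  under eq_fun do rewrite mxE.
  by apply: measurable_entry; exact: (measurableT_comp mgrad measurable_fst).
by apply: measurable_entry; exact: measurable_snd.
Qed.

Let mdot2 x : measurable_fun setT (fun y => dot x y).
Proof. exact: (measurableT_comp mdot (measurable_pair1 x)). Qed.

Let integral_dot_sqr x : \int[G]_y (dot x y ^+ 2)%:E <=
  (f x * fisher_integrand x)%:E.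
Proof.
apply: (le_trans (integral_gauss_dot_sqr (gradient f x))).
by rewrite lee_fin /fisher_integrand mulrC divfK// gt_eqF.
Qed.

Let G1 : G setT = 1. Proof. exact: probability_setT. Qed.

(** AM-GM with weight [t * f x] trades the absolute directional derivative for [f] and its square
    divided by [f]. Integrating out the direction leaves the Fisher integrand, so finite [a] and [N]
    suffice, even if [f] has infinite variance. *)
Lemma fiber_norm_le (t : R) : (0 < t)%R ->
  \int[G]_x (`|f x - a|%R)%:E <= (pi / 4 * (t * a + N / t))%:E.
Proof.
move=> t0.
apply: (le_trans (integral_norm_sub_mean_le G1 mf (fun x => ltW (f_gt0 x)) fa)).
apply: (le_trans (integral_gauss_increment_norm_le df)).
have -> : (pi / 4 * (t * a + N / t) = pi / 2 * (t / 2 * a + (2 * t)^-1 * N))%R.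
  by field; rewrite gt_eqF.
rewrite [X in _ <= X]EFinM; apply: lee_wpmul2l.
  by rewrite lee_fin divr_ge0// pi_ge0.
have t20 : (0 <= t / 2)%R by rewrite divr_ge0// ltW.
have t2V0 : (0 <= (2 * t)^-1)%R by rewrite invr_ge0 mulr_ge0// ltW.
have -> : (t / 2 * a + (2 * t)^-1 * N)%:E =
    \int[G]_x ((t / 2 * f x)%:E + ((2 * t)^-1 * fisher_integrand x)%:E).
  rewrite ge0_integralD//.
  - under eq_integral do rewrite EFinM.
    rewrite ge0_integralZl// ?fa//; last 2 first.
    + exact/measurable_EFinP.
    + by move=> x _; rewrite lee_fin ltW.
    under eq_integral do rewrite EFinM.
    rewrite ge0_integralZl// ?fN//; last 2 first.
    + exact/measurable_EFinP.
    + by move=> x _; rewrite lee_fin.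
  - by move=> x _; rewrite lee_fin mulr_ge0// ltW.
  - by apply/measurable_EFinP; exact: measurable_funM.
  - by move=> x _; rewrite lee_fin mulr_ge0.
  - by apply/measurable_EFinP; exact: measurable_funM.
have mnd : measurable_fun setT
    (fun p : 'cV[R]_n * 'cV[R]_n => (`|dot p.1 p.2|%R)%:E).
  by apply/measurable_EFinP; exact: measurableT_comp.
apply: ge0_le_integral => //.
- by move=> x _; apply: integral_ge0 => y _; rewrite lee_fin.
- by apply: (measurable_fun_fubini_tonelli_F _ mnd) => x; rewrite lee_fin.
- by apply: emeasurable_funD; apply/measurable_EFinP; exact: measurable_funM.
move=> x _; have fx0 := f_gt0 x.
(* The division by [f x] turns the squared gradient into the Fisher integrand. *)
pose k := ((2 * t)^-1 / f x)%R.
have k0 : (0 <= k)%R by rewrite divr_ge0// ltW.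
apply: (@le_trans _ _ (\int[G]_y ((t / 2 * f x)%:E + k%:E * (dot x y ^+ 2)%:E))).
  apply: ge0_le_integral => //.
  - by apply/measurable_EFinP; apply: measurableT_comp => //; exact: mdot2.
  - apply: emeasurable_funD => //; apply: emeasurable_funM => //.
    by apply/measurable_EFinP; apply: measurable_funX; exact: mdot2.
  - move=> y _; rewrite -EFinM -EFinD lee_fin.
    rewrite -subr_ge0 (_ : _ - _ = k * (`|dot x y| - t * f x) ^+ 2)%R.
      by rewrite mulr_ge0 ?sqr_ge0.
    rewrite -(real_normK (num_real (dot x y))) /k; field.
    by rewrite !gt_eqF.
rewrite ge0_integralD//; last 3 first.
- by move=> y _; rewrite lee_fin mulr_ge0// ltW.
- by move=> y _; rewrite mule_ge0 ?lee_fin ?sqr_ge0.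
- apply: emeasurable_funM => //.
  by apply/measurable_EFinP; apply: measurable_funX; exact: mdot2.
apply: leeD; first by rewrite (integral_cst_mass1 _ G1).
rewrite ge0_integralZl//; last 2 first.
- by apply/measurable_EFinP; apply: measurable_funX; exact: mdot2.
- by move=> y _; rewrite lee_fin sqr_ge0.
apply: (le_trans (lee_wpmul2l _ (integral_dot_sqr x))); first by rewrite lee_fin.
by rewrite -EFinM lee_fin /k -mulrA mulKf// gt_eqF.
Qed.

(** The squared gradient is [f] times the Fisher integrand, and the bound on [f] makes it at most
    [C * a] times that integrand. The factor [a] is put in front, as [min_le_integral_min_sqr]
    expects. *)
Lemma fiber_sqr_le (C : R) : (forall x, f x <= C * a)%R ->
  \int[G]_x ((f x - a) ^+ 2)%:E <= (a * (pi ^+ 2 / 8 * C * N))%:E.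
Proof.
move=> fC.
(* Finiteness comes from the boundedness of [f] and must precede the identity for independent
   copies. *)
have var : \int[G]_x ((f x - a) ^+ 2)%:E < +oo.
  apply: (@le_lt_trans _ _ (\int[G]_x ((C * a + `|a|) ^+ 2)%:E)).
    apply: ge0_le_integral => //.
    - by move=> x _; rewrite lee_fin sqr_ge0.
    - by apply/measurable_EFinP; apply: measurable_funX; exact: measurable_funB.
    move=> x _; rewrite lee_fin -(real_normK (num_real (f x - a))).
    rewrite lerXn2r ?nnegrE//.
      by rewrite addr_ge0// (le_trans _ (fC x))// ltW.
    by rewrite (le_trans (ler_normB _ _))// lerD2r gtr0_norm.
  by rewrite (integral_cst_mass1 _ G1) ltry.
have E := integral_sqr_sub_pair G1 mf (fun x => ltW (f_gt0 x)) fa var.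
have H := integral_gauss_increment_sqr_le df.
rewrite E in H.
have K : \int[G]_x \int[G]_y (dot x y ^+ 2)%:E <= (C * a * N)%:E.
  have Ca0 : (0 <= C * a)%R by rewrite (le_trans _ (fC 0%R))// ltW.
  have -> : (C * a * N)%:E = \int[G]_x ((C * a)%:E * (fisher_integrand x)%:E).
    rewrite ge0_integralZl// ?fN//; first exact/measurable_EFinP.
    by move=> x _; rewrite lee_fin.
  have m2 : measurable_fun setT
      (fun p : 'cV[R]_n * 'cV[R]_n => (dot p.1 p.2 ^+ 2)%:E).
    by apply/measurable_EFinP; exact: measurable_funX.
  apply: ge0_le_integral => //.
  - by move=> x _; apply: integral_ge0 => y _; rewrite lee_fin sqr_ge0.
  - by apply: (measurable_fun_fubini_tonelli_F _ m2) => x; rewrite lee_fin sqr_ge0.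
  - by apply: emeasurable_funM => //; exact/measurable_EFinP.
  move=> x _; apply: (le_trans (integral_dot_sqr x)).
  by rewrite -EFinM lee_fin ler_wpM2r.
have {}H := le_trans H (lee_wpmul2l _ K).
move: H; rewrite -EFinM -lee_pdivlMl// -EFinM => H.
have -> : (a * (pi ^+ 2 / 8 * C * N) = 2^-1 * ((pi / 2) ^+ 2 * (C * a * N)))%R.
  by field.
by apply: H; rewrite lee_fin sqr_ge0.
Qed.

End gaussian_fiber.

Section acceptance_algebra.
Context (R : realFieldType).

(** At [x = 0] both sides are 0, so acceptance ratios need no special treatment where the proposal
    density vanishes. *)
Lemma min1_div_mul (x y : R) : 0 <= x -> 0 <= y ->
  Num.min 1 (y / x) * x = Num.min x y.
Proof.
move=> x0 y0; have [->|xneq0] := eqVneq x 0.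
  by rewrite mulr0; apply/esym/min_idPl.
by rewrite minr_pMl// mul1r divfK.
Qed.

End acceptance_algebra.

(** * States with auxiliary samples: reordering the integrals *)

Section marked_product.
Local Open Scope ereal_scope.
Context d1 d2 (T1 : measurableType d1) (T2 : measurableType d2) (R : realType).
Variables (mu : {sigma_finite_measure set T1 -> \bar R})
  (nu : {sigma_finite_measure set T2 -> \bar R})
  (Q : {sigma_finite_measure set T2 -> \bar R}) (psi : T2 -> R).
Hypotheses (mpsi : measurable_fun setT psi) (psi0 : forall s, (0 <= psi s)%R).
Hypothesis Qpsi : forall h : T2 -> \bar R, measurable_fun setT h ->
  (forall s, 0 <= h s) -> \int[Q]_s h s = \int[nu]_s (h s * (psi s)%:E).
Variable F : (T1 * T2) * (T1 * T2) -> R.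
Hypotheses (mF : measurable_fun setT F) (F0 : forall x, (0 <= F x)%R).

Let mEF : measurable_fun setT (EFin \o F). Proof. exact/measurable_EFinP. Qed.

Let mE2 d d' (S : measurableType d) (S' : measurableType d')
    (m' : {sigma_finite_measure set S' -> \bar R}) (h : S * S' -> \bar R) :
  measurable_fun setT h -> (forall x, 0 <= h x) ->
  measurable_fun setT (fun s => \int[m']_s' h (s, s')).
Proof. by move=> mh h0; exact: (measurable_fun_fubini_tonelli_F h mh h0). Qed.

Lemma measurable_marked : measurable_fun setT (fun q : T1 * T1 =>
  \int[Q]_s \int[Q]_s' (F ((q.1, s), (q.2, s')))%:E).
Proof.
pose H (x : (T1 * T1 * T2) * T2) : \bar R :=
  (F ((x.1.1.1, x.1.2), (x.1.1.2, x.2)))%:E.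
have mH : measurable_fun setT H.
  apply: (measurableT_comp mEF); apply: measurable_fun_pair;
    apply: measurable_fun_pair.
  - exact: (measurableT_comp measurable_fst
      (measurableT_comp measurable_fst measurable_fst)).
  - exact: (measurableT_comp measurable_snd measurable_fst).
  - exact: (measurableT_comp measurable_snd
      (measurableT_comp measurable_fst measurable_fst)).
  - exact: measurable_snd.
have H0 x : 0 <= H x by rewrite lee_fin.
have mH2 : measurable_fun setT (fun x => \int[Q]_s' H (x, s')) by exact: mE2.
by apply: (mE2 Q mH2) => x; exact: integral_ge0.
Qed.

(** Both samples are moved innermost and their weights [psi] absorbed into [Q], so that estimates
    for a fixed pair [(z, z')] become applicable. *)
Lemma integral_marked_product :
  \int[product_sigma_finite mu nu]_x \int[product_sigma_finite mu nu]_y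
    (F (x, y) * psi x.2 * psi y.2)%:E =
  \int[mu]_z \int[mu]_z' \int[Q]_s \int[Q]_s' (F ((z, s), (z', s')))%:E.
Proof.
pose W (x : T1 * T2) := \int[mu]_z' \int[Q]_s' (F (x, (z', s')))%:E.
have mFx x : measurable_fun setT (fun y => (F (x, y))%:E).
  exact: (measurableT_comp mEF (measurable_pair1 x)).
have mFxz x z' : measurable_fun setT (fun s' => (F (x, (z', s')))%:E).
  exact: (measurableT_comp (mFx x) (measurable_pair1 z')).
have mIx x : measurable_fun setT (fun z' => \int[Q]_s' (F (x, (z', s')))%:E).
  by apply: (mE2 Q (mFx x)) => y; rewrite lee_fin.
have mV : measurable_fun setT (fun q : (T1 * T2) * T1 =>
    \int[Q]_s' (F (q.1, (q.2, s')))%:E).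
  pose H (x : ((T1 * T2) * T1) * T2) : \bar R := (F (x.1.1, (x.1.2, x.2)))%:E.
  apply: (mE2 Q (h := H)); last by move=> x; rewrite lee_fin.
  apply: (measurableT_comp mEF); apply: measurable_fun_pair.
    exact: (measurableT_comp measurable_fst measurable_fst).
  apply: measurable_fun_pair; last exact: measurable_snd.
  exact: (measurableT_comp measurable_snd measurable_fst).
have V0 x z' : 0 <= \int[Q]_s' (F (x, (z', s')))%:E.
  by apply: integral_ge0 => s' _; rewrite lee_fin.
have mW : measurable_fun setT W.
  by apply: (mE2 mu mV) => -[x z']; exact: V0.
have W0 x : 0 <= W x by apply: integral_ge0 => z' _; exact: V0.
have mpsi1 : measurable_fun setT (fun x : T1 * T2 => (psi x.2)%:E).
  by apply/measurable_EFinP; exact: (measurableT_comp mpsi measurable_snd).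
transitivity (\int[product_sigma_finite mu nu]_x (W x * (psi x.2)%:E)).
  apply: eq_integral => x _; rewrite muleC.
  have psix0 : 0 <= (psi x.2)%:E by rewrite lee_fin.
  have mFp : measurable_fun setT (fun y : T1 * T2 => (F (x, y))%:E * (psi y.2)%:E).
    exact: emeasurable_funM.
  have Fp0 (y : T1 * T2) : 0 <= (F (x, y))%:E * (psi y.2)%:E.
    by rewrite mule_ge0// lee_fin.
  transitivity (\int[product_sigma_finite mu nu]_y
      ((psi x.2)%:E * ((F (x, y))%:E * (psi y.2)%:E))).
    by apply: eq_integral => y _; rewrite -!EFinM; congr EFin; ring.
  rewrite ge0_integralZl//; congr (_ * _).
  rewrite (integral_product_sigma_finite mu nu mFp Fp0).
  apply: eq_integral => z' _; rewrite Qpsi//.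
  by move=> s'; rewrite lee_fin.
rewrite (integral_product_sigma_finite mu nu (f := fun x => W x * (psi x.2)%:E)).
- apply: eq_integral => z _.
  rewrite -[LHS]/(\int[nu]_s (W (z, s) * (psi s)%:E)) -Qpsi//; last first.
    exact: (measurableT_comp mW (measurable_pair1 z)).
  (* The only exchange needed is that of the first sample with the second state. *)
  pose K (x : T2 * T1) := \int[Q]_s' (F ((z, x.1), (x.2, s')))%:E.
  pose iota (x : T2 * T1) : (T1 * T2) * T1 := ((z, x.1), x.2).
  have miota : measurable_fun setT iota.
    apply: measurable_fun_pair; last exact: measurable_snd.
    exact: (measurableT_comp (measurable_pair1 z) measurable_fst).
  have mK : measurable_fun setT K by exact: (measurableT_comp mV miota).
  exact: (fubini_tonelli (m1 := Q) (m2 := mu) K mK (fun x => V0 _ _)).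
- exact: emeasurable_funM.
- by move=> x; rewrite mule_ge0// lee_fin.
Qed.

End marked_product.

(** * Integration of a pairwise estimate *)

Section gap.
Local Open Scope ereal_scope.
Context d (T : measurableType d) (R : realType).
Variable mu : {sigma_finite_measure set T -> \bar R}.
Variables (S x y : T * T -> R) (I : T * T -> \bar R) (good : T -> Prop).
Hypotheses (mS : measurable_fun setT S) (mx : measurable_fun setT x).
Hypotheses (my : measurable_fun setT y) (mI : measurable_fun setT I).
Hypotheses (S0 : forall q, (0 <= S q)%R) (x0 : forall q, (0 <= x q)%R).
Hypotheses (y0 : forall q, (0 <= y q)%R) (I0 : forall q, 0 <= I q).
Hypothesis ae_good : {ae mu, forall z, good z}.
Hypothesis S_le : forall z z', (S (z, z') <= x (z, z'))%R.
Hypothesis I_le : forall z z', good z -> good z' -> I (z, z') <= (S (z, z'))%:E.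

Let J (h : T * T -> \bar R) := \int[mu]_z \int[mu]_z' h (z, z').

(** The almost everywhere comparison is applied once to each variable, so no null set of the product
    space appears. *)
Let ae_le (h1 h2 : T * T -> \bar R) : measurable_fun setT h1 ->
  measurable_fun setT h2 -> (forall q, 0 <= h1 q) -> (forall q, 0 <= h2 q) ->
  (forall z z', good z -> good z' -> h1 (z, z') <= h2 (z, z')) ->
  J h1 <= J h2.
Proof.
move=> m1 m2 h10 h20 h12; apply: ae_ge0_le_integral => //.
- by move=> z _; exact: integral_ge0.
- exact: (measurable_fun_fubini_tonelli_F _ m1 h10).
- by move=> z _; exact: integral_ge0.
- exact: (measurable_fun_fubini_tonelli_F _ m2 h20).
move: ae_good; apply: filterS => z gz _; apply: ae_ge0_le_integral => //.
- exact: (measurableT_comp m1 (measurable_pair1 z)).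
- exact: (measurableT_comp m2 (measurable_pair1 z)).
by move: ae_good; apply: filterS => z' gz' _; exact: h12.
Qed.

Let JD (h1 h2 : T * T -> \bar R) : measurable_fun setT h1 ->
  measurable_fun setT h2 -> (forall q, 0 <= h1 q) -> (forall q, 0 <= h2 q) ->
  J (fun q => h1 q + h2 q) = J h1 + J h2.
Proof.
move=> m1 m2 h10 h20; rewrite /J -ge0_integralD//.
- apply: eq_integral => z _; rewrite ge0_integralD//.
    exact: (measurableT_comp m1 (measurable_pair1 z)).
  exact: (measurableT_comp m2 (measurable_pair1 z)).
- by move=> z _; exact: integral_ge0.
- exact: (measurable_fun_fubini_tonelli_F _ m1 h10).
- by move=> z _; exact: integral_ge0.
- exact: (measurable_fun_fubini_tonelli_F _ m2 h20).
Qed.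

Let JZ (k : R) (h : T * T -> R) : (0 <= k)%R -> measurable_fun setT h ->
  (forall q, 0 <= h q)%R ->
  J (fun q => (k * h q)%:E) = k%:E * J (EFin \o h).
Proof.
move=> k0 mh h0.
have mEh : measurable_fun setT (EFin \o h) by exact/measurable_EFinP.
rewrite /J -ge0_integralZl//.
- apply: eq_integral => z _; under eq_integral do rewrite EFinM.
  rewrite ge0_integralZl//.
    exact: (measurableT_comp mEh (measurable_pair1 z)).
  by move=> z' _; rewrite lee_fin.
- by apply: (measurable_fun_fubini_tonelli_F _ mEh) => q; rewrite lee_fin.
- by move=> z _; apply: integral_ge0 => z' _; rewrite lee_fin.
Qed.

Let mswap (h : T * T -> R) : measurable_fun setT h ->
  measurable_fun setT (fun q => h (q.2, q.1)).
Proof.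
move=> mh; apply: (measurableT_comp mh); apply: measurable_fun_pair.
  exact: measurable_snd.
exact: measurable_fst.
Qed.

Let Jswap (h : T * T -> R) : measurable_fun setT h -> (forall q, 0 <= h q)%R ->
  J (fun q => (h (q.2, q.1))%:E) = J (EFin \o h).
Proof.
move=> mh h0; have mEh : measurable_fun setT (EFin \o h) by exact/measurable_EFinP.
apply/esym; apply: (fubini_tonelli (m1 := mu) (m2 := mu) (EFin \o h) mEh).
by move=> q; rewrite lee_fin.
Qed.

(** The error is symmetric in the pair and the two orders contribute equally by Tonelli, hence the
    factors 2. *)
Lemma integral_gap_le (al be X Y : R) : (0 <= al)%R -> (0 <= be)%R ->
  J (EFin \o x) = X%:E -> J (EFin \o y) = Y%:E ->
  (forall z z', good z -> good z' -> (S (z, z'))%:E <= I (z, z') +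
     (al * (x (z, z') + x (z', z)) + be * (y (z, z') + y (z', z)))%:E) ->
  0 <= J (EFin \o S) - J I <= (2 * al * X + 2 * be * Y)%:E.
Proof.
move=> al0 be0 JX JY SI.
have mES : measurable_fun setT (EFin \o S) by exact/measurable_EFinP.
have mEx : measurable_fun setT (EFin \o x) by exact/measurable_EFinP.
have JIS : J I <= J (EFin \o S).
  by apply: ae_le => // *; rewrite lee_fin.
have JSX : J (EFin \o S) <= X%:E.
  by rewrite -JX; apply: ae_le => // *; rewrite lee_fin.
have JS0 : 0 <= J (EFin \o S).
  by apply: integral_ge0 => z _; apply: integral_ge0 => z' _; rewrite lee_fin.
have JI0 : 0 <= J I.
  by apply: integral_ge0 => z _; exact: integral_ge0.
(* Domination of [S] by [x] serves only here: with both terms finite, the difference of extended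
   reals can be moved across the inequality. *)
have fS : J (EFin \o S) \is a fin_num.
  by rewrite ge0_fin_numE// (le_lt_trans JSX)// ltry.
have fI : J I \is a fin_num.
  by rewrite ge0_fin_numE// (le_lt_trans JIS)// -ge0_fin_numE.
apply/andP; split; first by rewrite sube_ge0// fI.
rewrite leeBlDr//.
pose B q := (al * (x q + x (q.2, q.1)) + be * (y q + y (q.2, q.1)))%R.
have mB : measurable_fun setT B.
  apply: measurable_funD; apply: measurable_funM => //; apply: measurable_funD => //;
    exact: mswap.
have B0 q : (0 <= B q)%R by rewrite addr_ge0// mulr_ge0// addr_ge0.
have mEB : measurable_fun setT (EFin \o B) by exact/measurable_EFinP.
have JB : J (EFin \o B) = (2 * al * X + 2 * be * Y)%:E.
  have JE2 (k : R) (h : T * T -> R) (H : R) : (0 <= k)%R -> measurable_fun setT h ->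
      (forall q, 0 <= h q)%R -> J (EFin \o h) = H%:E ->
      J (fun q => (k * (h q + h (q.2, q.1)))%:E) = (2 * k * H)%:E.
    move=> k0 mh h0 hH.
    rewrite (JZ (h := fun q => h q + h (q.2, q.1))%R)//.
    - rewrite [X in _ * X](JD (h1 := EFin \o h)
        (h2 := fun q => (h (q.2, q.1))%:E)).
      + by rewrite Jswap// hH -EFinD -EFinM; congr EFin; ring.
      + exact/measurable_EFinP.
      + by apply/measurable_EFinP; exact: mswap.
      + by move=> q; rewrite lee_fin.
      + by move=> q; rewrite lee_fin.
    - by apply: measurable_funD => //; exact: mswap.
    - by move=> q; rewrite addr_ge0.
  rewrite [LHS](JD (h1 := fun q => (al * (x q + x (q.2, q.1)))%:E)
    (h2 := fun q => (be * (y q + y (q.2, q.1)))%:E)).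
  - by rewrite (JE2 _ _ X)// (JE2 _ _ Y).
  - apply/measurable_EFinP; apply: measurable_funM => //.
    by apply: measurable_funD => //; exact: mswap.
  - apply/measurable_EFinP; apply: measurable_funM => //.
    by apply: measurable_funD => //; exact: mswap.
  - by move=> q; rewrite lee_fin mulr_ge0// addr_ge0.
  - by move=> q; rewrite lee_fin mulr_ge0// addr_ge0.
have EB0 q : 0 <= (EFin \o B) q by rewrite lee_fin.
rewrite -JB addeC; have <- := JD mI mEB I0 EB0.
apply: ae_le.
- exact: mES.
- exact: emeasurable_funD.
- by move=> q; rewrite lee_fin.
- by move=> q; rewrite adde_ge0// lee_fin.
- exact: SI.
Qed.

End gap.

(** * Fiberwise decomposition of the evidence and of the trace residual *)

Section posterior_decomposition.
Context (R : realType).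

Lemma integral_power_gauss n m (f : m.-tuple 'cV[R]_n -> \bar R) :
  measurable_fun setT f -> (forall t, 0 <= f t)%E ->
  (\int[power_measure (gauss_prob R n) m]_t f t =
   \int[power_measure (lebesgue_cV R n) m]_t 
     (f t * (\prod_(i < m) gauss_pdf (tnth t i))%:E))%E.
Proof.
by rewrite /gauss_prob -lock => mf f0; exact: integral_power_measure_density.
Qed.

Context (d r : nat) (g : 'cV[R]_d -> R).
Variables (Ur : 'M[R]_(d, r)) (Up : 'M[R]_(d, d - r)).
Hypotheses (g_gt0 : forall z, 0 < g z) (dg : continuously_differentiable g).
Hypothesis evidence_fin : (0 < evidence g < +oo)%E.
Hypotheses (UU : Ur^T *m Ur = 1%:M) (VV : Up^T *m Up = 1%:M).
Hypothesis UV : Ur^T *m Up = 0.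

(** Orthonormal columns force this inequality, so the truncated subtraction [d - r] is the true
    complementary dimension. *)
Let rd : (r <= d)%N. Proof. exact: (mulmx1_min UU). Qed.

Let drn : d = (r + (d - r))%N. Proof. by rewrite subnKC. Qed.

Lemma measurable_likelihood : measurable_fun setT g.
Proof.
apply: continuous_measurable_cV => x.
exact: (differentiable_continuous (proj1 dg x)).
Qed.

Let mg := measurable_likelihood.

Let Z := fine (evidence g).

Lemma evidenceK : evidence g = Z%:E.
Proof.
by case/andP: evidence_fin => e0 eoo; rewrite fineK// ge0_fin_numE// ltW.
Qed.

Lemma fine_evidence_gt0 : 0 < Z.
Proof. by rewrite -lte_fin -evidenceK; case/andP: evidence_fin. Qed.

Let embed (p : 'cV[R]_r * 'cV[R]_(d - r)) := Ur *m p.1 + Up *m p.2.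

Let membed : measurable_fun setT embed.
Proof. by apply: measurable_addmx; exact: measurable_mulmx. Qed.

Lemma measurable_split_likelihood : measurable_fun setT
  (fun p : 'cV[R]_r * 'cV[R]_(d - r) => split_likelihood g Ur Up p.1 p.2).
Proof. exact: (measurableT_comp mg membed). Qed.

(* marginal_likelihood is the finite part of extended_marginal *)
Definition extended_marginal (zr : 'cV[R]_r) : \bar R :=
  (\int[gauss_prob R (d - r)]_zp (split_likelihood g Ur Up zr zp)%:E)%E.

Lemma extended_marginal_ge0 zr : (0 <= extended_marginal zr)%E.
Proof. by apply: integral_ge0 => s _; rewrite lee_fin ltW// g_gt0. Qed.

Lemma measurable_extended_marginal : measurable_fun setT extended_marginal.
Proof.
have mE : measurable_fun setT (fun p : 'cV[R]_r * 'cV[R]_(d - r) =>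
    (split_likelihood g Ur Up p.1 p.2)%:E).
  by apply/measurable_EFinP; exact: measurable_split_likelihood.
apply: (measurable_fun_fubini_tonelli_F _ mE) => p.
by rewrite lee_fin ltW// g_gt0.
Qed.

Let msplit zr : measurable_fun setT (split_likelihood g Ur Up zr).
Proof.
exact: (measurableT_comp measurable_split_likelihood (measurable_pair1 zr)).
Qed.

Lemma marginal_likelihoodE zr :
  marginal_likelihood g Ur Up zr = fine (extended_marginal zr).
Proof.
rewrite /marginal_likelihood /Rintegral /extended_marginal.
rewrite integral_gauss_prob//.
- exact/measurable_EFinP.
- by move=> s; rewrite lee_fin ltW// g_gt0.
Qed.

Lemma integral_gauss_extended_marginal :
  (\int[gauss_prob R r]_z extended_marginal z = Z%:E)%E.
Proof.
rewrite -evidenceK /evidence.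
have mEg : measurable_fun setT (fun x => (g x)%:E) by exact/measurable_EFinP.
have Eg0 x : (0 <= (g x)%:E)%E by rewrite lee_fin ltW.
rewrite [LHS](integral_gauss_orthogonal drn UU VV UV mEg Eg0).
by rewrite integral_gauss_prob.
Qed.

Definition extended_fisher (zr : 'cV[R]_r) : \bar R :=
  (\int[gauss_prob R (d - r)]_zp
    (fisher_integrand (split_likelihood g Ur Up zr) zp)%:E)%E.

(** One function on the whole space that restricts to the Fisher integrand of every fiber, so that
    the orthogonal change of variables applies to it. *)
Let fisher (x : 'cV[R]_d) : R :=
  (\sum_i (Up^T *m gradient g x) i 0 ^+ 2) / g x.

Let fisherE zr zp :
  fisher_integrand (split_likelihood g Ur Up zr) zp = fisher (embed (zr, zp)).
Proof. by rewrite /fisher_integrand /fisher gradient_affine. Qed.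

Let fisher_ge0 x : 0 <= fisher x.
Proof.
by apply: divr_ge0; [apply: sumr_ge0 => i _; exact: sqr_ge0|exact: ltW].
Qed.

Let mgrad : measurable_fun setT (gradient g).
Proof. exact: continuous_measurable_cV_mx (proj2 dg). Qed.

Let mfisher : measurable_fun setT fisher.
Proof.
apply: measurable_funM.
  apply: measurable_sum => i; apply: measurable_funX.
  by apply: measurable_entry; exact: measurable_mulmx.
apply: continuous_measurable_cV => x.
have cg := differentiable_continuous (proj1 dg x).
exact: (cvgV (lt0r_neq0 (g_gt0 x)) cg).
Qed.

Lemma extended_fisher_ge0 zr : (0 <= extended_fisher zr)%E.
Proof. by apply: integral_ge0 => s _; rewrite lee_fin fisherE fisher_ge0. Qed.

Lemma measurable_extended_fisher : measurable_fun setT extended_fisher.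
Proof.
have mE : measurable_fun setT (fun p : 'cV[R]_r * 'cV[R]_(d - r) =>
    (fisher_integrand (split_likelihood g Ur Up p.1) p.2)%:E).
  apply/measurable_EFinP; under eq_fun do rewrite fisherE.
  by apply: (measurableT_comp mfisher); exact: membed.
apply: (measurable_fun_fubini_tonelli_F _ mE) => p.
by rewrite lee_fin fisherE fisher_ge0.
Qed.

Hypothesis Hwd : Hmx_well_defined g.

Let gradient_ln x : gradient (fun w => ln (g w)) x = (g x)^-1 *: gradient g x.
Proof.
have dg_x := proj1 dg x.
have dln := is_derive1_ln (g_gt0 x).
have derln : derivable (@ln R) (g x) 1 by exact: (@ex_derive _ _ _ _ _ _ _ dln).
have dlnx : differentiable (@ln R) (g x) by apply/derivable1_diffP.
have dlng : differentiable (@ln R \o g) x by exact: differentiable_comp.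
apply/colP => i; rewrite !mxE -/(@ln R \o g) !deriveE// diff_comp//=.
rewrite deriv1E// derive1E (@derive_val _ _ _ _ _ _ _ dln).
by rewrite /GRing.scale/= mulrC.
Qed.

(** After multiplication by the Gaussian density, the integrand is a combination with constant
    coefficients of the entries defining [Hmx g]. These entries may change sign, so their
    integrability is what allows the sum and the integral to be exchanged. *)
Lemma integral_gauss_extended_fisher :
  (\int[gauss_prob R r]_z extended_fisher z =
   (Z * trace_residual Ur (Hmx g))%:E)%E.
Proof.
have mEf : measurable_fun setT (fun x => (fisher x)%:E) by exact/measurable_EFinP.
have Ef0 x : (0 <= (fisher x)%:E)%E by rewrite lee_fin.
transitivity (\int[gauss_prob R d]_x (fisher x)%:E)%E.
  rewrite -(integral_gauss_orthogonal drn UU VV UV mEf Ef0).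
  by apply: eq_integral => z _; apply: eq_integral => s _; rewrite fisherE.
rewrite integral_gauss_prob//.
pose K := 1%:M - Ur *m Ur^T.
have KE : K = Up *m Up^T.
  by rewrite /K -(orthogonal_completeness drn UU VV UV) addrC addKr.
(* Stated for every [M], since it serves both for the pointwise matrix [score_outer g x] and for its
   average [Hmx g]. *)
have trE (M : 'M[R]_d) : trace_residual Ur M = \sum_i \sum_j K i j * M j i.
  rewrite /trace_residual -mulmxA mxtrace_mulC -mulmxA -raddfB/=.
  rewrite -[X in \tr (X - _)]mulmx1 -mulmxBr mxtrace_mulC -/K.
  by apply: eq_bigr => i _; rewrite mxE.
have fisher_trE x : fisher x * gauss_pdf x =
    Z * \sum_i \sum_j K i j * Hmx_integrand g j i x.
  have -> : \sum_i \sum_j K i j * Hmx_integrand g j i x =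
      trace_residual Ur (score_outer g x) * posterior_pdf g x.
    rewrite trE mulr_suml; apply: eq_bigr => i _; rewrite mulr_suml.
    by apply: eq_bigr => j _; rewrite mulrA.
  have -> : trace_residual Ur (score_outer g x) =
      \sum_i (Up^T *m gradient (fun w => ln (g w)) x) i 0 ^+ 2.
    set w := gradient _ x.
    transitivity (\tr ((Up^T *m w) *m (Up^T *m w)^T)).
      rewrite trE trmx_mul trmxK -[in RHS]mulmxA mxtrace_mulC.
      rewrite -!mulmxA -KE /score_outer -/w mulmxA mxtrace_mulC.
      by apply: eq_bigr => i _; rewrite mxE.
    by apply: eq_bigr => i _; rewrite mxE big_ord1 [in X in _ * X]mxE.
  rewrite gradient_ln -scalemxAr.
  have -> : \sum_i ((g x)^-1 *: (Up^T *m gradient g x)) i 0 ^+ 2 =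
      fisher x / g x.
    rewrite /fisher !mulr_suml; apply: eq_bigr => i _; rewrite mxE.
    by rewrite exprMn exprVn mulrC -mulrA -invfM -expr2.
  rewrite /posterior_pdf -/Z; field.
  by rewrite !gt_eqF// fine_evidence_gt0.
have intH i j : (lebesgue_cV R d).-integrable setT
    (fun x => (K i j * Hmx_integrand g j i x)%:E).
  by under eq_fun do rewrite EFinM; exact: (integrableZl _ _ (Hwd j i)).
under eq_integral do rewrite -EFinM fisher_trE EFinM -sumEFin.
rewrite integralZl//; last first.
  apply: integrable_sum => // i _.
  under eq_fun do rewrite -sumEFin.
  exact: integrable_sum.
rewrite EFinM; congr (_ * _)%E; rewrite integral_sum//; last first.
  move=> i; under eq_fun do rewrite -sumEFin.
  exact: integrable_sum.
rewrite trE -sumEFin; apply: eq_bigr => i _.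
under eq_integral do rewrite -sumEFin.
rewrite integral_sum// -sumEFin; apply: eq_bigr => j _.
under eq_integral do rewrite EFinM.
rewrite integralZl//; last exact: Hwd.
have -> : Hmx g j i =
    fine (\int[lebesgue_cV R d]_x (Hmx_integrand g j i x)%:E)%E by rewrite mxE.
rewrite [RHS]EFinM fineK//.
exact: (integrable_fin_num _ (Hwd j i)).
Qed.

(** A finite Gaussian integral makes the product with the density finite almost everywhere; as the
    density is strictly positive, the function itself is finite there. *)
Lemma ae_extended_fin : {ae lebesgue_cV R r, forall z,
  (extended_marginal z < +oo)%E /\ (extended_fisher z < +oo)%E}.
Proof.
have ae_fin (h : 'cV[R]_r -> \bar R) : measurable_fun setT h ->
    (forall z, 0 <= h z)%E -> (\int[gauss_prob R r]_z h z < +oo)%E ->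
    {ae lebesgue_cV R r, forall z, (h z < +oo)%E}.
  move=> mh h0; rewrite integral_gauss_prob// => hoo.
  have ih : (lebesgue_cV R r).-integrable setT (fun z => h z * (gauss_pdf z)%:E)%E.
    apply/integrableP; split.
      apply: emeasurable_funM => //; apply/measurable_EFinP.
      exact: measurable_gauss_pdf.
    under eq_integral.
      move=> z _; rewrite gee0_abs; last first.
        by rewrite mule_ge0// lee_fin gauss_pdf_ge0.
      over.
    exact: hoo.
  have := integrable_ae measurableT ih; apply: filterS => z /(_ I).
  rewrite ltey; case: (h z) => // ; rewrite gt0_mulye ?lte_fin ?gauss_pdf_gt0//.
have A := ae_fin _ measurable_extended_marginal extended_marginal_ge0.
have B := ae_fin _ measurable_extended_fisher extended_fisher_ge0.
apply: filterS2 (A _) (B _).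
- by move=> z; split.
- by rewrite integral_gauss_extended_marginal ltry.
- by rewrite integral_gauss_extended_fisher ltry.
Qed.

End posterior_decomposition.

Section positivity.
Context d (T : measurableType d) (R : realType).

(** A zero integral would make [f] vanish almost everywhere, and the whole space, of mass 1, would
    be null. *)
Lemma integral_pos_gt0 (P : {measure set T -> \bar R}) (f : T -> R) (a : R) :
  P setT = 1%E -> measurable_fun setT f -> (forall x, 0 < f x) ->
  (\int[P]_x (f x)%:E = a%:E)%E -> 0 < a.
Proof.
move=> P1 mf f0 fa.
have : 0 <= a.
  by rewrite -lee_fin -fa; apply: integral_ge0 => x _; rewrite lee_fin ltW.
rewrite le_eqVlt => /predU1P[a0|//].
have := @ae_eq_integral_abs _ _ _ P setT measurableT (EFin \o f).
have mEf : measurable_fun setT (EFin \o f) by exact/measurable_EFinP.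
have -> : (\int[P]_(x in setT) `|(EFin \o f) x| = 0)%E.
  transitivity a%:E; last by rewrite -a0.
  by rewrite -fa; apply: eq_integral => x _; rewrite gee0_abs// lee_fin ltW.
move=> /(_ mEf) [/(_ erefl) [N [mN N0 subN]] _].
suff NT : N = setT by move: P1; rewrite -NT N0 => /eqP; rewrite eqe eq_sym oner_eq0.
apply/seteqP; split => // x _; apply: subN => /= /(_ I) [fx0].
by have := f0 x; rewrite fx0 ltxx.
Qed.

End positivity.

(** For [K > 0] the minimizer is [t = Num.sqrt K]. For [K <= 0], which covers a zero residual, [t]
    tends to 0 instead. *)
Lemma le_sqrt_optimize (R : realType) (e : \bar R) (K : R) :
  (forall t : R, 0 < t -> (e <= (t / 2 + K / (2 * t))%:E)%E) ->
  (e <= (Num.sqrt K)%:E)%E.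
Proof.
move=> H; have [K0|K0] := leP K 0.
  rewrite ler0_sqrtr//; apply/lee_addgt0Pr => t t0; rewrite add0e.
  apply: (le_trans (H t t0)); rewrite lee_fin.
  have : K / (2 * t) <= 0 by rewrite pmulr_lle0// invr_gt0 mulr_gt0.
  by lra.
have s0 : 0 < Num.sqrt K by rewrite sqrtr_gt0.
apply: (le_trans (H _ s0)); rewrite lee_fin.
rewrite -[X in X / (2 * _)](sqr_sqrtr (ltW K0)).
by rewrite le_eqVlt; apply/orP; left; apply/eqP; field; rewrite gt_eqF.
Qed.

Lemma ge0_integralZl_real d (T : measurableType d) (R : realType)
    (mu : {measure set T -> \bar R}) (k : R) (h : T -> \bar R) :
  measurable_fun setT h -> (forall x, 0 <= h x)%E -> 0 <= k ->
  (\int[mu]_x (k%:E * h x) = k%:E * \int[mu]_x h x)%E.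
Proof. by move=> mh h0 k0; rewrite ge0_integralZl. Qed.

(** * The gap between the two acceptance probabilities *)

Section acceptance_gap.
Context (R : realType) (d r m : nat) (g : 'cV[R]_d -> R).
Variables (Ur : 'M[R]_(d, r)) (Up : 'M[R]_(d, d - r)).
Variable p : 'cV[R]_r -> 'cV[R]_r -> R.
Hypotheses (g_gt0 : forall z, 0 < g z) (dg : continuously_differentiable g).
Hypothesis evidence_fin : (0 < evidence g < +oo)%E.
Hypothesis Hwd : Hmx_well_defined g.
Hypotheses (UU : Ur^T *m Ur = 1%:M) (VV : Up^T *m Up = 1%:M).
Hypothesis UV : Ur^T *m Up = 0.
Hypotheses (m_gt0 : (1 <= m)%N) (pp : proposal_density p).

Local Notation n := (d - r)%N.
Local Notation G := (gauss_prob R n).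
Local Notation Q := (power_measure (gauss_prob R n) m).
Local Notation Z := (fine (evidence g)).
Local Notation Res := (trace_residual Ur (Hmx g)).
Local Notation split := (split_likelihood g Ur Up).
Local Notation gb := (marginal_likelihood g Ur Up).

Let N (z : 'cV[R]_r) : R := fine (extended_fisher g Ur Up z).

Let mean (z : 'cV[R]_r) (s : m.-tuple 'cV[R]_n) : R :=
  m%:R^-1 * \sum_(i < m) split z (tnth s i).

(** Multiplied by [gb z], this is the stationary flow of proposals from [z] to [z']; acceptance
    reduces it to the minimum of the two opposite flows. *)
Let c (z z' : 'cV[R]_r) : R := gauss_pdf z * p z' z / Z.

Let S (q : 'cV[R]_r * 'cV[R]_r) : R :=
  Num.min (c q.1 q.2 * gb q.1) (c q.2 q.1 * gb q.2).

Let F (x : ('cV[R]_r * m.-tuple 'cV[R]_n) * ('cV[R]_r * m.-tuple 'cV[R]_n)) : R :=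
  Num.min (c x.1.1 x.2.1 * mean x.1.1 x.1.2) (c x.2.1 x.1.1 * mean x.2.1 x.2.2).

Let I (q : 'cV[R]_r * 'cV[R]_r) : \bar R :=
  (\int[Q]_s \int[Q]_s' (F ((q.1, s), (q.2, s')))%:E)%E.

Let IE z z' : I (z, z') = (\int[Q]_s \int[Q]_s'
  (Num.min (c z z' * mean z s) (c z' z * mean z' s'))%:E)%E.
Proof. by []. Qed.

Let SE z z' : S (z, z') = Num.min (c z z' * gb z) (c z' z * gb z').
Proof. by []. Qed.

(** For these [z], [gb z] and [N z] are the true integrals on the fiber rather than the default 0 of
    [fine]. *)
Let good (z : 'cV[R]_r) : Prop :=
  (extended_marginal g Ur Up z < +oo)%E /\ (extended_fisher g Ur Up z < +oo)%E.

Let Z_gt0 : 0 < Z. Proof. exact: fine_evidence_gt0 evidence_fin. Qed.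

Let p0 z' z : 0 <= p z' z. Proof. by case: pp. Qed.

Let c_ge0 z z' : 0 <= c z z'.
Proof. by rewrite divr_ge0 ?mulr_ge0 ?gauss_pdf_ge0 ?p0// ltW. Qed.

Let gb_ge0 z : 0 <= gb z.
Proof. by rewrite marginal_likelihoodE// fine_ge0// extended_marginal_ge0. Qed.

Let N_ge0 z : 0 <= N z.
Proof. by rewrite fine_ge0// extended_fisher_ge0. Qed.

Let mgb : measurable_fun setT gb.
Proof.
have -> : gb = fine \o extended_marginal g Ur Up.
  by apply/funext => z; exact: marginal_likelihoodE.
by apply: measurableT_comp => //; exact: measurable_extended_marginal.
Qed.

Let mN : measurable_fun setT N.
Proof. by apply: measurableT_comp => //; exact: measurable_extended_fisher. Qed.

Let mswap : measurable_fun setT (fun q : 'cV[R]_r * 'cV[R]_r => (q.2, q.1)).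
Proof.
by apply: measurable_fun_pair; [exact: measurable_snd|exact: measurable_fst].
Qed.

Let mc : measurable_fun setT (fun q : 'cV[R]_r * 'cV[R]_r => c q.1 q.2).
Proof.
case: pp => mp _ _; apply: measurable_funM => //; apply: measurable_funM.
  exact: (measurableT_comp (@measurable_gauss_pdf R r) measurable_fst).
exact: (measurableT_comp mp mswap).
Qed.

Let mS : measurable_fun setT S.
Proof.
apply: measurable_minr; apply: measurable_funM.
- exact: mc.
- exact: (measurableT_comp mgb measurable_fst).
- exact: (measurableT_comp mc mswap).
- exact: (measurableT_comp mgb measurable_snd).
Qed.

Let mmean : measurable_fun setT
  (fun x : 'cV[R]_r * m.-tuple 'cV[R]_n => mean x.1 x.2).
Proof.
apply: measurable_funM => //; apply: measurable_sum => i.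
have mi : measurable_fun setT
    (fun x : 'cV[R]_r * m.-tuple 'cV[R]_n => (x.1, tnth x.2 i)).
  apply: measurable_fun_pair; first exact: measurable_fst.
  exact: (measurableT_comp (measurable_tnth i) measurable_snd).
exact: (measurableT_comp (measurable_split_likelihood Ur Up dg) mi).
Qed.

Let mean_ge0 z s : 0 <= mean z s.
Proof.
by rewrite mulr_ge0 ?invr_ge0//; apply: sumr_ge0 => i _; exact/ltW/g_gt0.
Qed.

Let mF : measurable_fun setT F.
Proof.
have m11 : measurable_fun setT
    (fun x : ('cV[R]_r * m.-tuple 'cV[R]_n) * ('cV[R]_r * m.-tuple 'cV[R]_n) =>
      (x.1.1, x.2.1)).
  apply: measurable_fun_pair.
    exact: (measurableT_comp measurable_fst measurable_fst).
  exact: (measurableT_comp measurable_fst measurable_snd).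
apply: measurable_minr; apply: measurable_funM.
- exact: (measurableT_comp mc m11).
- exact: (measurableT_comp mmean measurable_fst).
- exact: (measurableT_comp (measurableT_comp mc mswap) m11).
- exact: (measurableT_comp mmean measurable_snd).
Qed.

Let F_ge0 x : 0 <= F x.
Proof.
rewrite /F le_min; apply/andP; split; apply: mulr_ge0.
- exact: c_ge0.
- exact: mean_ge0.
- exact: c_ge0.
- exact: mean_ge0.
Qed.

Let mI : measurable_fun setT I.
Proof. exact: (measurable_marked Q mF F_ge0). Qed.

Let I_ge0 q : (0 <= I q)%E.
Proof.
by apply: integral_ge0 => s _; apply: integral_ge0 => s' _; rewrite lee_fin.
Qed.

Let E_alpha_starE : E_alpha_star g Ur Up p =
  (\int[lebesgue_cV R r]_z \int[lebesgue_cV R r]_z' (S (z, z'))%:E)%E.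
Proof.
apply: eq_integral => z _; apply: eq_integral => z' _; congr EFin.
rewrite /alpha_star /marginal_posterior_pdf -/Z /S /c/=.
set x := gb z * gauss_pdf z * p z' z.
set y := gb z' * gauss_pdf z' * p z z'.
have x0 : 0 <= x by rewrite !mulr_ge0// ?gauss_pdf_ge0.
have y0 : 0 <= y by rewrite !mulr_ge0// ?gauss_pdf_ge0.
transitivity (Num.min 1 (y / x) * x * Z^-1); first by rewrite /x; ring.
rewrite (min1_div_mul x0 y0) minr_pMl; last by rewrite invr_ge0 ltW.
by congr Num.min; rewrite /x /y; ring.
Qed.

(** The densities of the auxiliary samples do not enter the acceptance ratio; they only weight the
    two samples, one from the target and one from the proposal, and become [Q]. *)
Let E_alpha_1E : E_alpha_1 g Ur Up p m =
  (\int[lebesgue_cV R r]_z \int[lebesgue_cV R r]_z' I (z, z'))%E.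
Proof.
pose psi (s : m.-tuple 'cV[R]_n) : R := \prod_(i < m) gauss_pdf (tnth s i).
have mpsi : measurable_fun setT psi.
  apply: measurable_prod => i _.
  exact: (measurableT_comp (@measurable_gauss_pdf R n) (measurable_tnth i)).
have psi0 s : 0 <= psi s by apply: prodr_ge0 => i _; exact: gauss_pdf_ge0.
rewrite -(integral_marked_product (lebesgue_cV R r) mpsi psi0
  (@integral_power_gauss R n m) mF F_ge0).
apply: eq_integral => -[z s] _; apply: eq_integral => -[z' s'] _; congr EFin.
rewrite /alpha_1 /ext_proposal /ext_posterior_pdf -/Z /F /c /mean /=.
rewrite -[gauss_pdf_tuple s]/(psi s) -[gauss_pdf_tuple s']/(psi s').
rewrite -/(likelihood_sum g Ur Up (z, s)) -/(likelihood_sum g Ur Up (z', s')).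
set l := likelihood_sum _ _ _ (z, s); set l' := likelihood_sum _ _ _ (z', s').
have l0 : 0 <= l by apply: sumr_ge0 => i _; exact/ltW/g_gt0.
have l'0 : 0 <= l' by apply: sumr_ge0 => i _; exact/ltW/g_gt0.
set x := gauss_pdf z * l * p z' z; set y := gauss_pdf z' * l' * p z z'.
have x0 : 0 <= x by exact: (mulr_ge0 (mulr_ge0 (gauss_pdf_ge0 _) l0) (p0 _ _)).
have y0 : 0 <= y by exact: (mulr_ge0 (mulr_ge0 (gauss_pdf_ge0 _) l'0) (p0 _ _)).
have -> : gauss_pdf z' * l' / (gauss_pdf z * l) * (p z z' / p z' z) = y / x.
  by rewrite mulf_div.
transitivity (Num.min 1 (y / x) * x * (Z^-1 / m%:R) * psi s * psi s').
  by rewrite /x; ring.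
rewrite (min1_div_mul x0 y0) minr_pMl; last first.
  by apply: divr_ge0; [rewrite invr_ge0 ltW|exact: ler0n].
by congr (Num.min _ _ * _ * _); rewrite /x /y; ring.
Qed.

(** The proposal density integrates to 1 in [z'] and drops out. Finiteness almost everywhere then
    replaces [fine (h z)] by [h z]. *)
Let integral_c (h : 'cV[R]_r -> \bar R) (H : R) : measurable_fun setT h ->
  (forall z, 0 <= h z)%E -> {ae lebesgue_cV R r, forall z, (h z < +oo)%E} ->
  (\int[gauss_prob R r]_z h z = H%:E)%E ->
  (\int[lebesgue_cV R r]_z \int[lebesgue_cV R r]_z'
    (c z z' * fine (h z))%:E = (H / Z)%:E)%E.
Proof.
move=> mh h0 hoo hH; case: pp => mp _ p1.
have mpz z : measurable_fun setT (fun z' => p z' z).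
  exact: (measurableT_comp mp (measurable_pair2 z)).
have mphi : measurable_fun setT (fun z : 'cV[R]_r => (gauss_pdf z)%:E).
  by apply/measurable_EFinP; exact: measurable_gauss_pdf.
transitivity (\int[lebesgue_cV R r]_z (Z^-1%:E * (h z * (gauss_pdf z)%:E)))%E.
  have mfh : measurable_fun setT (fun z => fine (h z)).
    by apply: measurableT_comp.
  have mE : measurable_fun setT (fun q : 'cV[R]_r * 'cV[R]_r =>
      (c q.1 q.2 * fine (h q.1))%:E).
    apply/measurable_EFinP; apply: measurable_funM; first exact: mc.
    exact: (measurableT_comp mfh measurable_fst).
  have E0 z z' : (0 <= (c z z' * fine (h z))%:E)%E.
    by rewrite lee_fin; apply: mulr_ge0; [exact: c_ge0|exact: fine_ge0].
  apply: ge0_ae_eq_integral.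
  - exact: measurableT.
  - exact: (measurable_fun_fubini_tonelli_F _ mE (fun q => E0 q.1 q.2)).
  - exact: (emeasurable_funM (measurable_cst _) (emeasurable_funM mh mphi)).
  - by move=> z _; apply: integral_ge0 => z' _.
  - move=> z _; apply: mule_ge0; first by rewrite lee_fin invr_ge0 ltW.
    by apply: mule_ge0; [exact: h0|rewrite lee_fin gauss_pdf_ge0].
  move: hoo; apply: filterS => z hz _.
  have hf : h z \is a fin_num by rewrite ge0_fin_numE.
  rewrite -(fineK hf) -!EFinM.
  transitivity (\int[lebesgue_cV R r]_z'
      ((gauss_pdf z / Z * fine (h z))%:E * (p z' z)%:E))%E.
    by apply: eq_integral => z' _; rewrite -EFinM /c; congr EFin; ring.
  have mEp : measurable_fun setT (fun z' => (p z' z)%:E).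
    by apply/measurable_EFinP; exact: mpz.
  have Ep0 z' : (0 <= (p z' z)%:E)%E by rewrite lee_fin; exact: p0.
  have k0 : 0 <= gauss_pdf z / Z * fine (h z).
    apply: mulr_ge0; last exact: fine_ge0.
    by apply: divr_ge0; [exact: gauss_pdf_ge0|exact: ltW].
  rewrite (ge0_integralZl_real _ mEp Ep0 k0) p1 mule1; congr EFin; ring.
have mhphi : measurable_fun setT (fun z => h z * (gauss_pdf z)%:E)%E.
  exact: (emeasurable_funM mh mphi).
have hphi0 z : (0 <= h z * (gauss_pdf z)%:E)%E.
  by apply: mule_ge0; [exact: h0|rewrite lee_fin gauss_pdf_ge0].
have Zi0 : 0 <= Z^-1 by rewrite invr_ge0 ltW.
rewrite (ge0_integralZl_real _ mhphi hphi0 Zi0).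
by rewrite -(integral_gauss_prob mh h0) hH -EFinM mulrC.
Qed.

Let ae_good : {ae lebesgue_cV R r, forall z, good z}.
Proof. exact: ae_extended_fin. Qed.

Let integral_split z : good z -> (\int[G]_s (split z s)%:E = (gb z)%:E)%E.
Proof.
move=> [z1 _]; rewrite (marginal_likelihoodE Ur Up g_gt0 dg) fineK.
  by [].
by rewrite (ge0_fin_numE (extended_marginal_ge0 Ur Up g_gt0 z)).
Qed.

Let integral_fisher z : good z ->
  (\int[G]_s (fisher_integrand (split z) s)%:E = (N z)%:E)%E.
Proof.
move=> [_ z2]; rewrite /N fineK.
  by [].
by rewrite (ge0_fin_numE (extended_fisher_ge0 Ur Up g_gt0 dg z)).
Qed.

Let G1 : G setT = 1%E. Proof. exact: probability_setT. Qed.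

Let Q1 : Q setT = 1%E. Proof. exact: power_measure_setT. Qed.

Let msplit z : measurable_fun setT (split z).
Proof.
exact: (measurableT_comp (measurable_split_likelihood Ur Up dg)
  (measurable_pair1 z)).
Qed.

Let split_gt0 z s : 0 < split z s. Proof. exact: g_gt0. Qed.

Let dsplit z : continuously_differentiable (split z).
Proof. exact: continuously_differentiable_affine. Qed.

Let mmeanz z : measurable_fun setT (mean z).
Proof. exact: measurable_sample_mean. Qed.

Let mean_int z : good z -> (\int[Q]_s (mean z s)%:E = (gb z)%:E)%E.
Proof.
move=> gz; apply: integral_sample_mean.
- exact: G1.
- exact: msplit.
- by move=> s; exact/ltW/split_gt0.
- exact: integral_split.
- exact: m_gt0.
Qed.

(** The marginal flow has total mass [Z / Z = 1] and its Fisher counterpart [Z * Res / Z = Res];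
    these are the constants [X] and [Y] of [integral_gap_le]. *)
Lemma acceptance_gap_le (al be : R) : 0 <= al -> 0 <= be ->
  (forall z z', good z -> good z' -> ((S (z, z'))%:E <= I (z, z') +
     (al * (c z z' * gb z + c z' z * gb z') +
      be * (c z z' * N z + c z' z * N z'))%:E)%E) ->
  (0 <= E_alpha_star g Ur Up p - E_alpha_1 g Ur Up p m <=
   (2 * al + 2 * be * Res)%:E)%E.
Proof.
move=> al0 be0 SI; rewrite E_alpha_starE E_alpha_1E.
have mx : measurable_fun setT
    (fun q : 'cV[R]_r * 'cV[R]_r => c q.1 q.2 * gb q.1).
  exact: (measurable_funM mc (measurableT_comp mgb measurable_fst)).
have my : measurable_fun setT
    (fun q : 'cV[R]_r * 'cV[R]_r => c q.1 q.2 * N q.1).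
  exact: (measurable_funM mc (measurableT_comp mN measurable_fst)).
have := @integral_gap_le _ _ R (lebesgue_cV R r) S
  (fun q => c q.1 q.2 * gb q.1) (fun q => c q.1 q.2 * N q.1) I good
  mS mx my mI _ _ _ I_ge0 ae_good _ _ al be 1 Res al0 be0.
rewrite mulr1; apply.
- move=> q; rewrite /S le_min.
  by apply/andP; split; exact: (mulr_ge0 (c_ge0 _ _) (gb_ge0 _)).
- by move=> q; exact: (mulr_ge0 (c_ge0 _ _) (gb_ge0 _)).
- by move=> q; exact: (mulr_ge0 (c_ge0 _ _) (N_ge0 _)).
- by move=> z z'; rewrite /S ge_min lexx.
- move=> z z' gz gz'; rewrite IE SE.
  exact: (integral_min_le Q1 (mmeanz z) (mmeanz z') (mean_ge0 z) (mean_ge0 z')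
    (mean_int gz) (mean_int gz') (c_ge0 z z') (c_ge0 z' z)).
- transitivity ((Z / Z)%:E); last by rewrite (divff (lt0r_neq0 Z_gt0)).
  rewrite -(integral_c _ _ _ (integral_gauss_extended_marginal g_gt0 dg
    evidence_fin UU VV UV)).
  + by apply: eq_integral => z _; apply: eq_integral => z' _;
      rewrite /= marginal_likelihoodE.
  + exact: measurable_extended_marginal.
  + exact: extended_marginal_ge0.
  + by move: ae_good; apply: filterS => z [].
- transitivity ((Z * Res / Z)%:E); last first.
    by rewrite mulrAC (divff (lt0r_neq0 Z_gt0)) mul1r.
  rewrite -(integral_c _ _ _ (integral_gauss_extended_fisher g_gt0 dg
    evidence_fin UU VV UV Hwd)).
  + by [].
  + exact: measurable_extended_fisher.
  + exact: extended_fisher_ge0.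
  + by move: ae_good; apply: filterS => z [].
- exact: SI.
Qed.

Let mean_norm_le z (t : R) : good z -> 0 < t ->
  (\int[Q]_s (`|mean z s - gb z|%R)%:E <= (pi / 4 * (t * gb z + N z / t))%:E)%E.
Proof.
move=> gz t0.
have H := fiber_norm_le (split_gt0 z) (dsplit z) (integral_split gz)
  (integral_fisher gz) t0.
apply: le_trans H.
apply: integral_sample_mean_norm_le.
- exact: G1.
- exact: msplit.
- exact: m_gt0.
Qed.

Lemma acceptance_gap_le_norm (t : R) : 0 < t ->
  (0 <= E_alpha_star g Ur Up p - E_alpha_1 g Ur Up p m <=
   (pi / 4 * (t + Res / t))%:E)%E.
Proof.
move=> t0; have pi0 := @pi_ge0 R.
(* The coefficients multiply the factor 1/2 of the minimum by [pi / 4] from the fiber bound. *)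
have al0 : 0 <= pi * t / 8.
  by apply: divr_ge0; [apply: mulr_ge0; [exact: pi0|exact: ltW]|exact: ler0n].
have be0 : 0 <= pi / (8 * t).
  by apply: divr_ge0; [exact: pi0|apply: mulr_ge0; [exact: ler0n|exact: ltW]].
have -> : pi / 4 * (t + Res / t) = 2 * (pi * t / 8) + 2 * (pi / (8 * t)) * Res.
  by field; rewrite gt_eqF.
apply: (acceptance_gap_le al0 be0) => z z' gz gz'; rewrite IE SE.
apply: (le_trans (min_le_integral_min_norm Q1 (mmeanz z) (mmeanz z') (mean_ge0 z)
  (mean_ge0 z') (mean_int gz) (mean_int gz') (c_ge0 z z') (c_ge0 z' z))).
apply: leeD; first exact: lexx.
have -> : pi * t / 8 * (c z z' * gb z + c z' z * gb z') +
    pi / (8 * t) * (c z z' * N z + c z' z * N z') =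
    c z z' / 2 * (pi / 4 * (t * gb z + N z / t)) +
    c z' z / 2 * (pi / 4 * (t * gb z' + N z' / t)).
  by field; rewrite gt_eqF.
have half (x : R) : 0 <= x -> (0 <= (x / 2)%:E)%E.
  by move=> x0; rewrite lee_fin; apply: divr_ge0.
rewrite EFinD; apply: leeD; rewrite [X in (_ <= X)%E]EFinM; apply: lee_wpmul2l.
- exact: half.
- exact: mean_norm_le.
- exact: half.
- exact: mean_norm_le.
Qed.

Let gb_gt0 z : good z -> 0 < gb z.
Proof.
by move=> gz; exact: (integral_pos_gt0 G1 (msplit z) (split_gt0 z) (integral_split gz)).
Qed.

Let mean_sqr_le z (C : R) : good z ->
  (forall x, g x / gb (Ur^T *m x) <= C) ->
  (\int[Q]_s ((mean z s - gb z) ^+ 2)%:E <=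
   (gb z * (pi ^+ 2 / 8 * C * N z / m%:R))%:E)%E.
Proof.
move=> gz gC.
have split_le s : split z s <= C * gb z.
  (* Every point of the fiber over [z] projects back to [z], so the ratio bound becomes a bound by a
     constant on that fiber. *)
  have := gC (Ur *m z + Up *m s).
  rewrite mulmxDr !mulmxA UU UV mul1mx mul0mx addr0.
  by rewrite ler_pdivrMr ?gb_gt0.
have H := fiber_sqr_le (split_gt0 z) (dsplit z) (integral_split gz)
  (integral_fisher gz) split_le.
have split_ge0 s : 0 <= split z s by exact: ltW (split_gt0 z s).
have var : (\int[G]_s ((split z s - gb z) ^+ 2)%:E < +oo)%E.
  by apply: (le_lt_trans H); rewrite ltry.
rewrite [X in (X <= _)%E](integral_sample_mean_sqr G1 (msplit z) split_ge0
  (integral_split gz) m_gt0 var).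
have -> : gb z * (pi ^+ 2 / 8 * C * N z / m%:R) =
    m%:R^-1 * (gb z * (pi ^+ 2 / 8 * C * N z)) by ring.
by rewrite EFinM; apply: lee_wpmul2l => //; rewrite lee_fin invr_ge0.
Qed.

Lemma acceptance_gap_le_sqr (C t : R) :
  (forall x, g x / gb (Ur^T *m x) <= C) -> 0 <= C -> 0 < t ->
  (0 <= E_alpha_star g Ur Up p - E_alpha_1 g Ur Up p m <=
   (t / 4 + pi ^+ 2 * C * Res / (16 * m%:R * t))%:E)%E.
Proof.
move=> gC C0 t0.
have mR : 0 < m%:R :> R by rewrite ltr0n.
have al0 : 0 <= t / 8 by apply: divr_ge0 => //; exact: ltW.
(* The coefficient is the AM-GM factor times the variance constant of a fiber, divided by the sample
   size. *)
have be0 : 0 <= (4 * t)^-1 * (pi ^+ 2 / 8 * C / m%:R).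
  apply: mulr_ge0; first by rewrite invr_ge0; apply: mulr_ge0 => //; exact: ltW.
  apply: divr_ge0; last exact: ltW.
  by apply: mulr_ge0 => //; apply: divr_ge0 => //; exact: sqr_ge0.
have -> : t / 4 + pi ^+ 2 * C * Res / (16 * m%:R * t) =
    2 * (t / 8) + 2 * ((4 * t)^-1 * (pi ^+ 2 / 8 * C / m%:R)) * Res.
  by field; rewrite !gt_eqF.
apply: (acceptance_gap_le al0 be0) => z z' gz gz'; rewrite IE SE.
have := min_le_integral_min_sqr Q1 (mmeanz z) (mmeanz z') (mean_ge0 z)
  (mean_ge0 z') (mean_int gz) (mean_int gz') (c_ge0 z z') (c_ge0 z' z) t0
  (gb_gt0 gz) (gb_gt0 gz') (mean_sqr_le gz gC) (mean_sqr_le gz' gC).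
move/le_trans; apply; apply: leeD; first exact: lexx.
rewrite lee_fin le_eqVlt; apply/orP; left; apply/eqP.
by field; rewrite !gt_eqF.
Qed.

(** Up to the positive factor [Z], the residual is an integral of a nonnegative function. *)
Lemma trace_residual_ge0 : 0 <= Res.
Proof.
rewrite -(pmulr_rge0 _ Z_gt0) -lee_fin.
rewrite -(integral_gauss_extended_fisher g_gt0 dg evidence_fin UU VV UV Hwd).
by apply: integral_ge0 => z _; exact: extended_fisher_ge0.
Qed.

Lemma likelihood_ratio_bound_ge0 (C : R) :
  (forall x, g x / gb (Ur^T *m x) <= C) -> 0 <= C.
Proof. by move=> /(_ 0); apply: le_trans; apply: divr_ge0 => //; exact: ltW. Qed.

End acceptance_gap.

Theorem proposition4p4 (R : realType) (d r m : nat) (g : 'cV[R]_d -> R)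
    (Ur : 'M[R]_(d, r)) (Up : 'M[R]_(d, d - r))
    (p : 'cV[R]_r -> 'cV[R]_r -> R) :
  (forall z, 0 < g z) ->
  continuously_differentiable g ->
  (0 < evidence g < +oo)%E ->
  Hmx_well_defined g ->
  Ur^T *m Ur = 1%:M ->
  Up^T *m Up = 1%:M ->
  Ur^T *m Up = 0 ->
  (1 <= m)%N ->
  proposal_density p ->
  (0 <= E_alpha_star g Ur Up p - E_alpha_1 g Ur Up p m
     <= (2 * Num.sqrt (trace_residual Ur (Hmx g)))%:E)%E /\
  (forall C : R,
    (forall z, g z / marginal_likelihood g Ur Up (Ur^T *m z) <= C) ->
    (0 <= E_alpha_star g Ur Up p - E_alpha_1 g Ur Up p m
       <= (Num.sqrt C / Num.sqrt m%:R *
           Num.sqrt (trace_residual Ur (Hmx g)))%:E)%E).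
Proof.
move=> g0 dg ev Hwd UU VV UV m0 pp.
set Res := trace_residual Ur (Hmx g).
set gap := (E_alpha_star g Ur Up p - E_alpha_1 g Ur Up p m)%E.
have Res0 : 0 <= Res := trace_residual_ge0 g0 dg ev Hwd UU VV UV.
have gap1 (t : R) : 0 < t -> (0 <= gap <= (pi / 4 * (t + Res / t))%:E)%E.
  exact: (acceptance_gap_le_norm g0 dg ev Hwd UU VV UV m0 pp).
have pi4 : pi <= 4 :> R by have := pihalf_lt2 R; lra.
have pi0 : 0 <= pi :> R := pi_ge0 R.
split=> [|C gC]; apply/andP; split.
- by case/andP: (gap1 1 ltr01).
- have -> : 2 * Num.sqrt Res = Num.sqrt (4 * Res).
    rewrite sqrtrM// (_ : 4 = 2 ^+ 2) ?sqrtr_sqr ?ger0_norm//.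
    by rewrite -natrX.
  apply: le_sqrt_optimize => t t0.
  (* Halving the parameter matches [t / 2 + K / (2 * t)] with [K = 4 * Res]; the factor [pi / 4] is
     then at most 1. *)
  have t20 : 0 < t / 2 by rewrite divr_gt0.
  case/andP: (gap1 _ t20) => _ /le_trans; apply; rewrite lee_fin.
  have -> : t / 2 + 4 * Res / (2 * t) = t / 2 + Res / (t / 2).
    by field; rewrite gt_eqF.
  rewrite ler_piMl//; first by rewrite addr_ge0 ?divr_ge0// ltW.
  by rewrite ler_pdivrMr// mul1r.
- by case/andP: (gap1 1 ltr01).
- have C0 : 0 <= C := likelihood_ratio_bound_ge0 g0 dg gC.
  have mR : 0 < m%:R :> R by rewrite ltr0n.
  have -> : Num.sqrt C / Num.sqrt m%:R * Num.sqrt Res = Num.sqrt (C / m%:R * Res).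
    by rewrite !sqrtrM ?divr_ge0// ?sqrtrV// ltW.
  apply: le_sqrt_optimize => t t0.
  (* Doubling the parameter matches [K = C / m%:R * Res]; the remaining factor [pi ^+ 2 / 16] is at
     most 1. *)
  have t20 : 0 < 2 * t by rewrite mulr_gt0.
  have := acceptance_gap_le_sqr g0 dg ev Hwd UU VV UV m0 pp gC C0 t20.
  rewrite -/Res -/gap => /andP[_ /le_trans]; apply; rewrite lee_fin.
  have -> : 2 * t / 4 + pi ^+ 2 * C * Res / (16 * m%:R * (2 * t)) =
      t / 2 + pi ^+ 2 / 16 * (C / m%:R * Res / (2 * t)).
    by field; rewrite !gt_eqF.
  rewrite lerD2l ler_piMl//.
    by rewrite !(divr_ge0, mulr_ge0)// ltW.
  by rewrite ler_pdivrMr// mul1r; nra.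
Qed.
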